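(* Consider the system $\partial_t u=\mathcal L(u)=A(u)+\sum_{j=1}^d B_j(u)\,\partial_j u$ for $u(t,x)\in\mathbb R^m$, where $A:\mathbb R^m\to\mathbb R^m$ and $B_j:\mathbb R^m\to\mathbb R^{m\times m}$ are analytic. Let $u_0$ be an analytic stationary solution, i.e. $\mathcal L(u_0)=0$, let $L=d\mathcal L(u_0)$ be the linearized operator and let $Q(v)=\mathcal L(u_0+v)-Lv$ be the nonlinearity. Let $\sigma=\sup_{\lambda\in Sp(L)}\Re\lambda$. Assume: 1. $\sigma$ is finite, and there exists an eigenvalue $\lambda_0$ of $L$, with eigenvector $U_{\lambda_0}$, such that $\Re\lambda_0>0$, $\Re\lambda_0>\sigma/2$ and $\mathcal G[U_{\lambda_0}](\rho_0)<+\infty$ for some $\rho_0>0$. 2. There is a constant $C_0$ such that, for every $\lambda\in\mathbb C$ with $\Re\lambda\ge 2\Re\lambda_0$, the operator $\lambda-L$ is invertible and, for any function $u$ and any $0\le\rho\le\rho_0$ with $\mathcal G[u](\rho)<+\infty$, $$\mathcal G\bigl[(\lambda-L)^{-1}u\bigr](\rho)\le\frac{C_0}{|\lambda|}\,\mathcal G[u](\rho).$$ 3. $Q$ is quadratic, $Q(v)=Q(v,v)$ with $Q(\cdot,\cdot)$ bilinear, and there is a constant $C_Q$ such that, for any $0\le\rho\le\rho_0$ and any functions $u,v$, $$\mathcal G[Q(u,v)](\rho)\le C_Q\,\mathcal G[u](\rho)\,\mathcal G[\nabla_x v](\rho).$$ Then $u_0$ is nonlinearly unstable in the following sense: there exist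 $\varepsilon_1>0$ and $\rho_1>0$ such that for any $\delta_1>0$ there exist a time $T$ and a solution $u(t)$ of $\partial_t u=\mathcal L(u)$ on the time interval $[0,T]$ satisfying $$\mathcal G[u(0)-u_0](\rho_1)\le\delta_1\qquad\text{and}\qquad\|u(T)-u_0\|_{L^\infty}\ge\varepsilon_1 .$$
   Context: The space variable $x$ ranges over a domain $\Omega\subset\mathbb R^d$ on which the system is posed. Generator function: for a smooth scalar function $u$ on $\Omega$ and $\rho\ge 0$, $$\mathcal G[u](\rho)=\sum_{\alpha\in\mathbb N^d}\|\partial_x^\alpha u\|_{L^\infty(\Omega)}\frac{\rho^{|\alpha|}}{\alpha!}\in[0,+\infty].$$ For vector-valued functions (in particular for $\nabla_x v$), $\mathcal G$ is the sum of the generator functions of the components. A function $u$ is called analytic if $\mathcal G[u](\rho)<+\infty$ for some $\rho>0$. Linearized operator: $Lu=\nabla_uA(u_0)\cdot u+\sum_j[\nabla_uB_j(u_0)\cdot u]\,\partial_j u_0+\sum_jB_j(u_0)\,\partial_j u$, acting on complex-valued functions. $Sp(L)$ is the spectrum of $L$, regarded as an unbounded operator on a fixed Banach space of functions on $\Omega$. With $u=u_0+v$, the system becomes $\partial_tv=Lv+Q(v)$. *)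

(* Defs.v *)
From HB Require Import structures.
From mathcomp Require Import all_boot all_order all_algebra.
From mathcomp Require Import complex.
From mathcomp Require Import all_classical all_reals all_analysis.

Set Implicit Arguments.
Unset Strict Implicit.
Unset Printing Implicit Defensive.

Import Order.TTheory GRing.Theory Num.Theory.
Import numFieldNormedType.Exports.

Local Open Scope classical_set_scope.
Local Open Scope ring_scope.

(* Functions on Omega are represented by total functions on R^d; only their
   values on Omega matter (Omega is always open below, so the derivatives at a
   point of Omega do not see the values outside Omega). *)

Section MultiIndices.
Variable n : nat.

Definition multi_index := {ffun 'I_n -> nat}.

Definition mi_deg (alpha : multi_index) : nat := (\sum_(i < n) alpha i)%N.

Definition mi_fact (alpha : multi_index) : nat := (\prod_(i < n) (alpha i)`!)%N.

Definition mi_pow (R : pzRingType) (y : 'cV[R]_n) (alpha : multi_index) : R :=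
  \prod_(i < n) y i 0 ^+ alpha i.

End MultiIndices.

(* Near every point, f is the sum of an absolutely convergent power series; the
   N-th partial sum runs over the multi-indices in {0,...,N-1}^n. *)
Definition real_analytic (R : realType) (n : nat) (f : 'cV[R]_n -> R) : Prop :=
  forall a : 'cV[R]_n, exists (c : multi_index n -> R) (r : R),
    [/\ 0 < r,
        (\esum_(alpha in [set: multi_index n])
           (`|c alpha| * r ^+ mi_deg alpha)%:E < +oo)%E &
        forall x, `|x - a| < r ->
          (\sum_(alpha : {ffun 'I_n -> 'I_N})
             c [ffun i => nat_of_ord (alpha i)] *
             mi_pow (x - a) [ffun i => nat_of_ord (alpha i)])
          @[N --> \oo] --> f x].

Section Derivatives.
Context {R : realType} {d : nat} {W : normedModType R}.
Implicit Types (Omega : set 'cV[R]_d) (f : 'cV[R]_d -> W).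

Definition basis_vec (j : 'I_d) : 'cV[R]_d := delta_mx j 0.

Definition partial (j : 'I_d) f : 'cV[R]_d -> W :=
  fun x => 'D_(basis_vec j) f x.

Definition partials (s : seq 'I_d) f : 'cV[R]_d -> W := foldr partial f s.

(* For smooth f the order of the differentiations is irrelevant. *)
Definition mi_partial (alpha : multi_index d) f : 'cV[R]_d -> W :=
  foldr (fun j => iter (alpha j) (partial j)) f (enum 'I_d).

Definition C1_on Omega f : Prop :=
  forall x, Omega x -> forall j,
    derivable f x (basis_vec j) /\ {for x, continuous (partial j f)}.

Definition smooth_on Omega f : Prop :=
  forall s x, Omega x ->
    {for x, continuous (partials s f)} /\
    forall j, derivable (partials s f) x (basis_vec j).

(* On continuous functions on an open set, the supremum is the essential
   supremum for the Lebesgue measure. *)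
Definition Linfty Omega f : \bar R := ereal_sup [set `|f x|%:E | x in Omega].

End Derivatives.

Section ComplexValued.
Context {R : realType} {T : Type}.

Definition re_fun (f : T -> R[i]) : T -> R := fun x => complex.Re (f x).
Definition im_fun (f : T -> R[i]) : T -> R := fun x => complex.Im (f x).

Definition re_col (m : nat) (f : T -> 'cV[R[i]]_m) : T -> 'cV[R]_m :=
  fun x => \col_i complex.Re (f x i 0).
Definition im_col (m : nat) (f : T -> 'cV[R[i]]_m) : T -> 'cV[R]_m :=
  fun x => \col_i complex.Im (f x i 0).

End ComplexValued.

(* The modulus, as an element of R (the library norm has values in R[i]). *)
Definition cmod {R : realType} (z : R[i]) : R := complex.Re `|z|.

Section Generator.
Context {R : realType} {d : nat}.
Implicit Types (Omega : set 'cV[R]_d) (rho : R).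

Definition gen_series (N : multi_index d -> \bar R) rho : \bar R :=
  (\esum_(alpha in [set: multi_index d])
     N alpha * (rho ^+ mi_deg alpha / (mi_fact alpha)%:R)%:E)%E.

(* The generator function of a scalar function. It is set to +oo on non-smooth
   functions, so that G f rho < +oo entails that f is smooth on Omega. *)
Definition G Omega (f : 'cV[R]_d -> R) rho : \bar R :=
  if `[< smooth_on Omega f >]
  then gen_series (fun alpha => Linfty Omega (mi_partial alpha f)) rho
  else +oo%E.

(* The same for a complex scalar function, whose derivatives are computed on
   the real and imaginary parts. *)
Definition GC Omega (f : 'cV[R]_d -> R[i]) rho : \bar R :=
  if `[< smooth_on Omega (re_fun f) /\ smooth_on Omega (im_fun f) >]
  then gen_series (fun alpha => Linfty Omega (fun x =>
         cmod (mi_partial alpha (re_fun f) x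
               +i* mi_partial alpha (im_fun f) x)%C)) rho
  else +oo%E.

Definition Gvec (m : nat) Omega (u : 'cV[R]_d -> 'cV[R]_m) rho : \bar R :=
  (\sum_(i < m) G Omega (fun x => u x i 0%R) rho)%E.

Definition GCvec (m : nat) Omega (u : 'cV[R]_d -> 'cV[R[i]]_m) rho : \bar R :=
  (\sum_(i < m) GC Omega (fun x => u x i 0%R) rho)%E.

Definition Ggrad (m : nat) Omega (v : 'cV[R]_d -> 'cV[R]_m) rho : \bar R :=
  (\sum_(j < d) \sum_(i < m) G Omega (partial j (fun x => v x i 0%R)) rho)%E.

Definition analytic_on (m : nat) Omega (u : 'cV[R]_d -> 'cV[R]_m) : Prop :=
  exists2 rho, 0 < rho & (Gvec Omega u rho < +oo)%E.

End Generator.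

Section System.
Context {R : realType} {d m : nat}.
Variables (A : 'cV[R]_m -> 'cV[R]_m) (B : 'I_d -> 'cV[R]_m -> 'M[R]_m).
Implicit Types (Omega : set 'cV[R]_d) (u v : 'cV[R]_d -> 'cV[R]_m).

Definition Lcal u : 'cV[R]_d -> 'cV[R]_m :=
  fun x => A (u x) + \sum_(j < d) B j (u x) *m partial j u x.

Definition linearized (u0 v : 'cV[R]_d -> 'cV[R]_m) : 'cV[R]_d -> 'cV[R]_m :=
  fun x => 'D_(v x) A (u0 x)
           + \sum_(j < d) 'D_(v x) (B j) (u0 x) *m partial j u0 x
           + \sum_(j < d) B j (u0 x) *m partial j v x.

Definition linearizedC (u0 : 'cV[R]_d -> 'cV[R]_m) (w : 'cV[R]_d -> 'cV[R[i]]_m) :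
    'cV[R]_d -> 'cV[R[i]]_m :=
  fun x => \col_i (linearized u0 (re_col w) x i 0
                   +i* linearized u0 (im_col w) x i 0)%C.

Definition nonlinearity (u0 v : 'cV[R]_d -> 'cV[R]_m) : 'cV[R]_d -> 'cV[R]_m :=
  fun x => Lcal (fun y => u0 y + v y) x - linearized u0 v x.

(* Classical solutions of du/dt = Lcal u on [0, T] x Omega. A function on [0, T]
   with one-sided derivatives at 0 and T extends to a function differentiable
   there, so the two-sided derivative at the endpoints is no restriction. *)
Definition is_solution Omega (T : R) (u : R -> 'cV[R]_d -> 'cV[R]_m) : Prop :=
  [/\ forall t x, 0 <= t <= T -> Omega x ->
        forall j, derivable (u t) x (basis_vec j),
      {within `[0, T] `*` Omega, continuous (fun p => u p.1 p.2)},
      forall j, {within `[0, T] `*` Omega,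
                   continuous (fun p => partial j (u p.1) p.2)} &
      forall t x, 0 <= t <= T -> Omega x ->
        is_derive t 1 (fun s => u s x) (Lcal (u t) x)].

End System.

(* Q is a well-defined bilinear operation on smooth functions on Omega. *)
Definition bilinear_on (R : realType) (d m : nat) (Omega : set 'cV[R]_d)
    (Q : ('cV[R]_d -> 'cV[R]_m) -> ('cV[R]_d -> 'cV[R]_m) ->
         'cV[R]_d -> 'cV[R]_m) : Prop :=
  [/\ forall u u' v v', smooth_on Omega u -> smooth_on Omega u' ->
        smooth_on Omega v -> smooth_on Omega v' ->
        {in Omega, u =1 u'} -> {in Omega, v =1 v'} ->
        {in Omega, Q u v =1 Q u' v'},
      forall (a : R) u u' v, smooth_on Omega u -> smooth_on Omega u' ->
        smooth_on Omega v ->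
        {in Omega, Q (fun x => a *: u x + u' x) v
                   =1 (fun x => a *: Q u v x + Q u' v x)} &
      forall (a : R) u v v', smooth_on Omega u -> smooth_on Omega v ->
        smooth_on Omega v' ->
        {in Omega, Q u (fun x => a *: v x + v' x)
                   =1 (fun x => a *: Q u v x + Q u v' x)}].

(* A complex Banach space whose elements are identified, through fs_fun, with
   C^m-valued functions on Omega. *)
Record function_space (R : realType) (d m : nat) (Omega : set 'cV[R]_d) :=
  FunctionSpace {
    fs_sort :> completeNormedModType R[i];
    fs_fun : fs_sort -> 'cV[R]_d -> 'cV[R[i]]_m;
    fs_linear : forall (a : R[i]) (f g : fs_sort),
      {in Omega, fs_fun (a *: f + g) =1 (fun x => a *: fs_fun f x + fs_fun g x)};
    fs_inj : forall f g : fs_sort, {in Omega, fs_fun f =1 fs_fun g} -> f = g }.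

Record unbounded_operator (R : realType) (X : completeNormedModType R[i]) :=
  UnboundedOperator {
    op_dom : set X;
    op_fun :> X -> X;
    op_dom0 : op_dom 0;
    op_dom_linear : forall (a : R[i]) f g,
      op_dom f -> op_dom g -> op_dom (a *: f + g);
    op_linear : forall (a : R[i]) f g, op_dom f -> op_dom g ->
      op_fun (a *: f + g) = a *: op_fun f + op_fun g }.

Section Spectrum.
Context {R : realType} {X : completeNormedModType R[i]}.
Variable L : unbounded_operator X.
Implicit Types lambda : R[i].

Definition is_resolvent lambda (S : X -> X) : Prop :=
  [/\ forall g, op_dom L (S g),
      forall g, lambda *: S g - L (S g) = g,
      forall f, op_dom L f -> S (lambda *: f - L f) = f &
      continuous S].

Definition spectrum : set R[i] :=
  [set lambda | ~ exists S, is_resolvent lambda S].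

Definition spectral_bound : \bar R :=
  ereal_sup [set (complex.Re lambda)%:E | lambda in spectrum].

Definition is_eigenvector lambda (U : X) : Prop :=
  [/\ op_dom L U, U != 0 & L U = lambda *: U].

End Spectrum.

(* L acts on X as the linearization of Lcal at u0. The domain of L is left free
   (it encodes, e.g., boundary conditions) and may contain functions that are
   not classically differentiable. *)
Definition is_linearization (R : realType) (d m : nat) (Omega : set 'cV[R]_d)
    (A : 'cV[R]_m -> 'cV[R]_m) (B : 'I_d -> 'cV[R]_m -> 'M[R]_m)
    (u0 : 'cV[R]_d -> 'cV[R]_m) (X : function_space m Omega)
    (L : unbounded_operator X) : Prop :=
  forall f : X, op_dom L f ->
    C1_on Omega (re_col (fs_fun f)) -> C1_on Omega (im_col (fs_fun f)) ->
    {in Omega, fs_fun (L f) =1 linearizedC A B u0 (fs_fun f)}.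

(* Main.v *)
Require Import Defs.
From HB Require Import structures.
From mathcomp Require Import all_boot all_order all_algebra.
From mathcomp Require Import complex.
From mathcomp Require Import all_classical all_reals all_analysis.
From mathcomp Require Import zify ring lra.
Import Order.TTheory GRing.Theory Num.Theory.
Import numFieldNormedType.Exports.
Local Open Scope classical_set_scope.
Local Open Scope ring_scope.

Set Implicit Arguments.
Unset Strict Implicit.
Unset Printing Implicit Defensive.

(** The solution is sought as a series u = u0 + sum_(n >= 1) v_n of exponentials in
    time. Write r for the real part of lambda0. The leading term v_1 is the real part of
    eps e^(lambda0 t) U (or of i times this, [eigenmode]), and v_n collects the terms of
    growth rate n r. Inserting the series into dv/dt = L v + Q(v, v) and sorting by
    growth rate gives

      dv_n/dt - L v_n = sum_(k + l = n) Q(v_k, v_l),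

    where only k, l >= 1 contribute. The source on the right is a finite sum of modes Re
    (e^((n r + i w) t) z), and for each of them one inverts lambda - L at lambda = n r +
    i w. For n >= 2 this is in the half plane where the resolvent is bounded, by C0 /
    |lambda| <= C0 / (n r). All fields are real: a complex amplitude z is stored as the
    pair of its real and imaginary parts, and the product of two real parts is half the
    real part of z z' + z conj z' ([Q_modes_at], [mode_solve], [cascade]).

    Each application of Q loses a derivative, and the generator function controls
    derivatives only at a smaller radius: G[grad v](rho') is at most d / (rho - rho')
    times G[v](rho) ([G_partial], [Ggrad_le]). As in the Cauchy-Kovalevskaya theorem,
    the radius is lowered by a fraction 1/(l + 1) of what is left at order l, which
    costs a factor l, and the factor 1/n of the resolvent compensates this cost. The
    outcome ([majorant]) is that v_n has size at most a q^(n-1) / n^2 at time 0 and a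
    fixed radius rho1 < rho0, with a and q proportional to eps. When eps is small, the
    series and its derivatives in space and time therefore converge uniformly for t < 1
    ([level_bounds]).

    Dominated convergence for series ([cvg_dominated_series]) then shows that the sum
    may be differentiated term by term, that L may be applied term by term, and that
    Q(v, v) is the sum of its expansion by total order, which is a Cauchy product
    ([Q_vsum_vsum]). Hence the sum solves the system ([solution_is_solution]).

    For the instability eps is fixed. At time 0 the leading term has size at least eps c
    at some point, while the terms of order at least two sum up to O(eps^2), which is at
    most eps c / 2 ([amplitude]). At time -T the bound on every term, hence on the sum,
    has decreased by a factor e^(-r T), so that the sum is below any prescribed delta
    for T large. Translating time by T gives a solution that starts within delta of u0
    and ends at distance at least eps c / 2 from it. *)

(** * Series dominated by a summable sequence *)

Section DominatedSeries.
Context {R : realType}.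
Implicit Types c M : nat -> R.

Definition ssum (c : nat -> R) : R := limn (series c).

Lemma dominated_cvg_series c M :
  (forall n, `|c n| <= M n) -> cvgn (series M) -> cvgn (series c).
Proof.
move=> cM cvM; apply: normed_cvg; apply: series_le_cvg cvM => n //=.
by rewrite (le_trans _ (cM n)).
Qed.

Lemma dominated_tail c M N :
  (forall n, `|c n| <= M n) -> cvgn (series M) ->
  `|ssum c - series c N| <= ssum M - series M N.
Proof.
move=> cM cvM; have cvc := dominated_cvg_series cM cvM.
have lc : `|series c n - series c N| @[n --> \oo] --> `|ssum c - series c N|.
  by apply: cvg_norm; apply: cvgB => //; exact: cvg_cst.
have lM : series M n - series M N @[n --> \oo] --> ssum M - series M N.
  by apply: cvgB => //; exact: cvg_cst.
apply: ler_cvg_to lc lM _; near=> n.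
have Nn : (N <= n)%N by near: n; exact: nbhs_infty_ge.
rewrite !sub_series_geq//; apply: le_trans (ler_norm_sum _ _ _) _.
exact: ler_sum.
Unshelve. all: by end_near. Qed.

Lemma ssum_norm_le c M :
  (forall n, `|c n| <= M n) -> cvgn (series M) -> `|ssum c| <= ssum M.
Proof.
move=> cM cvM; have := dominated_tail 0 cM cvM.
by rewrite /series/= !big_geq// !subr0.
Qed.

(** Dominated convergence for series: a limit may be taken term by term when
    the terms have a common summable bound, because the tails are then
    uniformly small and a finite sum passes to the limit. *)
Lemma cvg_dominated_series {T : Type} (F : set_system T) {FF : ProperFilter F}
    (a : nat -> T -> R) (b M : nat -> R) :
  (\forall t \near F, forall n, `|a n t| <= M n) ->
  (forall n, a n t @[t --> F] --> b n) -> cvgn (series M) ->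
  ssum (a ^~ t) @[t --> F] --> ssum b.
Proof.
move=> aM ab cvM.
have bM n : `|b n| <= M n.
  have l1 : `|a n t| @[t --> F] --> `|b n| by apply: cvg_norm; exact: ab.
  by apply: (cvgr_to_le l1); apply: filterS aM => t; exact.
apply/cvgrPdist_le => e e0.
have /cvgrPdist_le/(_ (e / 4)) := cvM; rewrite divr_gt0// => /(_ isT)[N _ HN].
have {}HN : ssum M - series M N <= e / 4.
  by apply: le_trans (HN N (leqnn N)); exact: ler_norm.
(* The head of the series converges as a finite sum, the two tails are below e / 4. *)
have fin : (series (a ^~ t) N) @[t --> F] --> series b N.
  rewrite /series /=; elim: N {HN} => [|N IH].
    by under eq_fun do rewrite big_geq//; rewrite big_geq//; exact: cvg_cst.
  under eq_fun do rewrite big_nat_recr//=.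
  by rewrite big_nat_recr//=; apply: cvgD; [exact: IH|exact: ab].
have /cvgrPdist_le/(_ (e / 4)) := fin; rewrite divr_gt0// => /(_ isT) near_fin.
near=> t.
have aMt : forall n, `|a n t| <= M n by near: t.
have h1 := dominated_tail N aMt cvM.
have h2 := dominated_tail N bM cvM.
have h3 : `|series b N - series (a ^~ t) N| <= e / 4 by near: t.
have -> : ssum b - ssum (a ^~ t) = (ssum b - series b N) +
  (series b N - series (a ^~ t) N) - (ssum (a ^~ t) - series (a ^~ t) N) by ring.
apply: le_trans (ler_normB _ _) _.
have h4 := ler_normD (ssum b - series b N) (series b N - series (a ^~ t) N).
have : e / 4 * 4 = e by rewrite divfK.
lra.
Unshelve. all: by end_near. Qed.

Lemma ssumD c c' : cvgn (series c) -> cvgn (series c') ->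
  ssum (fun n => c n + c' n) = ssum c + ssum c'.
Proof. by move=> h h'; rewrite /ssum -lim_seriesD. Qed.

Lemma ssumZ c (k : R) : cvgn (series c) ->
  ssum (fun n => k * c n) = k * ssum c.
Proof. by move=> h; rewrite /ssum -[RHS](lim_seriesZ k h). Qed.

Lemma ssum_sum (I : Type) (s : seq I) (c : I -> nat -> R) :
  (forall i, cvgn (series (c i))) ->
  ssum (fun n => \sum_(i <- s) c i n) = \sum_(i <- s) ssum (c i) /\
  cvgn (series (fun n => \sum_(i <- s) c i n)).
Proof.
move=> cvc; elim: s => [|i s [IH1 IH2]].
  have E : series (fun n => \sum_(i <- [::]) c i n) = cst 0.
    apply/funext => n; rewrite /series/=.
    by under eq_bigr do rewrite big_nil; rewrite big1.
  split; last by rewrite E; exact: is_cvg_cst.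
  by rewrite big_nil /ssum E; exact: lim_cst.
have -> : (fun n => \sum_(j <- i :: s) c j n) =
  (fun n => c i n + \sum_(j <- s) c j n).
  by apply/funext => n; rewrite big_cons.
split; first by rewrite big_cons ssumD// IH1.
exact: (is_cvg_seriesD (cvc i) IH2).
Qed.

End DominatedSeries.

(** * Derivatives along lines and termwise differentiation *)

Section LineDerivative.
Context {R : realType} {V : normedModType R}.
Implicit Types (f : V -> R) (x v : V).

Lemma is_derive_line f x v (s : R) : derivable f (x + s *: v) v ->
  is_derive s (1 : R) (fun t => f (x + t *: v)) ('D_v f (x + s *: v)).
Proof.
move=> df.
have E : (fun h : R => h^-1 *: (((fun t => f (x + t *: v)) \o shift s) (h *: (1 : R))
            - f (x + s *: v))) =
         (fun h : R => h^-1 *: ((f \o shift (x + s *: v)) (h *: v) - f (x + s *: v))).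
  apply/funext => h /=; congr (_ *: (f _ - _)).
  by rewrite [_ *: 1]mulr1 scalerDl addrCA addrC -!addrA addrC -!addrA.
split; first by rewrite /derivable E.
by rewrite /derive E.
Qed.

Lemma is_derive_translate f (w x v : V) : derivable f (x + w) v ->
  is_derive x v (fun y => f (y + w)) ('D_v f (x + w)).
Proof.
move=> df.
have E : (fun h : R => h^-1 *: (((fun y => f (y + w)) \o shift x) (h *: v)
            - f (x + w))) =
         (fun h : R => h^-1 *: ((f \o shift (x + w)) (h *: v) - f (x + w))).
  by apply/funext => h /=; rewrite addrA.
split; first by rewrite /derivable E.
by rewrite /derive E.
Qed.

Lemma is_derive_lin (a : R) f g x v (df dg : R) :
  is_derive x v f df -> is_derive x v g dg ->
  is_derive x v (fun y => a * f y + g y) (a * df + dg).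
Proof. by move=> Df Dg; exact: is_deriveD (is_deriveZ a Df) Dg. Qed.

(** The mean value theorem for the restriction of f to a line; h may be negative, hence
    the absolute values. *)
Lemma line_MVT f x v (h : R) :
  (forall s, `|s| <= `|h| -> derivable f (x + s *: v) v) ->
  exists2 s, `|s| <= `|h| & f (x + h *: v) - f x = 'D_v f (x + s *: v) * h.
Proof.
move=> df.
have D s : `|s| <= `|h| -> is_derive s (1 : R) (fun t => f (x + t *: v))
    ('D_v f (x + s *: v)) by move=> /df/is_derive_line.
have C a b : `|a| <= `|h| -> `|b| <= `|h| ->
    {within `[a, b], continuous (fun t => f (x + t *: v))}.
  move=> ah bh; apply: derivable_within_continuous => s; rewrite in_itv/= => /andP[as_ sb].
  apply: ex_derive; apply: D; rewrite ler_norml; move: ah bh; rewrite !ler_norml.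
  by move=> /andP[a1 a2] /andP[b1 b2]; rewrite (le_trans a1 as_) (le_trans sb b2).
have [h0|h0] := leP 0 h.
- have [||c] := @MVT_segment R (fun t => f (x + t *: v))
     (fun s => 'D_v f (x + s *: v)) 0 h h0.
  + move=> s; rewrite in_itv/= => /andP[s0 sh]; apply: D.
    by rewrite !ger0_norm// ltW.
  + by apply: C; rewrite ?normr0.
  + rewrite in_itv/= => /andP[c0 ch]; rewrite scale0r addr0 subr0 => ->.
    by exists c => //; rewrite !ger0_norm.
- have [||c] := @MVT_segment R (fun t => f (x + t *: v))
     (fun s => 'D_v f (x + s *: v)) h 0 (ltW h0).
  + move=> s; rewrite in_itv/= => /andP[sh s0]; apply: D.
    by rewrite !ltr0_norm// lerN2 ltW.
  + by apply: C; rewrite ?normr0.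
  + rewrite in_itv/= => /andP[ch c0]; rewrite scale0r addr0 sub0r mulrN.
    move=> E; exists c; first by rewrite ler0_norm// ltr0_norm// lerN2.
    by rewrite -[LHS]opprB E opprK.
Qed.

(** Termwise differentiation: the difference quotients of the terms are
    dominated by the bounds on their derivatives, so they may be summed before
    the limit is taken. *)
Lemma is_derive_ssum (f : nat -> V -> R) (M : nat -> R) x v (r : R) :
  0 < r -> cvgn (series M) ->
  (forall n s, `|s| < r -> `|f n (x + s *: v)| <= M n) ->
  (forall n s, `|s| < r -> derivable (f n) (x + s *: v) v) ->
  (forall n s, `|s| < r -> `|'D_v (f n) (x + s *: v)| <= M n) ->
  is_derive x v (fun y => ssum (f ^~ y)) (ssum (fun n => 'D_v (f n) x)).
Proof.
move=> r0 cvM fM df dfM.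
have x0 : x + 0 *: v = x by rewrite scale0r addr0.
have fM0 n : `|f n x| <= M n by rewrite -x0; apply: fM; rewrite normr0.
have df0 n : derivable (f n) x v by rewrite -x0; apply: df; rewrite normr0.
have cx := dominated_cvg_series fM0 cvM.
pose q n (h : R) : R := h^-1 * (f n (h *: v + x) - f n x).
have qD n : q n h @[h --> 0^'] --> 'D_v (f n) x by exact: df0.
have near_r : \forall h \near (0 : R)^', `|h| < r by exact: dnbhs0_lt.
have qM : \forall h \near (0 : R)^', forall n, `|q n h| <= M n.
  near=> h => n.
  have hr : `|h| < r by near: h.
  have h0 : h != 0 by near: h; exact: nbhs_dnbhs_neq.
  have [s sh E] := @line_MVT (f n) x v h (fun s sh => df n s (le_lt_trans sh hr)).
  rewrite /q [h *: v + x]addrC E [_^-1 * _]mulrC mulfK//.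
  by apply: dfM; exact: le_lt_trans hr.
have lim := cvg_dominated_series qM qD cvM.
pose Q (h : R) : R := h^-1 * (ssum (f ^~ (h *: v + x)) - ssum (f ^~ x)).
have E : \forall h \near (0 : R)^', ssum (q ^~ h) = Q h.
  near=> h.
  have hr : `|h| < r by near: h.
  have ch : cvgn (series (f ^~ (h *: v + x))).
    by apply: dominated_cvg_series cvM => n; rewrite addrC; exact: fM.
  rewrite /Q /q -[- ssum _]mulN1r -ssumZ// -ssumD//; last first.
    exact: (is_cvg_seriesZ (k := -1) cx).
  rewrite -ssumZ; last first.
    apply: (is_cvg_seriesD ch); exact: (is_cvg_seriesZ (k := -1) cx).
  by congr ssum; apply/funext => n; rewrite mulN1r.
have lim' : Q @ (0 : R)^' --> ssum (fun n => 'D_v (f n) x).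
  exact: (cvg_trans (near_eq_cvg E) (lim _)).
split; first by apply/cvg_ex; eexists; exact: lim'.
exact: (@cvg_lim _ _ _ _ _ _ _ lim').
Unshelve. all: by end_near. Qed.

End LineDerivative.

Lemma is_derive_scale {R : realType} (F : R -> R) (k t dF : R) :
  is_derive (k * t) 1 F dF -> is_derive t 1 (fun s => F (k * s)) (k * dF).
Proof.
move=> DF; have Dk : is_derive t 1 (fun s : R => k * s) k.
  by have := is_deriveZ k (is_derive_id t (1 : R)); rewrite [k *: 1]mulr1.
have d1 := @ex_derive _ _ _ _ _ _ _ Dk; have d2 := @ex_derive _ _ _ _ _ _ _ DF.
split.
  apply/derivable1_diffP; apply: differentiable_comp; exact/derivable1_diffP.
rewrite -derive1E (derive1_comp d1 d2) !derive1E.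
by rewrite (@derive_val _ _ _ _ _ _ _ Dk) (@derive_val _ _ _ _ _ _ _ DF) mulrC.
Qed.

(** * Iterated partial derivatives *)

Section Partials.
Context {R : realType} {d : nat}.
Variable Omega : set 'cV[R]_d.
Hypothesis Omega_open : open Omega.
Implicit Types f g : 'cV[R]_d -> R.

Lemma norm_basis_vec (j : 'I_d) : `|basis_vec j : 'cV[R]_d| <= 1.
Proof.
rewrite /Num.Def.normr/= mx_normrE bigmax_le// => -[a b] _ /=.
by rewrite mxE; case: (_ && _); rewrite ?normr1 ?normr0.
Qed.

Lemma near_open (P : 'cV[R]_d -> Prop) x :
  Omega x -> (forall y, Omega y -> P y) -> nbhs x P.
Proof. by move=> Ox HP; apply: filterS HP _; exact: open_nbhs_nbhs. Qed.

Lemma near_eq_on (W : Type) (f g : 'cV[R]_d -> W) x : Omega x -> (forall y, Omega y -> f y = g y) ->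
  {near x, f =1 g}.
Proof.
move=> Ox fg; have N : nbhs x (fun y => f y = g y) := near_open Ox fg.
exact: N.
Qed.

Lemma derivable_eq_on (W : normedModType R) (f g : 'cV[R]_d -> W) x v :
  Omega x -> (forall y, Omega y -> f y = g y) ->
  derivable f x v -> derivable g x v.
Proof.
by move=> Ox fg; exact: near_eq_derivable (near_eq_on Ox fg).
Qed.

Lemma derive_eq_on (W : normedModType R) (f g : 'cV[R]_d -> W) x v :
  Omega x -> (forall y, Omega y -> f y = g y) ->
  'D_v f x = 'D_v g x.
Proof.
by move=> Ox fg; exact: near_eq_derive (near_eq_on Ox fg).
Qed.

Lemma continuous_eq_on (W : normedModType R) (f g : 'cV[R]_d -> W) x :
  Omega x -> (forall y, Omega y -> f y = g y) ->
  {for x, continuous f} -> {for x, continuous g}.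
Proof.
move=> Ox fg; rewrite /prop_for /continuous_at -(fg x Ox) => cf.
apply: cvg_trans cf; exact: near_eq_cvg (near_eq_on Ox fg).
Qed.

Lemma partials_eq_on f g s : (forall y, Omega y -> f y = g y) ->
  forall y, Omega y -> partials s f y = partials s g y.
Proof.
by move=> fg; elim: s => [//|j s IH] y Oy /=; exact: derive_eq_on.
Qed.

Lemma partials_partial s j f : partials s (partial j f) = partials (rcons s j) f.
Proof. by rewrite /partials foldr_rcons. Qed.

Lemma partials_cat s s' f : partials (s ++ s') f = partials s (partials s' f).
Proof. by rewrite /partials foldr_cat. Qed.

Lemma smooth_on_partials s f : smooth_on Omega f -> smooth_on Omega (partials s f).
Proof. by move=> sf s' x Ox; rewrite -partials_cat; exact: sf. Qed.

Lemma smooth_on_partial j f : smooth_on Omega f -> smooth_on Omega (partial j f).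
Proof. exact: (@smooth_on_partials [:: j]). Qed.

Lemma partials_lin (a : R) f g s : smooth_on Omega f -> smooth_on Omega g ->
  forall x, Omega x ->
  partials s (fun y => a * f y + g y) x = a * partials s f x + partials s g x.
Proof.
move=> sf sg; elim: s => [//|j s IH] x Ox /=.
have [_ /(_ j) df] := sf s x Ox; have [_ /(_ j) dg] := sg s x Ox.
rewrite /partial (derive_eq_on _ Ox IH).
exact: (@derive_val _ _ _ _ _ _ _
  (is_derive_lin a (derivableP df) (derivableP dg))).
Qed.

Lemma smooth_on_lin (a : R) f g : smooth_on Omega f -> smooth_on Omega g ->
  smooth_on Omega (fun y => a * f y + g y).
Proof.
move=> sf sg s x Ox.
have E y (Oy : Omega y) := esym (partials_lin a s sf sg Oy).
have [cf df] := sf s x Ox; have [cg dg] := sg s x Ox.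
split.
  apply: (continuous_eq_on Ox E).
  exact: (cvgD (cvgM (cvg_cst a) cf) cg).
move=> j; apply: (derivable_eq_on Ox E).
exact: (@ex_derive _ _ _ _ _ _ _
  (is_derive_lin a (derivableP (df j)) (derivableP (dg j)))).
Qed.

Lemma ball_in_open x : Omega x ->
  exists2 r : R, 0 < r & forall y, `|y - x| < r -> Omega y.
Proof.
move=> Ox; have : nbhs x Omega by exact: open_nbhs_nbhs.
move=> /nbhs_ballP[r /= r0 xr]; exists r => // y yx; apply: xr.
by rewrite -ball_normE /ball_/= distrC.
Qed.

Lemma norm_two_steps (s t h : R) i j : `|s| <= `|h| -> `|t| <= `|h| ->
  `|s *: (basis_vec i : 'cV[R]_d) + t *: basis_vec j| <= 2 * `|h|.
Proof.
move=> sh th; apply: le_trans (ler_normD _ _) _; rewrite !normrZ.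
have hi := norm_basis_vec i; have hj := norm_basis_vec j.
have h1 : `|s| * `|basis_vec i : 'cV[R]_d| <= `|h| * 1 by apply: ler_pM.
have h2 : `|t| * `|basis_vec j : 'cV[R]_d| <= `|h| * 1 by apply: ler_pM.
by lra.
Qed.

(** Two applications of the mean value theorem to the second difference of f
    over a small square. *)
Lemma second_difference f x (r h : R) i j :
  (forall y, `|y - x| < r -> Omega y) -> 2 * `|h| < r -> smooth_on Omega f ->
  exists2 z, `|z - x| <= 2 * `|h| &
    (f (x + h *: basis_vec i + h *: basis_vec j) - f (x + h *: basis_vec i)) -
    (f (x + h *: basis_vec j) - f x) = partial j (partial i f) z * (h * h).
Proof.
move=> xr hr sf.
have O s t : `|s| <= `|h| -> `|t| <= `|h| ->
    Omega (x + s *: basis_vec i + t *: basis_vec j).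
  move=> sh th; apply: xr; rewrite addrC !addrA addNr add0r.
  by apply: le_lt_trans hr; exact: norm_two_steps.
have h0 : `|0 : R| <= `|h| by rewrite normr0.
have O1 s : `|s| <= `|h| -> Omega (x + s *: basis_vec i).
  by move=> sh; have := O s 0 sh h0; rewrite scale0r addr0.
have dg s : `|s| <= `|h| ->
    is_derive (x + s *: basis_vec i) (basis_vec i)
      (fun y => f (y + h *: basis_vec j) - f y)
      (partial i f (x + s *: basis_vec i + h *: basis_vec j) -
       partial i f (x + s *: basis_vec i)).
  move=> sh; apply: is_deriveB.
    by apply: is_derive_translate; exact: (sf [::] _ (O _ _ sh (lexx _))).2.
  by apply: derivableP; exact: (sf [::] _ (O1 _ sh)).2.
have [s sh ->] := @line_MVT R _ (fun y => f (y + h *: basis_vec j) - f y) x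
  (basis_vec i) h (fun s sh => @ex_derive _ _ _ _ _ _ _ (dg s sh)).
rewrite (@derive_val _ _ _ _ _ _ _ (dg s sh)).
have [t th ->] := @line_MVT R _ (partial i f) (x + s *: basis_vec i)
  (basis_vec j) h (fun t th => (sf [:: i] _ (O _ _ sh th)).2 j).
rewrite -mulrA.
exists (x + s *: basis_vec i + t *: basis_vec j) => //.
by rewrite addrC !addrA addNr add0r; exact: norm_two_steps.
Qed.

Lemma ler_dist_mid (a b c e : R) :
  `|a - c| <= e / 2 -> `|b - c| <= e / 2 -> `|a - b| <= e.
Proof.
by move=> ac bc; have := ler_normB (a - c) (b - c); rewrite opprB addrA subrK; lra.
Qed.

(** Symmetry of second derivatives: both mixed derivatives are limits of the
    same second difference quotient. *)
Lemma partialC f i j x : smooth_on Omega f -> Omega x ->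
  partial i (partial j f) x = partial j (partial i f) x.
Proof.
move=> sf Ox; have [r r0 xr] := ball_in_open Ox.
apply/eqP; rewrite -subr_eq0 -normr_eq0 eq_le normr_ge0 andbT.
apply/ler_addgt0Pl => e e0; rewrite addr0.
have e2 : 0 < e / 2 by rewrite divr_gt0.
have /cvgrPdist_le/(_ (e / 2) e2)/nbhs_ballP[r1 /= r10 H1] := (sf [:: i; j] x Ox).1.
have /cvgrPdist_le/(_ (e / 2) e2)/nbhs_ballP[r2 /= r20 H2] := (sf [:: j; i] x Ox).1.
pose m := Num.min r (Num.min r1 r2).
have m0 : 0 < m by rewrite !lt_min r0 r10 r20.
pose h := m / 4.
have h0 : 0 < h by rewrite divr_gt0.
have hm : 2 * `|h| < m by rewrite gtr0_norm// /h; lra.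
have [mr mr1 mr2] : [/\ m <= r, m <= r1 & m <= r2].
  by rewrite /m !ge_min !lexx !orbT.
have [z1 z1x E1] := second_difference i j xr (lt_le_trans hm mr) sf.
have [z2 z2x E2] := second_difference j i xr (lt_le_trans hm mr) sf.
have E : partial j (partial i f) z1 = partial i (partial j f) z2.
  have hh : h * h != 0 by rewrite mulf_neq0// gt_eqF.
  apply: (mulIf hh); apply: (etrans (esym E1)); apply: (etrans _ E2).
  have sq (a b c k : R) : (a - b) - (c - k) = (a - c) - (b - k) by ring.
  rewrite sq; congr ((f _ - _) - _); exact: addrAC.
have near1 z : `|z - x| <= 2 * `|h| -> m <= r1 -> ball x r1 z.
  by move=> zx mr'; rewrite -ball_normE /ball_/= distrC; exact: le_lt_trans zx (lt_le_trans hm _).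
have near2 z : `|z - x| <= 2 * `|h| -> m <= r2 -> ball x r2 z.
  by move=> zx mr'; rewrite -ball_normE /ball_/= distrC; exact: le_lt_trans zx (lt_le_trans hm _).
have := H2 z1 (near2 z1 z1x mr2); have := H1 z2 (near1 z2 z2x mr1).
rewrite /= E; exact: ler_dist_mid.
Qed.

(** Iterated derivatives only depend on how often each variable occurs, so
    that the derivatives indexed by a multi-index control all of them. *)
Lemma partials_perm f s s' x : smooth_on Omega f -> perm_eq s s' -> Omega x ->
  partials s f x = partials s' f x.
Proof.
move=> sf; elim: s s' x => [|i s IH] s' x.
  by rewrite perm_sym => /perm_nilP ->.
move=> ps Ox.
have : i \in s' by rewrite -(perm_mem ps) mem_head.
move=> /path.splitPr E; case: E ps => p1 p2 ps.
have {}ps : perm_eq s (p1 ++ p2).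
  by move: ps; rewrite perm_sym perm_catC cat_cons perm_cons perm_catC perm_sym.
rewrite /= /partial (derive_eq_on _ Ox (fun y => IH _ y ps)).
rewrite -/(partial i _ x) -[partial i _ x]/(partials (i :: p1 ++ p2) f x).
elim: p1 x Ox {IH ps} => [//|j p1 IH] x Ox.
rewrite [RHS]/= /partial -(derive_eq_on _ Ox IH).
have sm : smooth_on Omega (partials (p1 ++ p2) f) by exact: smooth_on_partials.
exact: (partialC i j sm Ox).
Qed.

End Partials.

(** * Generator series and multi-indices *)

Section GeneratorSeries.
Context {R : realType} {d : nat}.
Implicit Types (alpha : multi_index d) (N : multi_index d -> \bar R).

(** The coefficient rho^|alpha| / alpha! of the generator series. *)
Definition weight (rho : R) alpha : R := rho ^+ mi_deg alpha / (mi_fact alpha)%:R.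

Lemma mi_fact_gt0 alpha : 0 < (mi_fact alpha)%:R :> R.
Proof. by rewrite ltr0n /mi_fact prodn_gt0// => i; exact: fact_gt0. Qed.

Lemma weight_ge0 rho alpha : 0 <= rho -> 0 <= weight rho alpha.
Proof. by move=> r0; rewrite divr_ge0// ?exprn_ge0// ltW ?mi_fact_gt0. Qed.

Lemma weight_gt0 rho alpha : 0 < rho -> 0 < weight rho alpha.
Proof. by move=> r0; rewrite divr_gt0 ?exprn_gt0 ?mi_fact_gt0. Qed.

(** Real bounds l on the sup norms reduce an upper bound on a generator function to
    one on finite sums of real numbers. *)
Lemma gen_series_le N (l : multi_index d -> R) (rho B : R) : 0 <= rho ->
  (forall alpha, (N alpha <= (l alpha)%:E)%E) ->
  (forall s : seq (multi_index d), uniq s ->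
     \sum_(alpha <- s) l alpha * weight rho alpha <= B) ->
  (gen_series N rho <= B%:E)%E.
Proof.
move=> r0 Nl sB; apply: ge_ereal_sup => _ [X [finX _] <-].
rewrite fsbig_finite//=; have := finmap.fset_uniq (fset_set X).
move: (finmap.enum_fset _) => s us.
have := sB s us; rewrite -lee_fin -sumEFin; apply: le_trans.
apply: lee_sum => a _; rewrite [leRHS]EFinM; apply: lee_wpmul2r => //.
by rewrite lee_fin weight_ge0.
Qed.

Lemma gen_series_term N (rho B : R) : 0 < rho -> (forall alpha, (0 <= N alpha)%E) ->
  (gen_series N rho <= B%:E)%E ->
  forall s : seq (multi_index d), uniq s ->
    (\sum_(alpha <- s) N alpha * (weight rho alpha)%:E <= B%:E)%E.
Proof.
move=> r0 N0 NB s us; apply: le_trans NB; apply: esum_ge.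
exists [set` s]; last by rewrite fsbig_seq.
by split => //; exact: finite_seq.
Qed.

Lemma gen_series_fin_num N (rho B : R) : 0 < rho -> (forall alpha, (0 <= N alpha)%E) ->
  (gen_series N rho <= B%:E)%E -> forall alpha, N alpha \is a fin_num.
Proof.
move=> r0 N0 NB alpha; have := gen_series_term r0 N0 NB (s := [:: alpha]) isT.
rewrite big_seq1 => NwB; rewrite ge0_fin_numE//; apply: contraTT NwB.
rewrite -leNgt leye_eq => /eqP ->; rewrite gt0_mulye ?lte_fin ?weight_gt0//.
Qed.

Lemma gen_series_ge N (rho B : R) : 0 < rho -> (forall alpha, (0 <= N alpha)%E) ->
  (gen_series N rho <= B%:E)%E ->
  forall s : seq (multi_index d), uniq s ->
    \sum_(alpha <- s) fine (N alpha) * weight rho alpha <= B.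
Proof.
move=> r0 N0 NB s us; rewrite -lee_fin -sumEFin.
apply: le_trans (gen_series_term r0 N0 NB us).
apply: lee_sum => a _; rewrite EFinM fineK//.
exact: gen_series_fin_num NB a.
Qed.

End GeneratorSeries.

Section MultiIndexDerivatives.
Context {R : realType} {d : nat}.
Implicit Types (alpha : multi_index d) (f : 'cV[R]_d -> R) (s : seq 'I_d).

(** The multi-index of a word in the variables, and conversely the word in
    which mi_partial differentiates. *)
Definition mi_of s : multi_index d := [ffun j => count_mem j s].

Definition mi_seq alpha : seq 'I_d := flatten [seq nseq (alpha j) j | j <- enum 'I_d].

Definition mi_succ (j : 'I_d) alpha : multi_index d :=
  [ffun i => (alpha i + (i == j))%N].

Lemma mi_partialE alpha f : mi_partial alpha f = partials (mi_seq alpha) f.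
Proof.
rewrite /mi_partial /mi_seq; elim: (enum 'I_d) => [//|j s IH] /=.
rewrite partials_cat -IH; elim: (alpha j) => [//|n IHn] /=.
by rewrite IHn.
Qed.

Lemma count_mi_seq alpha j : count_mem j (mi_seq alpha) = alpha j.
Proof.
rewrite /mi_seq count_flatten -map_comp sumnE big_map.
rewrite (bigD1_seq j) ?mem_enum ?enum_uniq//= count_nseq /= eqxx mul1n.
rewrite big1 ?addn0// => i ij; rewrite count_nseq /=.
by rewrite (negPf ij) mul0n.
Qed.

Lemma mi_deg_of s : mi_deg (mi_of s) = size s.
Proof.
rewrite /mi_deg; under eq_bigr do rewrite ffunE.
elim: s => [|k s IH] /=; first by rewrite big1.
rewrite big_split/= IH -add1n; congr addn.
by rewrite (bigD1 k)//= eqxx big1// => i ik; rewrite eq_sym (negPf ik).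
Qed.

Variable Omega : set 'cV[R]_d.
Hypothesis Omega_open : open Omega.

Lemma perm_count_mem (s s' : seq 'I_d) :
  (forall i, count_mem i s = count_mem i s') -> perm_eq s s'.
Proof. by move=> E; apply/allP => i _ /=; rewrite E. Qed.

Lemma partials_mi s f x : smooth_on Omega f -> Omega x ->
  partials s f x = mi_partial (mi_of s) f x.
Proof.
move=> sf Ox; rewrite mi_partialE; apply: partials_perm sf _ Ox => //.
by apply: perm_count_mem => i; rewrite count_mi_seq ffunE.
Qed.

Lemma mi_partial_partial alpha j f x : smooth_on Omega f -> Omega x ->
  mi_partial alpha (partial j f) x = mi_partial (mi_succ j alpha) f x.
Proof.
move=> sf Ox; rewrite !mi_partialE partials_partial.
apply: partials_perm sf _ Ox => //.
apply: perm_count_mem => i; rewrite -cats1 count_cat !count_mi_seq ffunE/=.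
by rewrite addn0 eq_sym.
Qed.

Lemma mi_deg_succ j alpha : mi_deg (mi_succ j alpha) = (mi_deg alpha).+1.
Proof.
rewrite /mi_deg; under eq_bigr do rewrite ffunE.
rewrite big_split/= -addn1; congr addn.
by rewrite (bigD1 j)//= eqxx big1// => i /negPf ->.
Qed.

Lemma mi_fact_succ j alpha :
  mi_fact (mi_succ j alpha) = ((alpha j).+1 * mi_fact alpha)%N.
Proof.
rewrite /mi_fact (bigD1 j)//= [in RHS](bigD1 j)//= ffunE eqxx addn1 factS mulnA.
congr muln; apply: eq_bigr => i /negPf ij.
by rewrite ffunE ij addn0.
Qed.

Lemma mi_succ_inj j : injective (mi_succ j).
Proof.
move=> a b /ffunP E; apply/ffunP => i; have := E i; rewrite !ffunE.
exact: addIn.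
Qed.

Lemma leq_mi_deg alpha j : (alpha j <= mi_deg alpha)%N.
Proof. by rewrite /mi_deg (bigD1 j)//= leq_addr. Qed.

End MultiIndexDerivatives.

(** * Estimates for the generator function *)

Section GeneratorBounds.
Context {R : realType} {d : nat}.
Variable Omega : set 'cV[R]_d.
Hypothesis Omega_open : open Omega.
Hypothesis Omega_nonempty : Omega !=set0.
Implicit Types (alpha : multi_index d) (f g : 'cV[R]_d -> R) (rho B : R).

Lemma Linfty_ge f x : Omega x -> (`|f x|%:E <= Linfty Omega f)%E.
Proof. by move=> Ox; apply: ereal_sup_ubound; exists x. Qed.

Lemma Linfty_ge0 f : (0 <= Linfty Omega f)%E.
Proof.
have [x Ox] := Omega_nonempty; apply: le_trans (Linfty_ge f Ox).
by rewrite lee_fin.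
Qed.

Lemma Linfty_le f (l : R) : (forall x, Omega x -> `|f x| <= l) ->
  (Linfty Omega f <= l%:E)%E.
Proof.
by move=> fl; apply: ge_ereal_sup => _ [x Ox <-]; rewrite lee_fin; exact: fl.
Qed.

Lemma fine_Linfty_ge f x : Linfty Omega f \is a fin_num -> Omega x ->
  `|f x| <= fine (Linfty Omega f).
Proof. by move=> Lf Ox; rewrite -lee_fin fineK//; exact: Linfty_ge. Qed.

(** Finiteness also encodes smoothness, since G is infinite on functions that
    are not smooth. *)
Definition finG f rho : Prop := (G Omega f rho < +oo)%E.

Definition gnorm f rho : R := fine (G Omega f rho).

(** The sup norm of one derivative, a real number when finG holds. *)
Definition dsup f alpha : R := fine (Linfty Omega (mi_partial alpha f)).

Lemma G_smooth f rho : smooth_on Omega f ->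
  G Omega f rho = gen_series (fun alpha => Linfty Omega (mi_partial alpha f)) rho.
Proof. by move=> sf; rewrite /G asboolT. Qed.

Lemma G_ge0 f rho : 0 <= rho -> (0 <= G Omega f rho)%E.
Proof.
move=> r0; rewrite /G; case: ifP => // _; apply: esum_ge0 => a _.
by rewrite mule_ge0 ?Linfty_ge0// lee_fin; exact: weight_ge0.
Qed.

Lemma finG_smooth f rho : finG f rho -> smooth_on Omega f.
Proof. by rewrite /finG /G; case: ifP => // /asboolP. Qed.

Lemma G_fineK f rho : 0 <= rho -> finG f rho -> G Omega f rho = (gnorm f rho)%:E.
Proof. by move=> r0 Gf; rewrite /gnorm fineK// ge0_fin_numE// G_ge0. Qed.

Lemma gnorm_ge0 f rho : 0 <= rho -> 0 <= gnorm f rho.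
Proof. by move=> r0; rewrite fine_ge0// G_ge0. Qed.

Lemma G_le_finG f rho B : (G Omega f rho <= B%:E)%E -> finG f rho.
Proof. by move=> GB; apply: le_lt_trans GB _; rewrite ltry. Qed.

Lemma G_le_gnorm f rho B : 0 <= rho -> (G Omega f rho <= B%:E)%E -> gnorm f rho <= B.
Proof. by move=> r0 GB; rewrite -lee_fin -G_fineK//; exact: G_le_finG GB. Qed.

Lemma G_le f rho (l : multi_index d -> R) B : smooth_on Omega f -> 0 <= rho ->
  (forall alpha x, Omega x -> `|mi_partial alpha f x| <= l alpha) ->
  (forall s, uniq s -> \sum_(alpha <- s) l alpha * weight rho alpha <= B) ->
  (G Omega f rho <= B%:E)%E.
Proof.
move=> sf r0 fl lB; rewrite /G asboolT//; apply: (@gen_series_le _ _ _ l) => // a.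
by apply: Linfty_le => x; exact: fl.
Qed.

Lemma finG_gen_series f rho : 0 < rho -> finG f rho ->
  (gen_series (fun alpha => Linfty Omega (mi_partial alpha f)) rho
     <= (gnorm f rho)%:E)%E.
Proof.
move=> r0 Gf; rewrite -G_fineK ?(ltW r0)// /G asboolT//; exact: finG_smooth Gf.
Qed.

Lemma dsup_sum f rho s : 0 < rho -> finG f rho -> uniq s ->
  \sum_(alpha <- s) dsup f alpha * weight rho alpha <= gnorm f rho.
Proof.
move=> r0 Gf us; apply: (gen_series_ge r0 _ (finG_gen_series r0 Gf) us) => a.
exact: Linfty_ge0.
Qed.

Lemma dsup_ge f rho alpha x : 0 < rho -> finG f rho -> Omega x ->
  `|mi_partial alpha f x| <= dsup f alpha.
Proof.
move=> r0 Gf Ox; apply: fine_Linfty_ge => //.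
apply: (gen_series_fin_num r0 _ (finG_gen_series r0 Gf)) => a.
exact: Linfty_ge0.
Qed.

Lemma dsup_ge0 f alpha : 0 <= dsup f alpha.
Proof. by rewrite fine_ge0// Linfty_ge0. Qed.

(** Cauchy estimates: a single term of the series bounds one derivative. *)
Lemma partials_le f rho s x : 0 < rho -> finG f rho -> Omega x ->
  `|partials s f x| <= (mi_fact (mi_of s))%:R / rho ^+ size s * gnorm f rho.
Proof.
move=> r0 Gf Ox; rewrite (partials_mi Omega_open _ (finG_smooth Gf) Ox).
apply: le_trans (dsup_ge _ r0 Gf Ox) _.
have := @dsup_sum f rho [:: mi_of s] r0 Gf isT; rewrite big_seq1 /weight mi_deg_of.
have F0 := mi_fact_gt0 (R := R) (mi_of s).
have P0 : 0 < rho ^+ size s by exact: exprn_gt0.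
by rewrite -ler_pdivlMr ?divr_gt0// invf_div mulrC.
Qed.

Lemma abs_le_gnorm f rho x : 0 < rho -> finG f rho -> Omega x -> `|f x| <= gnorm f rho.
Proof.
move=> r0 Gf Ox; have := partials_le [::] r0 Gf Ox.
suff -> : mi_fact (mi_of [::] : multi_index d) = 1%N by rewrite expr0 divr1 mul1r.
by rewrite /mi_fact big1// => i _; rewrite ffunE.
Qed.

Lemma G_lin (a : R) f g rho : 0 < rho -> finG f rho -> finG g rho ->
  (G Omega (fun x => a * f x + g x)%R rho <= (`|a| * gnorm f rho + gnorm g rho)%:E)%E.
Proof.
move=> r0 Gf Gg; have sf := finG_smooth Gf; have sg := finG_smooth Gg.
apply: (@G_le _ _ (fun al => `|a| * dsup f al + dsup g al)).
- exact: (smooth_on_lin Omega_open a sf sg).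
- exact: ltW.
- move=> al x Ox; rewrite mi_partialE (partials_lin Omega_open a _ sf sg Ox) -!mi_partialE.
  apply: le_trans (ler_normD _ _) _; rewrite normrM.
  apply: lerD; last exact: (dsup_ge al r0 Gg Ox).
  by apply: ler_wpM2l => //; exact: (dsup_ge al r0 Gf Ox).
- move=> s us; under eq_bigr do rewrite mulrDl -mulrA.
  rewrite big_split/= -mulr_sumr; apply: lerD; last exact: dsup_sum.
  by apply: ler_wpM2l => //; exact: dsup_sum.
Qed.

Lemma G_mono f rho rho' : 0 <= rho' <= rho -> 0 < rho -> finG f rho ->
  (G Omega f rho' <= (gnorm f rho)%:E)%E.
Proof.
move=> /andP[r0 rr] rp Gf; apply: (@G_le _ _ (dsup f)).
- exact: finG_smooth Gf.
- exact: r0.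
- by move=> a x Ox; exact: (dsup_ge a rp Gf Ox).
- move=> s us; apply: le_trans (dsup_sum rp Gf us).
  apply: ler_sum => a _; rewrite ler_wpM2l ?dsup_ge0//.
  by rewrite ler_wpM2r ?invr_ge0 ?ler0n// lerXn2r ?nnegrE// (le_trans r0).
Qed.

(** By convexity, the derivative of x^(k+1) at the smaller point y is at most its
    slope between y and x. *)
Lemma exprn_slope (x y : R) k : 0 <= y <= x ->
  k.+1%:R * y ^+ k * (x - y) <= x ^+ k.+1.
Proof.
move=> /andP[y0 yx]; have x0 := le_trans y0 yx.
have xy0 : 0 <= x - y by rewrite subr_ge0.
elim: k => [|k IH]; first by rewrite expr0 !mulr1 mul1r expr1 lerBlDr lerDl.
have h1 := ler_wpM2l y0 IH.
have h2 : y ^+ k.+1 * (x - y) <= x ^+ k.+1 * (x - y).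
  by apply: ler_wpM2r => //; apply: lerXn2r; rewrite ?nnegrE.
rewrite (_ : k.+2%:R * y ^+ k.+1 * (x - y) =
  y * (k.+1%:R * y ^+ k * (x - y)) + y ^+ k.+1 * (x - y)); last first.
  by rewrite (exprS y k) -(natr1 k.+1); ring.
rewrite [leRHS](_ : _ = y * x ^+ k.+1 + x ^+ k.+1 * (x - y)); last first.
  by rewrite (exprS x k.+1); ring.
exact: lerD.
Qed.

(** The Cauchy estimate that costs a derivative against a loss of radius:
    termwise it is the slope bound above. *)
Lemma G_partial j f rho rho' : 0 <= rho' < rho -> finG f rho ->
  (G Omega (partial j f) rho' <= (gnorm f rho / (rho - rho'))%:E)%E.
Proof.
move=> /andP[r0 rr] Gf; have rp := le_lt_trans r0 rr.
have sf := finG_smooth Gf; have D0 : 0 < rho - rho' by rewrite subr_gt0.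
apply: (@G_le _ _ (fun al => dsup f (mi_succ j al))).
- exact: (smooth_on_partial j sf).
- exact: r0.
- move=> al x Ox; rewrite (mi_partial_partial Omega_open al j sf Ox).
  exact: (dsup_ge _ rp Gf Ox).
move=> s us; rewrite ler_pdivlMr// mulr_suml.
(* Raising the index alpha_j is injective, so the shifted family is again a family
   of distinct terms of the series at the larger radius. *)
have us' : uniq (map (mi_succ j) s) by rewrite map_inj_uniq//; exact: mi_succ_inj.
apply: le_trans (dsup_sum rp Gf us'); rewrite big_map; apply: ler_sum => al _.
rewrite -mulrA ler_wpM2l ?dsup_ge0// /weight mi_deg_succ mi_fact_succ.
have F0 := mi_fact_gt0 (R := R) al.
rewrite natrM ler_pdivlMr; last by rewrite mulr_gt0// ltr0n.
have -> : rho' ^+ mi_deg al / (mi_fact al)%:R * (rho - rho') *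
    ((al j).+1%:R * (mi_fact al)%:R) =
    (al j).+1%:R * rho' ^+ mi_deg al * (rho - rho') by field; rewrite (gt_eqF F0).
have yx : 0 <= rho' <= rho by rewrite r0 ltW.
apply: le_trans (exprn_slope (mi_deg al) yx).
by rewrite ler_wpM2r ?(ltW D0)// ler_wpM2r ?exprn_ge0// ler_nat ltnS leq_mi_deg.
Qed.

Section Series.
Variables (f : nat -> 'cV[R]_d -> R) (M : nat -> R) (rho : R).
Hypothesis rho_gt0 : 0 < rho.
Hypothesis f_fin : forall n, finG (f n) rho.
Hypothesis f_le : forall n, gnorm (f n) rho <= M n.
Hypothesis M_cvg : cvgn (series M).

Let K (s : seq 'I_d) : R := (mi_fact (mi_of s))%:R / rho ^+ size s.

Let K_ge0 s : 0 <= K s.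
Proof. by rewrite divr_ge0 ?ler0n// exprn_ge0// ltW. Qed.

Lemma partials_term_le s n x : Omega x -> `|partials s (f n) x| <= K s * M n.
Proof.
move=> Ox; apply: le_trans (partials_le s rho_gt0 (f_fin n) Ox) _.
exact: (ler_wpM2l (K_ge0 s) (f_le n)).
Qed.

Let M_ge0 n : 0 <= M n.
Proof. by apply: le_trans (f_le n); exact: gnorm_ge0 (ltW rho_gt0). Qed.

Lemma cvg_series_partials s x : Omega x -> cvgn (series (fun n => partials s (f n) x)).
Proof.
move=> Ox; apply: dominated_cvg_series (is_cvg_seriesZ (k := K s) M_cvg) => n.
exact: (partials_term_le s n Ox).
Qed.

Lemma is_derive_ssum_partials s j x : Omega x ->
  is_derive x (basis_vec j) (fun y => ssum (fun n => partials s (f n) y))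
    (ssum (fun n => partials (j :: s) (f n) x)).
Proof.
move=> Ox; have [r r0 xr] := ball_in_open Omega_open Ox.
have O t : `|t| < r -> Omega (x + t *: basis_vec j).
  move=> tr; apply: xr; rewrite addrAC subrr add0r normrZ.
  by apply: le_lt_trans tr; rewrite ler_piMr//; exact: norm_basis_vec.
apply: (@is_derive_ssum _ _ (fun n => partials s (f n))
   (fun n => (K s + K (j :: s)) * M n) x (basis_vec j) r r0).
- exact: is_cvg_seriesZ M_cvg.
- move=> n t /O Ot; apply: le_trans (partials_term_le s n Ot) _.
  by rewrite ler_wpM2r// lerDl.
- by move=> n t /O Ot; exact: (finG_smooth (f_fin n) s Ot).2.
- move=> n t /O Ot; apply: le_trans (partials_term_le (j :: s) n Ot) _.
  by rewrite ler_wpM2r// lerDr.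
Qed.

(** By the Cauchy estimates, the derivatives of any given order of the terms are
    dominated by a multiple of M, so that termwise differentiation may be iterated. *)
Lemma partials_ssum s x : Omega x ->
  partials s (fun y => ssum (f ^~ y)) x = ssum (fun n => partials s (f n) x).
Proof.
elim: s x => [//|j s IH] x Ox /=.
rewrite /partial (derive_eq_on Omega_open _ Ox IH).
exact: (@derive_val _ _ _ _ _ _ _ (is_derive_ssum_partials s j Ox)).
Qed.

Lemma continuous_ssum_partials s x : Omega x ->
  {for x, continuous (fun y => ssum (fun n => partials s (f n) y))}.
Proof.
move=> Ox; apply: (@cvg_dominated_series _ _ (nbhs x) _ (fun n => partials s (f n))
   (fun n => partials s (f n) x) (fun n => K s * M n)).
- apply: (near_open Omega_open Ox) => y Oy n; exact: partials_term_le.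
- move=> n; exact: (finG_smooth (f_fin n) s Ox).1.
- exact: is_cvg_seriesZ M_cvg.
Qed.

Lemma smooth_on_ssum : smooth_on Omega (fun y => ssum (f ^~ y)).
Proof.
move=> s x Ox; have E y (Oy : Omega y) := esym (partials_ssum s Oy).
split.
  exact: (continuous_eq_on Omega_open Ox E (@continuous_ssum_partials s x Ox)).
move=> j; apply: (derivable_eq_on Omega_open Ox E).
exact: (@ex_derive _ _ _ _ _ _ _ (is_derive_ssum_partials s j Ox)).
Qed.

(** The sup norms of the derivatives of a sum are dominated by the sums of
    the sup norms; exchanging the sum over n with a finite sum over alpha gives the bound. *)
Lemma G_ssum : (G Omega (fun y => ssum (f ^~ y))%R rho <= (ssum M)%:E)%E.
Proof.
have lcM n al : dsup (f n) al <= (mi_fact al)%:R / rho ^+ mi_deg al * M n.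
  have W0 := weight_gt0 al rho_gt0.
  have := @dsup_sum (f n) rho [:: al] rho_gt0 (f_fin n) isT; rewrite big_seq1.
  move=> /le_trans/(_ (f_le n)); rewrite -ler_pdivlMr// mulrC.
  by rewrite /weight invf_div.
have cl al : cvgn (series (fun n => dsup (f n) al)).
  apply: (dominated_cvg_series (M := fun n => (mi_fact al)%:R / rho ^+ mi_deg al * M n)).
    by move=> n; rewrite ger0_norm ?dsup_ge0.
  exact: is_cvg_seriesZ M_cvg.
apply: (@G_le _ _ (fun al => ssum (fun n => dsup (f n) al))).
- exact: smooth_on_ssum.
- exact: ltW.
- move=> al x Ox; rewrite mi_partialE partials_ssum//.
  apply: ssum_norm_le (cl al) => n; rewrite -mi_partialE.
  exact: (dsup_ge _ rho_gt0 (f_fin n) Ox).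
move=> s us.
have cl' al : cvgn (series (fun n => weight rho al * dsup (f n) al)).
  exact: is_cvg_seriesZ.
have [E cS] := ssum_sum s cl'.
rewrite (eq_bigr (fun al => ssum (fun n => weight rho al * dsup (f n) al))); last first.
  by move=> al _; rewrite ssumZ// mulrC.
rewrite -E; apply: le_trans (ler_norm _) _.
apply: ssum_norm_le => // n.
rewrite (eq_bigr (fun al => dsup (f n) al * weight rho al)); last first.
  by move=> al _; rewrite mulrC.
rewrite ger0_norm; first exact: le_trans (dsup_sum rho_gt0 (f_fin n) us) (f_le n).
by apply: sumr_ge0 => al _; rewrite mulr_ge0 ?dsup_ge0 ?weight_ge0 ?ltW.
Qed.

End Series.

End GeneratorBounds.

(** * Generator functions of vector-valued and complex-valued functions *)

Section ComplexModulus.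
Context {R : realType}.

Lemma cmodE (a b : R) : cmod (a +i* b)%C = Num.sqrt (a ^+ 2 + b ^+ 2).
Proof. by rewrite /cmod normc_def. Qed.

Lemma cmod_ge_Re (a b : R) : `|a| <= cmod (a +i* b)%C.
Proof. by rewrite cmodE -sqrtr_sqr ler_wsqrtr// lerDl sqr_ge0. Qed.

Lemma cmod_ge_Im (a b : R) : `|b| <= cmod (a +i* b)%C.
Proof. by rewrite cmodE -sqrtr_sqr ler_wsqrtr// lerDr sqr_ge0. Qed.

Lemma cmod_le (a b : R) : cmod (a +i* b)%C <= `|a| + `|b|.
Proof.
rewrite cmodE -[leRHS]ger0_norm ?addr_ge0// -sqrtr_sqr ler_wsqrtr//.
rewrite sqrrD !real_normK ?num_real// -addrA lerD2l addrC lerDl.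
by rewrite mulrn_wge0// mulr_ge0.
Qed.

Lemma cmod_ge0 (z : R[i]) : 0 <= cmod z.
Proof. by case: z => a b; rewrite cmodE sqrtr_ge0. Qed.

End ComplexModulus.

Section VectorCalculus.
Context {R : realType}.

Lemma cvg_mx {T : Type} (F : set_system T) {FF : Filter F} (m n : nat)
    (f : T -> 'M[R]_(m, n)) (l : 'M[R]_(m, n)) :
  (forall i j, f t i j @[t --> F] --> l i j) -> f @ F --> l.
Proof.
move=> fl; apply/cvgrPdist_le => e e0; near=> t.
rewrite /Num.Def.normr/= mx_normrE (bigmax_le _ (ltW e0))//= => -[i j] _ /=.
rewrite !mxE; move: i j; near: t.
apply: filter_forall => i; apply: filter_forall => j.
by have /cvgrPdist_le/(_ e e0) := fl i j.
Unshelve. all: by end_near. Qed.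

Lemma norm_coord (n m : nat) (v : 'M[R]_(n, m)) i j : `|v i j| <= `|v|.
Proof.
rewrite [leRHS]/Num.Def.normr/= mx_normrE.
exact: (le_bigmax _ (fun ij : 'I_n * 'I_m => `|v ij.1 ij.2|) (i, j)).
Qed.

Lemma is_derive_mx {V : normedModType R} (n m : nat) (f : V -> 'M[R]_(n, m)) x v
    (df : 'M[R]_(n, m)) :
  (forall i j, is_derive x v (fun y => f y i j) (df i j)) -> is_derive x v f df.
Proof.
move=> D; have D' : derivable f x v.
  by apply/derivable_mxP => i j; exact: (@ex_derive _ _ _ _ _ _ _ (D i j)).
split; first exact: D'.
rewrite derive_mx//; apply/matrixP => i j; rewrite mxE.
exact: (@derive_val _ _ _ _ _ _ _ (D i j)).
Qed.

End VectorCalculus.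

Section VectorGenerator.
Context {R : realType} {d : nat}.
Variable Omega : set 'cV[R]_d.
Hypothesis Omega_open : open Omega.
Hypothesis Omega_nonempty : Omega !=set0.
Implicit Types (rho B : R).

Definition coord m (u : 'cV[R]_d -> 'cV[R]_m) (i : 'I_m) : 'cV[R]_d -> R :=
  fun x => u x i 0.

Definition finV m (u : 'cV[R]_d -> 'cV[R]_m) rho : Prop :=
  forall i, finG Omega (coord u i) rho.

Definition vnorm m (u : 'cV[R]_d -> 'cV[R]_m) rho : R :=
  \sum_(i < m) gnorm Omega (coord u i) rho.

Definition grad_norm m (u : 'cV[R]_d -> 'cV[R]_m) rho : R :=
  \sum_(j < d) \sum_(i < m) gnorm Omega (partial j (coord u i)) rho.

Lemma partials_coord m (u : 'cV[R]_d -> 'cV[R]_m) s x :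
  (forall i, smooth_on Omega (coord u i)) -> Omega x ->
  partials s u x = \col_i partials s (coord u i) x.
Proof.
move=> su; elim: s x => [|j s IH] x Ox.
  by apply/matrixP => i k; rewrite mxE ord1.
rewrite /= /partial (derive_eq_on Omega_open _ Ox IH).
apply: derive_val; apply: is_derive_mx => i k; rewrite mxE.
rewrite [X in is_derive _ _ X _](_ : _ = partials s (coord u i)); last first.
  by apply/funext => y; rewrite mxE.
apply: derivableP; exact: (su i s x Ox).2.
Qed.

Lemma smooth_on_coord m (u : 'cV[R]_d -> 'cV[R]_m) :
  (forall i, smooth_on Omega (coord u i)) -> smooth_on Omega u.
Proof.
move=> su s x Ox; have E y (Oy : Omega y) := esym (partials_coord s su Oy).
split.
  apply: (continuous_eq_on Omega_open Ox E).
  apply: (@cvg_mx _ _ (nbhs x) (nbhs_filter x)) => i j.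
  rewrite [X in X @ _ --> _](_ : _ = partials s (coord u i)); last first.
    by apply/funext => y; rewrite mxE.
  by rewrite mxE; exact: (su i s x Ox).1.
move=> j; apply: (derivable_eq_on Omega_open Ox E); apply/derivable_mxP => i k.
rewrite [X in derivable X _ _](_ : _ = partials s (coord u i)); last first.
  by apply/funext => y; rewrite mxE.
exact: (su i s x Ox).2.
Qed.

Lemma finV_smooth m (u : 'cV[R]_d -> 'cV[R]_m) rho : finV u rho -> smooth_on Omega u.
Proof. by move=> fu; apply: smooth_on_coord => i; exact: finG_smooth (fu i). Qed.

Lemma partial_coord m (u : 'cV[R]_d -> 'cV[R]_m) rho j x i : finV u rho -> Omega x ->
  partial j u x i 0 = partial j (coord u i) x.
Proof.
move=> fu Ox.
have E := partials_coord [:: j] (fun i => finG_smooth (fu i)) Ox.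
by rewrite -[partial j u x]/(partials [:: j] u x) E mxE.
Qed.

Lemma vnorm_ge0 m (u : 'cV[R]_d -> 'cV[R]_m) rho : 0 <= rho -> 0 <= vnorm u rho.
Proof. by move=> r0; apply: sumr_ge0 => i _; exact: gnorm_ge0. Qed.

Lemma grad_norm_ge0 m (u : 'cV[R]_d -> 'cV[R]_m) rho : 0 <= rho -> 0 <= grad_norm u rho.
Proof.
by move=> r0; apply: sumr_ge0 => j _; apply: sumr_ge0 => i _; exact: gnorm_ge0.
Qed.

Lemma GvecE m (u : 'cV[R]_d -> 'cV[R]_m) rho : 0 <= rho -> finV u rho ->
  Gvec Omega u rho = (vnorm u rho)%:E.
Proof.
move=> r0 fu; rewrite /Gvec /vnorm -sumEFin; apply: eq_bigr => i _.
by rewrite -G_fineK//; exact: fu.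
Qed.

Lemma Gvec_finV m (u : 'cV[R]_d -> 'cV[R]_m) rho : 0 <= rho ->
  (Gvec Omega u rho < +oo)%E -> finV u rho.
Proof.
move=> r0 Gu i; rewrite /finG; apply: le_lt_trans Gu; rewrite /Gvec (bigD1 i)//=.
by rewrite leeDl// sume_ge0// => k _; exact: G_ge0.
Qed.

Lemma Gvec_le m (u : 'cV[R]_d -> 'cV[R]_m) rho B : 0 <= rho ->
  (Gvec Omega u rho <= B%:E)%E -> finV u rho /\ vnorm u rho <= B.
Proof.
move=> r0 GB; have fu : finV u rho.
  by apply: Gvec_finV => //; apply: le_lt_trans GB _; rewrite ltry.
by split => //; rewrite -lee_fin -GvecE.
Qed.

Lemma vnorm_lin m (a : R) (u v : 'cV[R]_d -> 'cV[R]_m) rho : 0 < rho ->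
  finV u rho -> finV v rho ->
  finV (fun x => a *: u x + v x) rho /\
  vnorm (fun x => a *: u x + v x) rho <= `|a| * vnorm u rho + vnorm v rho.
Proof.
move=> r0 fu fv.
have E i : coord (fun x => a *: u x + v x) i = fun x => a * coord u i x + coord v i x.
  by apply/funext => x; rewrite /coord !mxE.
have B i := G_lin Omega_open Omega_nonempty a r0 (fu i) (fv i).
split=> [i|]; first by rewrite E; exact: G_le_finG (B i).
rewrite /vnorm mulr_sumr -big_split/=; apply: ler_sum => i _.
by rewrite E; apply: (G_le_gnorm Omega_nonempty (ltW r0)); exact: B.
Qed.

Lemma abs_le_vnorm m (u : 'cV[R]_d -> 'cV[R]_m) rho x i : 0 < rho -> finV u rho ->
  Omega x -> `|u x i 0| <= vnorm u rho.
Proof.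
move=> r0 fu Ox; rewrite /vnorm (bigD1 i)//=.
apply: le_trans (abs_le_gnorm Omega_open Omega_nonempty r0 (fu i) Ox) _.
by rewrite lerDl sumr_ge0// => k _; exact: gnorm_ge0 (ltW r0).
Qed.

Lemma vnorm_mono m (u : 'cV[R]_d -> 'cV[R]_m) rho rho' : 0 <= rho' <= rho -> 0 < rho ->
  finV u rho -> finV u rho' /\ vnorm u rho' <= vnorm u rho.
Proof.
move=> rr r0 fu; have [r'0 _] := andP rr.
have B i := G_mono Omega_nonempty rr r0 (fu i).
split=> [i|]; first exact: G_le_finG (B i).
by apply: ler_sum => i _; apply: (G_le_gnorm Omega_nonempty r'0); exact: B.
Qed.

(** The loss of a derivative against a loss of radius. The entrywise bound
    holds for each of the d partial derivatives, hence the factor d. *)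
Lemma Ggrad_le m (u : 'cV[R]_d -> 'cV[R]_m) rho rho' : 0 <= rho' < rho -> finV u rho ->
  Ggrad Omega u rho' = (grad_norm u rho')%:E /\
  grad_norm u rho' <= d%:R / (rho - rho') * vnorm u rho.
Proof.
move=> rr fu; have [r'0 _] := andP rr.
have B j i := G_partial Omega_open Omega_nonempty j rr (fu i).
split.
  rewrite /Ggrad /grad_norm -sumEFin; apply: eq_bigr => j _.
  rewrite -sumEFin; apply: eq_bigr => i _.
  by rewrite -G_fineK//; exact: G_le_finG (B j i).
rewrite /grad_norm; apply: (@le_trans _ _ (\sum_(j < d) vnorm u rho / (rho - rho'))).
  apply: ler_sum => j _; rewrite /vnorm mulr_suml; apply: ler_sum => i _.
  by apply: (G_le_gnorm Omega_nonempty r'0); exact: B.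
by rewrite sumr_const card_ord -[leLHS]mulr_natl mulrA mulrAC.
Qed.

Section Complex.

Lemma gen_series_mono (N N' : multi_index d -> \bar R) rho : 0 <= rho ->
  (forall al, (N al <= N' al)%E) -> (gen_series N rho <= gen_series N' rho)%E.
Proof.
move=> r0 NN; apply: le_esum => al _; apply: lee_wpmul2r => //.
by rewrite lee_fin; exact: weight_ge0.
Qed.

Lemma GC_smooth (f : 'cV[R]_d -> R[i]) rho :
  smooth_on Omega (re_fun f) /\ smooth_on Omega (im_fun f) ->
  GC Omega f rho = gen_series (fun al => Linfty Omega (fun x =>
    cmod (mi_partial al (re_fun f) x +i* mi_partial al (im_fun f) x)%C)) rho.
Proof. by move=> sf; rewrite /GC asboolT. Qed.

Lemma GC_nonsmooth (f : 'cV[R]_d -> R[i]) rho :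
  ~ (smooth_on Omega (re_fun f) /\ smooth_on Omega (im_fun f)) ->
  GC Omega f rho = +oo%E.
Proof. by move=> nsf; rewrite /GC asboolF. Qed.

(** The modulus dominates the real and the imaginary part and is dominated by
    their sum, so that complex bounds and pairs of real bounds are equivalent up to
    a factor 2. *)
Lemma GC_re_im (f : 'cV[R]_d -> R[i]) rho : 0 <= rho ->
  (G Omega (re_fun f) rho <= GC Omega f rho)%E /\
  (G Omega (im_fun f) rho <= GC Omega f rho)%E.
Proof.
move=> r0; have [sf|nsf] := pselect (smooth_on Omega (re_fun f) /\
                                     smooth_on Omega (im_fun f)); last first.
  by rewrite (GC_nonsmooth rho nsf) !leey.
rewrite (GC_smooth rho sf) (G_smooth rho sf.1) (G_smooth rho sf.2).
split; apply: gen_series_mono => // al; apply: ge_ereal_sup => _ [x Ox <-].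
  apply: le_trans (Linfty_ge _ Ox).
  by rewrite lee_fin [leRHS]ger0_norm ?cmod_ge0//; exact: cmod_ge_Re.
apply: le_trans (Linfty_ge _ Ox).
by rewrite lee_fin [leRHS]ger0_norm ?cmod_ge0//; exact: cmod_ge_Im.
Qed.

Lemma GC_le (f : 'cV[R]_d -> R[i]) rho : 0 < rho ->
  finG Omega (re_fun f) rho -> finG Omega (im_fun f) rho ->
  (GC Omega f rho <= (gnorm Omega (re_fun f) rho + gnorm Omega (im_fun f) rho)%:E)%E.
Proof.
move=> r0 fr fi; rewrite (GC_smooth rho (conj (finG_smooth fr) (finG_smooth fi))).
apply: (@gen_series_le _ _ _ (fun al => dsup Omega (re_fun f) al + dsup Omega (im_fun f) al)).
- exact: ltW.
- move=> al; apply: Linfty_le => x Ox; rewrite ger0_norm ?cmod_ge0//.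
  apply: le_trans (cmod_le _ _) _.
  by apply: lerD; [exact: (dsup_ge Omega_nonempty al r0 fr Ox)
                  |exact: (dsup_ge Omega_nonempty al r0 fi Ox)].
- move=> s us; under eq_bigr do rewrite mulrDl.
  by rewrite big_split/= lerD//; exact: dsup_sum.
Qed.

Definition cnorm m (p q : 'cV[R]_d -> 'cV[R]_m) rho : R := vnorm p rho + vnorm q rho.

Lemma GCvec_re_im m (w : 'cV[R]_d -> 'cV[R[i]]_m) rho B : 0 <= rho ->
  (GCvec Omega w rho <= B%:E)%E ->
  [/\ finV (re_col w) rho, finV (im_col w) rho &
      cnorm (re_col w) (im_col w) rho <= 2 * B].
Proof.
move=> r0 wB.
have Er i : coord (re_col w) i = re_fun (fun x => w x i 0).
  by apply/funext => x; rewrite /coord mxE.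
have Ei i : coord (im_col w) i = im_fun (fun x => w x i 0).
  by apply/funext => x; rewrite /coord mxE.
have hr : (Gvec Omega (re_col w) rho <= B%:E)%E.
  apply: le_trans wB; apply: lee_sum => i _.
  by rewrite -/(coord (re_col w) i) Er; exact: (GC_re_im _ r0).1.
have hi : (Gvec Omega (im_col w) rho <= B%:E)%E.
  apply: le_trans wB; apply: lee_sum => i _.
  by rewrite -/(coord (im_col w) i) Ei; exact: (GC_re_im _ r0).2.
have [fr nr] := Gvec_le r0 hr; have [fi ni] := Gvec_le r0 hi.
by split => //; rewrite /cnorm mulr2n mulrDl mul1r; exact: lerD.
Qed.

Lemma GCvec_le m (w : 'cV[R]_d -> 'cV[R[i]]_m) rho : 0 < rho ->
  finV (re_col w) rho -> finV (im_col w) rho ->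
  (GCvec Omega w rho <= (cnorm (re_col w) (im_col w) rho)%:E)%E.
Proof.
move=> r0 fr fi.
have Er i : coord (re_col w) i = re_fun (fun x => w x i 0).
  by apply/funext => x; rewrite /coord mxE.
have Ei i : coord (im_col w) i = im_fun (fun x => w x i 0).
  by apply/funext => x; rewrite /coord mxE.
rewrite /cnorm /vnorm -big_split/= -sumEFin; apply: lee_sum => i _.
by have := GC_le r0; rewrite Er Ei; apply; rewrite -?Er -?Ei.
Qed.

End Complex.

End VectorGenerator.

(** * The linearization of an analytic system *)

Section AnalyticDerivative.
Context {R : realType} {n : nat}.
Implicit Types (c : multi_index n -> R) (x v a : 'cV[R]_n) (r : R).

(** The partial sums of a power series in the definition of analyticity run
    over boxes of multi-indices; here an element of the box is read as a multi-index. *)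
Definition box_index N (al : {ffun 'I_n -> 'I_N}) : multi_index n :=
  [ffun i => nat_of_ord (al i)].

Definition mi_unit (i : 'I_n) : multi_index n := [ffun k => nat_of_bool (k == i)].

Lemma box_index_inj N : injective (@box_index N).
Proof.
move=> a b /ffunP E; apply/ffunP => i; apply: val_inj.
by have := E i; rewrite !ffunE.
Qed.

Lemma mi_pow_le x al : `|mi_pow x al| <= `|x| ^+ mi_deg al.
Proof.
rewrite /mi_pow /mi_deg normr_prod expr_sum; apply: ler_prod => i _.
by rewrite normr_ge0 normrX lerXn2r ?nnegrE//; exact: norm_coord.
Qed.

Lemma mi_deg1 (al : multi_index n) : mi_deg al = 1%N -> exists i, al = mi_unit i.
Proof.
move=> /eqP; rewrite /mi_deg => /sum_nat_eq1[i [_ ali alj]].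
exists i; apply/ffunP => k; rewrite ffunE; case: eqVneq => [->//|ki].
exact: alj.
Qed.

Lemma mi_pow_unit x i : mi_pow x (mi_unit i) = x i 0.
Proof.
rewrite /mi_pow (bigD1 i)//= ffunE eqxx expr1 big1 ?mulr1// => k /negPf ki.
by rewrite ffunE ki expr0.
Qed.

Definition box_sum c N x : R :=
  \sum_(al : {ffun 'I_n -> 'I_N}) c (box_index al) * mi_pow x (box_index al).

(** Second-order remainder of a power series: every term of degree at least two
    carries a factor (|x|/r)^2 with respect to its value at radius r. *)
Lemma box_sum_remainder c r C N x : 0 < r -> `|x| <= r ->
  (forall s : seq (multi_index n), uniq s ->
     \sum_(al <- s) `|c al| * r ^+ mi_deg al <= C) ->
  `|box_sum c N.+2 x - (c [ffun=> 0%N] + \sum_i c (mi_unit i) * x i 0)|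
    <= C * (`|x| / r) ^+ 2.
Proof.
move=> r0 xr cC.
pose F (al : {ffun 'I_n -> 'I_N.+2}) := c (box_index al) * mi_pow x (box_index al).
pose z : {ffun 'I_n -> 'I_N.+2} := [ffun=> ord0].
pose e i : {ffun 'I_n -> 'I_N.+2} := [ffun k => inord (k == i)].
have zE : box_index z = [ffun=> 0%N] by apply/ffunP => i; rewrite !ffunE.
have eE i : box_index (e i) = mi_unit i.
  by apply/ffunP => k; rewrite !ffunE inordK//; case: (k == i).
have e_inj : injective e.
  move=> i k /(congr1 (@box_index _)); rewrite !eE => /ffunP/(_ i).
  by rewrite !ffunE eqxx; case: eqVneq.
(* The terms of degree 0 and 1 are isolated; what remains has degree at least 2. *)
have S0 : \sum_(al | mi_deg (box_index al) == 0%N) F al = c [ffun=> 0%N].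
  rewrite (big_pred1 z); last first.
    move=> al /=; apply/idP/eqP => [|->]; last first.
      by rewrite zE /mi_deg big1// => i _; rewrite ffunE.
    rewrite /mi_deg sum_nat_eq0 => /forallP al0; apply/ffunP => i.
    apply: val_inj; rewrite ffunE /=; have := al0 i.
    by rewrite ffunE /= => /eqP.
  rewrite /F zE /mi_pow big1 ?mulr1// => i _; by rewrite ffunE expr0.
have S1 : \sum_(al | mi_deg (box_index al) == 1%N) F al =
    \sum_i c (mi_unit i) * x i 0.
  rewrite (eq_bigl (mem (e @: [set: 'I_n]%SET))); last first.
    move=> al /=; apply/idP/imsetP => [/eqP/mi_deg1[i E]|[i _ ->]].
      exists i; first by rewrite inE.
      by apply: box_index_inj; rewrite E eE.
    rewrite eE /mi_deg (bigD1 i)//= ffunE eqxx big1// => k /negPf ki.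
    by rewrite ffunE ki.
  rewrite big_imset/=; last by move=> i k _ _; exact: e_inj.
  by apply: eq_big => [i|i _]; rewrite ?inE// /F eE mi_pow_unit.
have -> : box_sum c N.+2 x - (c [ffun=> 0%N] + \sum_i c (mi_unit i) * x i 0) =
    \sum_(al | (1 < mi_deg (box_index al))%N) F al.
  rewrite -S0 -S1 /box_sum (bigID (fun al => mi_deg (box_index al) == 0%N))/=.
  rewrite -/F [X in _ + X - _](bigID (fun al => mi_deg (box_index al) == 1%N))/=.
  rewrite [X in _ + (X + _) - _](eq_bigl (fun al => mi_deg (box_index al) == 1%N));
    last by move=> al /=; case: (mi_deg _) => [|[]].
  rewrite opprD addrACA subrr add0r addrAC subrr add0r.
  by apply: eq_bigl => al; case: (mi_deg _) => [|[]].
apply: le_trans (ler_norm_sum _ _ _) _.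
apply: (@le_trans _ _ (\sum_(al | (1 < mi_deg (box_index al))%N)
   `|c (box_index al)| * r ^+ mi_deg (box_index al) * (`|x| / r) ^+ 2)).
  apply: ler_sum => al; set k := mi_deg _ => k2; rewrite normrM -mulrA ler_wpM2l//.
  apply: le_trans (mi_pow_le _ _) _; rewrite -/k -(subnK k2) !exprD.
  rewrite expr_div_n -[leRHS]mulrA [r ^+ 2 * _]mulrC divfK ?expf_neq0 ?gt_eqF//.
  by rewrite ler_wpM2r ?sqr_ge0// lerXn2r ?nnegrE// ltW.
rewrite -mulr_suml ler_wpM2r ?sqr_ge0//.
have us : uniq (map (@box_index _) (enum {ffun 'I_n -> 'I_N.+2})).
  by rewrite map_inj_uniq ?enum_uniq//; exact: box_index_inj.
apply: le_trans (cC _ us); rewrite big_map big_enum/=.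
rewrite [leRHS](bigID (fun al => (1 < mi_deg (box_index al))%N))/= lerDl.
by apply: sumr_ge0 => al _; rewrite mulr_ge0// exprn_ge0// ltW.
Qed.

(** By the quadratic bound on the remainder, the part of degree one of the power series is
    the derivative. *)
Lemma real_analytic_derive (f : 'cV[R]_n -> R) a : real_analytic f ->
  exists g : 'I_n -> R, forall v, is_derive a v f (\sum_i g i * v i 0).
Proof.
move=> /(_ a)[c [r [r0 cfin fE]]]; exists (fun i => c (mi_unit i)) => v.
set E := esum _ _ in cfin.
have E0 : (0 <= E)%E.
  by apply: esum_ge0 => al _; rewrite lee_fin mulr_ge0// exprn_ge0// ltW.
pose C := fine E; have EC : E = C%:E by rewrite fineK// ge0_fin_numE.
have C0 : 0 <= C by exact: fine_ge0.
have cC (s : seq (multi_index n)) : uniq s ->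
    \sum_(al <- s) `|c al| * r ^+ mi_deg al <= C.
  move=> us; rewrite -lee_fin -EC -sumEFin; apply: esum_ge.
  exists [set` s]; last by rewrite fsbig_seq.
  by split => //; exact: finite_seq.
set l := \sum_i _.
have rem h : `|h *: v| < r -> `|f (h *: v + a) - (c [ffun=> 0%N] + h * l)|
    <= C * (`|h *: v| / r) ^+ 2.
  move=> hr; set x := h *: v.
  have hl : h * l = \sum_i c (mi_unit i) * x i 0.
    by rewrite /l mulr_sumr; apply: eq_bigr => i _; rewrite mxE mulrCA.
  have cv : box_sum c N x @[N --> \oo] --> f (x + a).
    by have := fE (x + a); rewrite addrK; apply.
  have cv2 : `|box_sum c N x - (c [ffun=> 0%N] + h * l)| @[N --> \oo] -->
     `|f (x + a) - (c [ffun=> 0%N] + h * l)|.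
    by apply: cvg_norm; apply: cvgB => //; exact: cvg_cst.
  apply: (cvgr_to_le cv2); near=> N.
  have N2 : (2 <= N)%N by near: N; exact: nbhs_infty_ge.
  rewrite -(subnK N2) addn2 hl; apply: box_sum_remainder => //; exact: ltW.
have fa : f a = c [ffun=> 0%N].
  have := rem 0; rewrite scale0r add0r normr0 !mul0r expr0n/= mulr0 addr0.
  by move=> /(_ r0); rewrite normr_le0 subr_eq0 => /eqP.
pose K := C * (`|v| / r) ^+ 2.
have K0 : 0 <= K by rewrite mulr_ge0// sqr_ge0.
have lim : h^-1 *: (f (h *: v + a) - f a) @[h --> 0^'] --> l.
  apply/cvgrPdist_le => e e0.
  have d0 : 0 < e / (K + 1) by rewrite divr_gt0// ltr_wpDl.
  have d1 : 0 < r / (`|v| + 1) by rewrite divr_gt0// ltr_wpDl.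
  near=> h.
  have h0 : h != 0 by near: h; exact: nbhs_dnbhs_neq.
  have he : `|h| < e / (K + 1) by near: h; exact: dnbhs0_lt.
  have hr : `|h| < r / (`|v| + 1) by near: h; exact: dnbhs0_lt.
  have hvr : `|h *: v| < r.
    move: hr; rewrite ltr_pdivlMr ?ltr_wpDl// normrZ; apply: le_lt_trans.
    by rewrite ler_wpM2l// lerDl.
  have := rem h hvr; rewrite normrZ -fa.
  have -> : C * (`|h| * `|v| / r) ^+ 2 = K * `|h| * `|h|.
    by rewrite /K; ring.
  move=> B; have -> : l - h^-1 *: (f (h *: v + a) - f a) =
     - (h^-1 * (f (h *: v + a) - (f a + h * l))).
    by rewrite opprD addrA mulrBr mulKf// opprB.
  rewrite normrN normrM normfV ler_pdivrMl ?normr_gt0//.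
  apply: le_trans B _; rewrite mulrC ler_wpM2l//.
  move: he; rewrite ltr_pdivlMr ?ltr_wpDl// => he; apply: ltW.
  apply: le_lt_trans he; rewrite mulrC; apply: ler_wpM2l => //.
  by rewrite lerDl.
split; first by apply/cvg_ex; eexists; exact: lim.
exact: (@cvg_lim _ _ _ _ _ _ _ lim).
Unshelve. all: by end_near. Qed.

End AnalyticDerivative.

Section Linearization.
Context {R : realType} {d m : nat}.

(** Since A and the B_j have directional derivatives linear in the direction,
    the linearized operator is at each point a linear form in the values and the first
    derivatives of its argument. Its additivity and its continuity along convergent
    series follow from this form. *)
Lemma linearizedE (A : 'cV[R]_m -> 'cV[R]_m) (B : 'I_d -> 'cV[R]_m -> 'M[R]_m)
    (u0 : 'cV[R]_d -> 'cV[R]_m) x :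
  (forall i, real_analytic (fun y => A y i 0)) ->
  (forall j i k, real_analytic (fun y => B j y i k)) ->
  exists M0 : 'M[R]_m, forall v i, linearized A B u0 v x i 0 =
    \sum_k M0 i k * v x k 0 + \sum_j \sum_k B j (u0 x) i k * partial j v x k 0.
Proof.
move=> aA aB.
have [gA HA] := choice (fun i => real_analytic_derive (u0 x) (aA i)).
have [gB HB] := choice (fun p : 'I_d * 'I_m * 'I_m =>
  real_analytic_derive (u0 x) (aB p.1.1 p.1.2 p.2)).
exists (\matrix_(i, k) (gA i k +
  \sum_j \sum_l gB (j, i, l) k * partial j u0 x l 0)) => v i.
have DA w : 'D_w A (u0 x) = \col_i \sum_k gA i k * w k 0.
  apply: derive_val; apply: is_derive_mx => i' k; rewrite mxE ord1; exact: HA.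
have DB j w : 'D_w (B j) (u0 x) = \matrix_(i, l) \sum_k gB (j, i, l) k * w k 0.
  apply: derive_val; apply: is_derive_mx => i' l; rewrite mxE; exact: (HB (j, i', l)).
rewrite /linearized !mxE !summxE DA mxE; congr (_ + _); last first.
  by apply: eq_bigr => j _; rewrite mxE.
under [RHS]eq_bigr do rewrite mxE mulrDl.
rewrite big_split/=; congr (_ + _).
under [RHS]eq_bigr do rewrite mulr_suml.
rewrite exchange_big/=; apply: eq_bigr => j _; rewrite mxE DB.
under [RHS]eq_bigr do rewrite mulr_suml.
rewrite exchange_big/=; apply: eq_bigr => l _; rewrite mxE mulr_suml.
by apply: eq_bigr => k _; rewrite mulrAC.
Qed.

End Linearization.

(** * Bilinear operations on convergent series *)

Section CauchyProduct.
Context {R : realType}.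

Lemma triangle_sum (q : nat -> nat -> R) N :
  \sum_(n < N) \sum_(k < n.+1) q k (n - k)%N = \sum_(k < N) \sum_(l < N - k) q k l.
Proof.
elim: N => [|N IH]; first by rewrite !big_ord0.
rewrite big_ord_recr/= IH [RHS]big_ord_recr/= subSnn big_ord1.
rewrite [X in _ + X]big_ord_recr/= subnn addrA -big_split/=; congr (_ + _).
by apply: eq_bigr => k _; rewrite subSn ?(ltnW (ltn_ord k))// big_ord_recr.
Qed.

Lemma ssum_finite (c : nat -> R) N : (forall n, (N <= n)%N -> c n = 0) ->
  ssum c = \sum_(n < N) c n.
Proof.
move=> c0; have E : \forall n \near \oo, series c n = \sum_(n < N) c n.
  near=> n; have Nn : (N <= n)%N by near: n; exact: nbhs_infty_ge.
  have t0 : \sum_(N <= i < n) c i = 0.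
    by rewrite big_nat_cond big1// => k /andP[/andP[Nk _] _]; exact: c0.
  by rewrite /series/= (big_cat_nat _ Nn)//= t0 addr0 big_mkord.
apply: cvg_lim => //; apply: cvg_near_cst; exact: E.
Unshelve. all: by end_near. Qed.

(** Cauchy products converge to the iterated sum: the truncations of the inner
    series are dominated uniformly, so the limit may be taken inside. *)
Lemma cauchy_product (q : nat -> nat -> R) (K : R) (M : nat -> R) :
  0 <= K -> (forall k l, `|q k l| <= K * M k * M l) -> (forall n, 0 <= M n) ->
  cvgn (series M) ->
  series (fun n => \sum_(k < n.+1) q k (n - k)%N) @ \oo -->
    ssum (fun k => ssum (q k)).
Proof.
move=> K0 qM M0 cvM.
have cM k : cvgn (series (fun l => K * M k * M l)).
  exact: (is_cvg_seriesZ (k := K * M k) cvM).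
(* The partial sum of the Cauchy product up to N, written as a series over k whose
   terms vanish for k >= N, so that N tends to infinity by dominated convergence. *)
pose a k N := if (k < N)%N then series (q k) (N - k)%N else 0.
have Mnd n : series M n <= ssum M.
  apply: nondecreasing_cvgn_le => //; apply/nondecreasing_seqP => i.
  by rewrite seriesSr lerDl.
have aM : \forall N \near \oo, forall k, `|a k N| <= K * ssum M * M k.
  near=> N => k; rewrite /a; case: ifP => _; last first.
    by rewrite normr0 !mulr_ge0//; apply: le_trans (Mnd 0%N); rewrite /series/= big_geq.
  rewrite /series/=; apply: le_trans (ler_norm_sum _ _ _) _.
  apply: (@le_trans _ _ (\sum_(0 <= l < N - k) K * M k * M l)); first exact: ler_sum.
  by rewrite -mulr_sumr mulrAC ler_wpM2r// ler_wpM2l//; exact: Mnd.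
have ab k : a k N @[N --> \oo] --> ssum (q k).
  have cq : series (q k) @ \oo --> ssum (q k).
    exact: dominated_cvg_series (qM k) (cM k).
  have cs : series (q k) (N - k)%N @[N --> \oo] --> ssum (q k).
    by rewrite -(cvg_shiftn k); under eq_fun do rewrite addnK.
  apply: cvg_trans cs; apply: near_eq_cvg; near=> N.
  have kN : (k < N)%N by near: N; exact: nbhs_infty_gt.
  by rewrite /a kN.
have cKM : cvgn (series (fun k => K * ssum M * M k)).
  exact: (is_cvg_seriesZ (k := K * ssum M) cvM).
have := cvg_dominated_series aM ab cKM; move/(_ _).
suff -> : (fun N => ssum (a ^~ N)) = series (fun n => \sum_(k < n.+1) q k (n - k)%N) by exact.
apply/funext => N; rewrite (@ssum_finite _ N); last first.
  by move=> n Nn; rewrite /a ltnNge Nn.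
rewrite /series/= big_mkord triangle_sum; apply: eq_bigr => k _.
by rewrite /a ltn_ord /series/= big_mkord.
Unshelve. all: by end_near. Qed.

Lemma cvg_tail (M : nat -> R) : cvgn (series M) ->
  ssum M - series M N @[N --> \oo] --> (0 : R).
Proof.
move=> cM; rewrite -[X in _ --> X](subrr (ssum M)).
by apply: cvgB => //; exact: cvg_cst.
Qed.

Lemma cvg_series_shift (M : nat -> R) N : cvgn (series M) ->
  cvgn (series (fun n => M (n + N)%N)) /\
  ssum (fun n => M (n + N)%N) = ssum M - series M N.
Proof.
move=> cM.
have E : series (fun n => M (n + N)%N) = fun n => series M (n + N)%N - series M N.
  apply/funext => n; rewrite sub_series_geq ?leq_addl// /series/=.
  by rewrite -{2}[N]add0n big_addn addnK.
have c : (fun n => series M (n + N)%N - series M N) @ \oo --> ssum M - series M N.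
  by apply: cvgB; [rewrite cvg_shiftn|exact: cvg_cst].
by rewrite /ssum E; split; [apply/cvg_ex; eexists; exact: c|exact: cvg_lim c].
Qed.

End CauchyProduct.

Section VectorSeries.
Context {R : realType} {d m : nat}.
Variable Omega : set 'cV[R]_d.
Hypothesis Omega_open : open Omega.
Hypothesis Omega_nonempty : Omega !=set0.

Definition vsum (v : nat -> 'cV[R]_d -> 'cV[R]_m) : 'cV[R]_d -> 'cV[R]_m :=
  fun x => \col_i ssum (fun n => v n x i 0).

Definition psum (v : nat -> 'cV[R]_d -> 'cV[R]_m) N : 'cV[R]_d -> 'cV[R]_m :=
  fun x => \sum_(n < N) v n x.

Lemma coord_vsum v i : coord (vsum v) i = fun x => ssum (fun n => coord (v n) i x).
Proof. by apply/funext => x; rewrite /coord mxE. Qed.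

Lemma finV0 rho : 0 < rho ->
  finV Omega (fun _ => 0 : 'cV[R]_m) rho /\ vnorm Omega (fun _ => 0 : 'cV[R]_m) rho = 0.
Proof.
move=> r0.
have p0 s (x : 'cV[R]_d) : partials s (fun=> 0 : R) x = 0.
  elim: s x => [//|j s IH] x /=.
  have -> : partials s (fun=> 0 : R) = cst 0 by apply/funext => y; rewrite IH.
  exact: derive_cst.
have s0 : smooth_on Omega (fun=> 0 : R).
  move=> s x Ox; have -> : partials s (fun=> 0 : R) = cst 0.
    by apply/funext => y; rewrite p0.
  split=> [|j]; [exact: cst_continuous|exact: derivable_cst].
have c0 i : coord (fun _ => 0 : 'cV[R]_m) i = (fun=> 0) :> ('cV[R]_d -> R).
  by apply/funext => x; rewrite /coord mxE.
have B i : (G Omega (coord (fun _ => 0%R : 'cV[R]_m) i) rho <= 0%:E)%E.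
  rewrite c0; apply: (@G_le _ _ _ _ _ (fun=> 0)) => //; first exact: ltW.
    by move=> al x Ox; rewrite mi_partialE p0 normr0.
  by move=> s _; rewrite big1// => al _; rewrite mul0r.
split=> [i|]; first exact: G_le_finG (B i).
rewrite /vnorm big1// => i _; apply/eqP; rewrite eq_le gnorm_ge0 ?(ltW r0)// andbT.
exact: (G_le_gnorm Omega_nonempty (ltW r0) (B i)).
Qed.

Lemma vnorm_sum (I : Type) (s : seq I) (F : I -> 'cV[R]_d -> 'cV[R]_m) (c : I -> R) rho :
  0 < rho -> (forall i, finV Omega (F i) rho) ->
  finV Omega (fun x => \sum_(i <- s) c i *: F i x) rho /\
  vnorm Omega (fun x => \sum_(i <- s) c i *: F i x) rho <=
    \sum_(i <- s) `|c i| * vnorm Omega (F i) rho.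
Proof.
move=> r0 fF; elim: s => [|i s [IH1 IH2]].
  have -> : (fun x => \sum_(i <- [::]) c i *: F i x) = fun=> 0.
    by apply/funext => x; rewrite big_nil.
  by have [f0 n0] := finV0 r0; rewrite n0 big_nil.
have -> : (fun x => \sum_(j <- i :: s) c j *: F j x) =
    (fun x => c i *: F i x + \sum_(j <- s) c j *: F j x).
  by apply/funext => x; rewrite big_cons.
have [f1 n1] := vnorm_lin Omega_open Omega_nonempty (c i) r0 (fF i) IH1.
by split => //; rewrite big_cons; apply: le_trans n1 _; rewrite lerD2l.
Qed.

Variables (v : nat -> 'cV[R]_d -> 'cV[R]_m) (M : nat -> R) (rho : R).
Hypothesis rho_gt0 : 0 < rho.
Hypothesis v_fin : forall n, finV Omega (v n) rho.
Hypothesis v_le : forall n, vnorm Omega (v n) rho <= M n.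
Hypothesis M_cvg : cvgn (series M).

Let gnorm_le n i : gnorm Omega (coord (v n) i) rho <= vnorm Omega (v n) rho.
Proof.
rewrite /vnorm (bigD1 i)//= lerDl sumr_ge0// => k _; exact: gnorm_ge0 (ltW rho_gt0).
Qed.

Let gnorm_cvg i : cvgn (series (fun n => gnorm Omega (coord (v n) i) rho)).
Proof.
apply: (dominated_cvg_series (M := M)) => // n.
rewrite ger0_norm ?gnorm_ge0 ?(ltW rho_gt0)//.
exact: le_trans (gnorm_le n i) (v_le n).
Qed.

Lemma vsum_le : finV Omega (vsum v) rho /\ vnorm Omega (vsum v) rho <= ssum M.
Proof.
have B i := G_ssum Omega_open Omega_nonempty rho_gt0 (fun n => v_fin n i)
  (fun n => lexx _) (@gnorm_cvg i).
split=> [i|]; first by rewrite coord_vsum; exact: G_le_finG (B i).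
apply: (@le_trans _ _ (\sum_i ssum (fun n => gnorm Omega (coord (v n) i) rho))).
  apply: ler_sum => i _; rewrite coord_vsum.
  exact: (G_le_gnorm Omega_nonempty (ltW rho_gt0) (B i)).
have [<- cS] := ssum_sum (index_enum 'I_m) (@gnorm_cvg).
apply: le_trans (ler_norm _) _; apply: ssum_norm_le => // n.
rewrite ger0_norm; first exact: v_le.
by apply: sumr_ge0 => i _; exact: gnorm_ge0 (ltW rho_gt0).
Qed.

Lemma partial_vsum j i x : Omega x ->
  partial j (coord (vsum v) i) x = ssum (fun n => partial j (coord (v n) i) x) /\
  cvgn (series (fun n => partial j (coord (v n) i) x)).
Proof.
move=> Ox; rewrite coord_vsum; split.
  exact: (partials_ssum Omega_open Omega_nonempty rho_gt0 (fun n => v_fin n i)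
    (fun n => lexx _) (@gnorm_cvg i) [:: j] Ox).
have := @cvg_series_partials R d Omega Omega_open Omega_nonempty
  (fun n => coord (v n) i) _ rho rho_gt0 (fun n => v_fin n i)
  (fun n => lexx _) (@gnorm_cvg i) [:: j] x Ox.
by [].
Qed.

Lemma cvg_series_coord i x : Omega x -> cvgn (series (fun n => v n x i 0)).
Proof.
move=> Ox; apply: (dominated_cvg_series (M := M)) => // n.
apply: le_trans (v_le n); exact: abs_le_vnorm.
Qed.

Lemma psum_fin N : finV Omega (psum v N) rho.
Proof.
have [f _] := vnorm_sum (index_enum 'I_N) (fun=> 1) rho_gt0 (fun n : 'I_N => v_fin n).
rewrite (_ : psum v N = (fun x => \sum_(i < N) 1 *: v i x))//.
by apply/funext => x; apply: eq_bigr => n _; rewrite scale1r.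
Qed.

End VectorSeries.

Section VectorTail.
Context {R : realType} {d m : nat}.
Variable Omega : set 'cV[R]_d.
Hypothesis Omega_open : open Omega.
Hypothesis Omega_nonempty : Omega !=set0.
Variables (v : nat -> 'cV[R]_d -> 'cV[R]_m) (M : nat -> R) (rho : R).
Hypothesis rho_gt0 : 0 < rho.
Hypothesis v_fin : forall n, finV Omega (v n) rho.
Hypothesis v_le : forall n, vnorm Omega (v n) rho <= M n.
Hypothesis M_cvg : cvgn (series M).

(** Splitting the series into psum and vtail lets Q act on the head by finite
    bilinearity and on the tail by continuity. *)
Definition vtail N : 'cV[R]_d -> 'cV[R]_m := vsum (fun n => v (n + N)%N).

Lemma vtail_le N : finV Omega (vtail N) rho /\
  vnorm Omega (vtail N) rho <= ssum M - series M N.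
Proof.
have [cM E] := cvg_series_shift N M_cvg; rewrite -E.
exact: (vsum_le Omega_open Omega_nonempty rho_gt0 (fun n => v_fin (n + N)%N)
  (fun n => v_le (n + N)%N) cM).
Qed.

Lemma vsum_psum_tail N x : Omega x -> vsum v x = psum v N x + vtail N x.
Proof.
move=> Ox; apply/matrixP => i k; rewrite ord1 !mxE summxE.
have cv := @cvg_series_coord R d m Omega Omega_open Omega_nonempty v M rho
  rho_gt0 v_fin v_le M_cvg i x Ox.
have [_ ->] := cvg_series_shift N cv.
by rewrite [series _ _]big_mkord addrC subrK.
Qed.

Variables (Q : ('cV[R]_d -> 'cV[R]_m) -> ('cV[R]_d -> 'cV[R]_m) ->
         'cV[R]_d -> 'cV[R]_m) (K : R).
Hypothesis Q_bilinear : bilinear_on Omega Q.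
Hypothesis K_ge0 : 0 <= K.
Hypothesis Q_le : forall u w x i, finV Omega u rho -> finV Omega w rho -> Omega x ->
  `|Q u w x i 0| <= K * vnorm Omega u rho * vnorm Omega w rho.

Let memO x : Omega x -> x \in Omega. Proof. by move=> Ox; rewrite inE. Qed.

Lemma bilinear0l u x : smooth_on Omega u -> Omega x -> Q (fun=> 0) u x = 0.
Proof.
move=> su Ox; have [_ lin _] := Q_bilinear.
have s0 : smooth_on Omega (fun=> 0 : 'cV[R]_m).
  exact: (finV_smooth Omega_open (@finV0 R d m Omega Omega_nonempty rho rho_gt0).1).
have := lin 1 _ _ _ s0 s0 su x (memO Ox).
rewrite (_ : (fun=> 1 *: 0 + 0) = (fun=> 0)); last first.
  by apply/funext => y; rewrite scaler0 addr0.
by rewrite scale1r => /eqP; rewrite -subr_eq0 opprD addrA subrr sub0r oppr_eq0 => /eqP.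
Qed.

Lemma bilinear0r u x : smooth_on Omega u -> Omega x -> Q u (fun=> 0) x = 0.
Proof.
move=> su Ox; have [_ _ lin] := Q_bilinear.
have s0 : smooth_on Omega (fun=> 0 : 'cV[R]_m).
  exact: (finV_smooth Omega_open (@finV0 R d m Omega Omega_nonempty rho rho_gt0).1).
have := lin 1 _ _ _ su s0 s0 x (memO Ox).
rewrite (_ : (fun=> 1 *: 0 + 0) = (fun=> 0)); last first.
  by apply/funext => y; rewrite scaler0 addr0.
by rewrite scale1r => /eqP; rewrite -subr_eq0 opprD addrA subrr sub0r oppr_eq0 => /eqP.
Qed.

Lemma bilinear_suml (I : Type) (s : seq I) (c : I -> R)
    (F : I -> 'cV[R]_d -> 'cV[R]_m) u x :
  (forall i, finV Omega (F i) rho) -> smooth_on Omega u -> Omega x ->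
  Q (fun y => \sum_(i <- s) c i *: F i y) u x = \sum_(i <- s) c i *: Q (F i) u x.
Proof.
move=> fF su Ox; elim: s => [|i s IH].
  rewrite big_nil; apply: etrans (bilinear0l su Ox); congr (Q _ u x).
  by apply/funext => y; rewrite big_nil.
rewrite big_cons -IH; have [_ lin _] := Q_bilinear.
have [fS _] := vnorm_sum Omega_open Omega_nonempty s c rho_gt0 fF.
rewrite -(lin (c i) _ _ _ (finV_smooth Omega_open (fF i))
  (finV_smooth Omega_open fS) su x (memO Ox)).
by congr (Q _ u x); apply/funext => y; rewrite big_cons.
Qed.

Lemma bilinear_sumr (I : Type) (s : seq I) (c : I -> R)
    (F : I -> 'cV[R]_d -> 'cV[R]_m) u x :
  (forall i, finV Omega (F i) rho) -> smooth_on Omega u -> Omega x ->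
  Q u (fun y => \sum_(i <- s) c i *: F i y) x = \sum_(i <- s) c i *: Q u (F i) x.
Proof.
move=> fF su Ox; elim: s => [|i s IH].
  rewrite big_nil; apply: etrans (bilinear0r su Ox); congr (Q u _ x).
  by apply/funext => y; rewrite big_nil.
rewrite big_cons -IH; have [_ _ lin] := Q_bilinear.
have [fS _] := vnorm_sum Omega_open Omega_nonempty s c rho_gt0 fF.
rewrite -(lin (c i) _ _ _ su (finV_smooth Omega_open (fF i))
  (finV_smooth Omega_open fS) x (memO Ox)).
by congr (Q u _ x); apply/funext => y; rewrite big_cons.
Qed.

Lemma psumE N : psum v N = fun x => \sum_(n <- index_enum 'I_N) 1 *: v n x.
Proof. by apply/funext => x; apply: eq_bigr => n _; rewrite scale1r. Qed.

Let psumfin N : finV Omega (psum v N) rho.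
Proof. exact: (psum_fin Omega_open Omega_nonempty rho_gt0 v_fin N). Qed.

Let vs_fin : finV Omega (vsum v) rho.
Proof. exact: (vsum_le Omega_open Omega_nonempty rho_gt0 v_fin v_le M_cvg).1. Qed.

(** A bilinear operation that is bounded in the generator norm may be applied to a
    convergent series term by term: the error made by truncating the series is
    bounded by the tail of M. *)
Lemma Q_vsum_l u x i : finV Omega u rho -> Omega x ->
  series (fun n => Q (v n) u x i 0) @ \oo --> Q (vsum v) u x i 0.
Proof.
move=> fu Ox; have su := finV_smooth Omega_open fu; apply/cvgrPdist_le => e e0.
have t0 : K * vnorm Omega u rho * (ssum M - series M N) @[N --> \oo] --> (0 : R).
  rewrite -[X in _ --> X](mulr0 (K * vnorm Omega u rho)); apply: cvgM.
    exact: cvg_cst.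
  exact: cvg_tail.
have /cvgrPdist_le/(_ e e0) := t0; apply: filterS => N.
rewrite sub0r normrN => /(le_trans (ler_norm _)); apply: le_trans.
have [ft nt] := vtail_le N.
have -> : series (fun n => Q (v n) u x i 0) N = Q (psum v N) u x i 0.
  have E := @bilinear_suml 'I_N (index_enum 'I_N) (fun=> 1) (fun n => v n) u x
    (fun n => v_fin n) su Ox.
  rewrite psumE E summxE /series/= big_mkord.
  by apply: eq_bigr => n _; rewrite scale1r.
have -> : Q (vsum v) u x i 0 = Q (psum v N) u x i 0 + Q (vtail N) u x i 0.
  have [ext lin _] := Q_bilinear.
  have sp := finV_smooth Omega_open (psumfin N).
  have st := finV_smooth Omega_open ft.
  have := lin 1 _ _ _ sp st su x (memO Ox); rewrite scale1r => E.
  transitivity ((Q (psum v N) u x + Q (vtail N) u x) i 0); last by rewrite mxE.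
  have e1 : {in Omega, vsum v =1 (fun y => 1 *: psum v N y + vtail N y)}.
    by move=> y; rewrite inE => Oy; rewrite scale1r; exact: vsum_psum_tail.
  have s1 := finV_smooth Omega_open vs_fin.
  have [fl _] := vnorm_lin Omega_open Omega_nonempty 1 rho_gt0 (psumfin N) ft.
  have s2 := finV_smooth Omega_open fl.
  rewrite -E; have Z := ext _ _ _ _ s1 s2 su su e1 (fun y _ => erefl) x (memO Ox).
  exact: (congr1 (fun A : 'cV[R]_m => A i 0) Z).
rewrite addrAC subrr add0r; apply: le_trans (Q_le i ft fu Ox) _.
by rewrite mulrAC ler_wpM2l// mulr_ge0// vnorm_ge0// ltW.
Qed.

Lemma Q_vsum_r u x i : finV Omega u rho -> Omega x ->
  series (fun n => Q u (v n) x i 0) @ \oo --> Q u (vsum v) x i 0.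
Proof.
move=> fu Ox; have su := finV_smooth Omega_open fu; apply/cvgrPdist_le => e e0.
have t0 : K * vnorm Omega u rho * (ssum M - series M N) @[N --> \oo] --> (0 : R).
  rewrite -[X in _ --> X](mulr0 (K * vnorm Omega u rho)); apply: cvgM.
    exact: cvg_cst.
  exact: cvg_tail.
have /cvgrPdist_le/(_ e e0) := t0; apply: filterS => N.
rewrite sub0r normrN => /(le_trans (ler_norm _)); apply: le_trans.
have [ft nt] := vtail_le N.
have -> : series (fun n => Q u (v n) x i 0) N = Q u (psum v N) x i 0.
  have E := @bilinear_sumr 'I_N (index_enum 'I_N) (fun=> 1) (fun n => v n) u x
    (fun n => v_fin n) su Ox.
  rewrite psumE E summxE /series/= big_mkord.
  by apply: eq_bigr => n _; rewrite scale1r.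
have -> : Q u (vsum v) x i 0 = Q u (psum v N) x i 0 + Q u (vtail N) x i 0.
  have [ext _ lin] := Q_bilinear.
  have sp := finV_smooth Omega_open (psumfin N).
  have st := finV_smooth Omega_open ft.
  have := lin 1 _ _ _ su sp st x (memO Ox); rewrite scale1r => E.
  transitivity ((Q u (psum v N) x + Q u (vtail N) x) i 0); last by rewrite mxE.
  have e1 : {in Omega, vsum v =1 (fun y => 1 *: psum v N y + vtail N y)}.
    by move=> y; rewrite inE => Oy; rewrite scale1r; exact: vsum_psum_tail.
  have s1 := finV_smooth Omega_open vs_fin.
  have [fl _] := vnorm_lin Omega_open Omega_nonempty 1 rho_gt0 (psumfin N) ft.
  have s2 := finV_smooth Omega_open fl.
  rewrite -E; have Z := ext _ _ _ _ su su s1 s2 (fun y _ => erefl) e1 x (memO Ox).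
  exact: (congr1 (fun A : 'cV[R]_m => A i 0) Z).
rewrite addrAC subrr add0r; apply: le_trans (Q_le i fu ft Ox) _.
by rewrite ler_wpM2l// mulr_ge0// vnorm_ge0// ltW.
Qed.

(** The series of Q(v, v) regrouped by total order: apply Q to one factor at a
    time, then pass from the iterated sum to the Cauchy product. *)
Lemma Q_vsum_vsum x i : Omega x ->
  series (fun n => \sum_(k < n.+1) Q (v k) (v (n - k)%N) x i 0) @ \oo -->
    Q (vsum v) (vsum v) x i 0.
Proof.
move=> Ox; pose q k l : R := Q (v k) (v l) x i 0.
have M0 n : 0 <= M n by apply: le_trans (v_le n); exact: vnorm_ge0 (ltW rho_gt0).
have qM k l : `|q k l| <= K * M k * M l.
  apply: le_trans (Q_le i (v_fin k) (v_fin l) Ox) _.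
  by rewrite ler_pM ?mulr_ge0 ?vnorm_ge0 ?(ltW rho_gt0)// ler_wpM2l.
have := cauchy_product K_ge0 qM M0 M_cvg.
suff -> : ssum (fun k => ssum (q k)) = Q (vsum v) (vsum v) x i 0 by [].
have El := @Q_vsum_l (vsum v) x i vs_fin Ox.
rewrite -[RHS](cvg_lim _ El)// /ssum.
congr (lim (series _ @ \oo)); apply/funext => n.
by have Er := @Q_vsum_r (v n) x i (v_fin n) Ox; rewrite -[RHS](cvg_lim _ Er).
Qed.

End VectorTail.

(** * Oscillating modes and their products *)

Section Modes.
Context {R : realType} {d m : nat}.
Variable Omega : set 'cV[R]_d.
Hypothesis Omega_open : open Omega.
Hypothesis Omega_nonempty : Omega !=set0.
Variable rho0 : R.
Hypothesis rho0_gt0 : 0 < rho0.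

Local Notation field := ('cV[R]_d -> 'cV[R]_m).

(** A finite generator function at every radius below rho0 is what the products
    and the resolvent preserve; at rho0 itself the derivative in Q would lose it. *)
Definition good (u : field) : Prop := forall rho, 0 < rho < rho0 -> finV Omega u rho.

Definition lin2 (a : R) (u : field) (b : R) (w : field) : field :=
  fun x => a *: u x + b *: w x.

Lemma lin2_le a u b w rho : 0 < rho -> finV Omega u rho -> finV Omega w rho ->
  finV Omega (lin2 a u b w) rho /\
  vnorm Omega (lin2 a u b w) rho <= `|a| * vnorm Omega u rho + `|b| * vnorm Omega w rho.
Proof.
move=> r0 fu fw; pose F (i : bool) := if i then u else w.
pose c (i : bool) := if i then a else b.
have fF i : finV Omega (F i) rho by case: i.
have := vnorm_sum Omega_open Omega_nonempty [:: true; false] c r0 fF.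
rewrite !big_cons big_nil addr0 /=.
suff -> : (fun x => \sum_(i <- [:: true; false]) c i *: F i x) = lin2 a u b w by [].
by apply/funext => x; rewrite !big_cons big_nil addr0.
Qed.

Lemma good_lin2 a u b w : good u -> good w -> good (lin2 a u b w).
Proof.
move=> gu gw rho rr; have [r0 _] := andP rr.
exact: (lin2_le a b r0 (gu _ rr) (gw _ rr)).1.
Qed.

Lemma good_half : 0 < rho0 / 2 < rho0.
Proof. by rewrite divr_gt0//= ltr_pdivrMr// ltr_pMr// ltr1n. Qed.

Lemma good_smooth u : good u -> smooth_on Omega u.
Proof. by move=> gu; exact: finV_smooth (gu _ good_half). Qed.

Lemma good0 : good (fun=> 0).
Proof. by move=> rho /andP[r0 _]; exact: (finV0 Omega_nonempty r0).1. Qed.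

(** The pair (p, q) with frequency w stands for the complex-valued field
    p + iq, and contributes Re (e^((k + iw)t) (p + iq)) to a solution whose
    growth rate is k. *)
Record mode := Mode {
  freq : R;
  mre : field;
  mim : field;
  mre_good : good mre;
  mim_good : good mim }.

Definition mode_at (kappa t : R) (mu : mode) : field :=
  lin2 (expR (kappa * t) * cos (freq mu * t)) (mre mu)
       (- (expR (kappa * t) * sin (freq mu * t))) (mim mu).

Definition modes_at (kappa : R) (s : seq mode) (t : R) : field :=
  fun x => \sum_(mu <- s) mode_at kappa t mu x.

Definition mode_norm (rho : R) (mu : mode) : R := cnorm Omega (mre mu) (mim mu) rho.

Definition modes_norm (rho : R) (s : seq mode) : R := \sum_(mu <- s) mode_norm rho mu.

Definition modes_grad_norm (rho : R) (s : seq mode) : R :=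
  \sum_(mu <- s) (grad_norm Omega (mre mu) rho + grad_norm Omega (mim mu) rho).

Lemma mode_norm_ge0 rho mu : 0 <= rho -> 0 <= mode_norm rho mu.
Proof. by move=> r0; rewrite addr_ge0// vnorm_ge0. Qed.

Lemma modes_norm_ge0 rho s : 0 <= rho -> 0 <= modes_norm rho s.
Proof. by move=> r0; apply: sumr_ge0 => mu _; exact: mode_norm_ge0. Qed.

Lemma modes_grad_norm_ge0 rho s : 0 <= rho -> 0 <= modes_grad_norm rho s.
Proof. by move=> r0; apply: sumr_ge0 => mu _; rewrite addr_ge0// grad_norm_ge0. Qed.

Lemma good_mode_at kappa t mu : good (mode_at kappa t mu).
Proof. by apply: good_lin2; [exact: mre_good|exact: mim_good]. Qed.

Lemma mode_at_le kappa t mu rho : 0 < rho < rho0 ->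
  vnorm Omega (mode_at kappa t mu) rho <= expR (kappa * t) * mode_norm rho mu.
Proof.
move=> rr; have [r0 _] := andP rr.
have fp := mre_good mu rr; have fq := mim_good mu rr.
have [_] := lin2_le (expR (kappa * t) * cos (freq mu * t))
  (- (expR (kappa * t) * sin (freq mu * t))) r0 fp fq.
move/le_trans; apply; rewrite /mode_norm /cnorm mulrDr normrN !normrM.
have E : `|expR (kappa * t)| = expR (kappa * t) by rewrite gtr0_norm ?expR_gt0.
have cs : `|cos (freq mu * t)| <= 1.
  by rewrite ler_norml cos_geN1 cos_le1.
have sn : `|sin (freq mu * t)| <= 1.
  by rewrite ler_norml sin_geN1 sin_le1.
by rewrite E; apply: lerD; rewrite ler_wpM2r ?vnorm_ge0 ?(ltW r0)// ler_piMr// expR_ge0.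
Qed.

Lemma modes_at_sum1 kappa s t :
  modes_at kappa s t = fun x => \sum_(mu <- s) 1 *: mode_at kappa t mu x.
Proof. by apply/funext => x; apply: eq_bigr => mu _; rewrite scale1r. Qed.

Lemma modes_at_le kappa s t rho : 0 < rho < rho0 ->
  finV Omega (modes_at kappa s t) rho /\
  vnorm Omega (modes_at kappa s t) rho <= expR (kappa * t) * modes_norm rho s.
Proof.
move=> rr; have [r0 _] := andP rr; rewrite modes_at_sum1.
have [f n] := vnorm_sum Omega_open Omega_nonempty s (fun=> 1) r0
  (fun mu => @good_mode_at kappa t mu rho rr).
split => //; apply: le_trans n _; rewrite /modes_norm mulr_sumr; apply: ler_sum => mu _.
by rewrite normr1 mul1r; exact: mode_at_le.
Qed.

Lemma good_modes_at kappa s t : good (modes_at kappa s t).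
Proof. by move=> rho rr; exact: (modes_at_le kappa s t rr).1. Qed.

Lemma modes_grad_norm_le rho rho' s : 0 < rho' < rho -> rho < rho0 ->
  modes_grad_norm rho' s <= d%:R / (rho - rho') * modes_norm rho s.
Proof.
move=> /andP[r'0 rr] rr0; have r0 := lt_trans r'0 rr.
have R1 : 0 < rho < rho0 by rewrite r0.
have R2 : 0 <= rho' < rho by rewrite rr ltW.
rewrite /modes_norm mulr_sumr; apply: ler_sum => mu _.
rewrite mulrDr; apply: lerD.
  exact: (Ggrad_le Omega_open Omega_nonempty R2 (mre_good mu R1)).2.
exact: (Ggrad_le Omega_open Omega_nonempty R2 (mim_good mu R1)).2.
Qed.

Section Products.
Variables (Q : field -> field -> field) (CQ : R).
Hypothesis Q_bilinear : bilinear_on Omega Q.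
Hypothesis CQ_ge0 : 0 <= CQ.
Hypothesis Q_good : forall u w rho, good u -> good w -> 0 < rho < rho0 ->
  finV Omega (Q u w) rho /\
  vnorm Omega (Q u w) rho <= CQ * vnorm Omega u rho * grad_norm Omega w rho.

Lemma good_Q u w : good u -> good w -> good (Q u w).
Proof. by move=> gu gw rho rr; exact: (Q_good gu gw rr).1. Qed.

(** For complex fields z and z' one has Re z Re z' = Re (z z' + z conj z') / 2.
    Hence the product of two modes under Q is the sum of two modes, whose frequencies
    are the sum and the difference of the given ones; [prod_plus] is Q(z, z') / 2 and
    [prod_minus] is Q(z, conj z') / 2. *)
Definition prod_plus (mu nu : mode) : mode := Mode (freq mu + freq nu)
  (good_lin2 (2^-1) (- 2^-1) (good_Q (mre_good mu) (mre_good nu))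
                             (good_Q (mim_good mu) (mim_good nu)))
  (good_lin2 (2^-1) (2^-1) (good_Q (mre_good mu) (mim_good nu))
                           (good_Q (mim_good mu) (mre_good nu))).

Definition prod_minus (mu nu : mode) : mode := Mode (freq mu - freq nu)
  (good_lin2 (2^-1) (2^-1) (good_Q (mre_good mu) (mre_good nu))
                           (good_Q (mim_good mu) (mim_good nu)))
  (good_lin2 (2^-1) (- 2^-1) (good_Q (mim_good mu) (mre_good nu))
                             (good_Q (mre_good mu) (mim_good nu))).

Definition mode_products (s1 s2 : seq mode) : seq mode :=
  flatten [seq flatten [seq [:: prod_plus mu nu; prod_minus mu nu] | nu <- s2]
          | mu <- s1].

Lemma Q_lin2 a u b w a' u' b' w' x : good u -> good w -> good u' -> good w' -> Omega x ->
  Q (lin2 a u b w) (lin2 a' u' b' w') x =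
  (a * a') *: Q u u' x + (a * b') *: Q u w' x +
  ((b * a') *: Q w u' x + (b * b') *: Q w w' x).
Proof.
move=> gu gw gu' gw' Ox; have [h0 _] := andP good_half.
pose F (i : bool) := if i then u else w.
pose c (i : bool) := if i then a else b.
pose F' (i : bool) := if i then u' else w'.
pose c' (i : bool) := if i then a' else b'.
have fF i : finV Omega (F i) (rho0 / 2).
  by case: i; [exact: gu good_half|exact: gw good_half].
have fF' i : finV Omega (F' i) (rho0 / 2).
  by case: i; [exact: gu' good_half|exact: gw' good_half].
have E1 : lin2 a u b w = fun x => \sum_(i <- [:: true; false]) c i *: F i x.
  by apply/funext => y; rewrite !big_cons big_nil addr0.
have E2 : lin2 a' u' b' w' = fun x => \sum_(i <- [:: true; false]) c' i *: F' i x.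
  by apply/funext => y; rewrite !big_cons big_nil addr0.
have sl := good_smooth (good_lin2 a' b' gu' gw').
have H1 := bilinear_suml Omega_open Omega_nonempty h0 Q_bilinear
  [:: true; false] c fF sl Ox.
rewrite {1}E1 H1 E2 !big_cons big_nil addr0 /=.
have H2 := bilinear_sumr Omega_open Omega_nonempty h0 Q_bilinear
  [:: true; false] c' fF' (good_smooth gu) Ox.
have H3 := bilinear_sumr Omega_open Omega_nonempty h0 Q_bilinear
  [:: true; false] c' fF' (good_smooth gw) Ox.
rewrite H2 H3 !big_cons !big_nil !addr0 /=.
by rewrite !scalerDr !scalerA.
Qed.

(** The addition formulas for cos and sin. *)
Lemma Q_mode_at k1 k2 t mu nu x : Omega x ->
  Q (mode_at k1 t mu) (mode_at k2 t nu) x =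
  modes_at (k1 + k2) [:: prod_plus mu nu; prod_minus mu nu] t x.
Proof.
move=> Ox; rewrite /modes_at !big_cons big_nil addr0.
rewrite (Q_lin2 _ _ _ _ (mre_good mu) (mim_good mu) (mre_good nu) (mim_good nu) Ox).
rewrite /mode_at /lin2 /= mulrDl expRD mulrDl mulrBl cosD sinD cosB sinB.
set e1 := expR _; set e2 := expR _.
set c1 := cos _; set c2 := cos _; set s1 := sin _; set s2 := sin _.
apply/matrixP => i k; rewrite !mxE.
move: (Q (mre mu) (mre nu) x i k) (Q (mre mu) (mim nu) x i k)
  (Q (mim mu) (mre nu) x i k) (Q (mim mu) (mim nu) x i k) => q1 q2 q3 q4.
move: e1 e2 c1 c2 s1 s2 => e1 e2 c1 c2 s1 s2. 
by field.
Qed.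

Lemma Q_modes_at k1 k2 s1 s2 t x : Omega x ->
  Q (modes_at k1 s1 t) (modes_at k2 s2 t) x =
  modes_at (k1 + k2) (mode_products s1 s2) t x.
Proof.
move=> Ox; have [h0 _] := andP good_half.
have H1 := bilinear_suml Omega_open Omega_nonempty h0 Q_bilinear s1 (fun=> 1)
  (fun mu => @good_mode_at k1 t mu _ good_half)
  (good_smooth (@good_modes_at k2 s2 t)) Ox.
rewrite modes_at_sum1 H1 /modes_at /mode_products big_flatten big_map.
apply: eq_bigr => mu _; rewrite scale1r big_flatten big_map.
have H2 := bilinear_sumr Omega_open Omega_nonempty h0 Q_bilinear s2 (fun=> 1)
  (fun nu => @good_mode_at k2 t nu _ good_half)
  (good_smooth (@good_mode_at k1 t mu)) Ox.
rewrite -/(modes_at k2 s2 t) modes_at_sum1 H2.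
by apply: eq_bigr => nu _; rewrite scale1r Q_mode_at.
Qed.

(** The number of modes doubles in a product, but each of them carries a
    factor 1/2, so that the norms multiply without any combinatorial loss. *)
Lemma mode_products_norm rho s1 s2 : 0 < rho < rho0 ->
  modes_norm rho (mode_products s1 s2) <= CQ * modes_norm rho s1 * modes_grad_norm rho s2.
Proof.
move=> rr; have [r0 _] := andP rr.
rewrite /modes_norm /mode_products big_flatten big_map.
rewrite -mulrA mulr_suml mulr_sumr.
apply: ler_sum => mu _; rewrite big_flatten big_map mulrA /modes_grad_norm mulr_sumr.
apply: ler_sum => nu _; rewrite !big_cons big_nil/= addr0.
have gp := mre_good mu; have gq := mim_good mu.
have gp' := mre_good nu; have gq' := mim_good nu.
have [f1 n1] := Q_good gp gp' rr; have [f2 n2] := Q_good gq gq' rr.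
have [f3 n3] := Q_good gp gq' rr; have [f4 n4] := Q_good gq gp' rr.
have [_ m1] := lin2_le (2^-1) (- 2^-1) r0 f1 f2.
have [_ m2] := lin2_le (2^-1) (2^-1) r0 f3 f4.
have [_ m3] := lin2_le (2^-1) (2^-1) r0 f1 f2.
have [_ m4] := lin2_le (2^-1) (- 2^-1) r0 f4 f3.
rewrite /mode_norm /cnorm /=.
have h : `|2^-1 : R| = 2^-1 by rewrite ger0_norm.
rewrite normrN h in m1 m2 m3 m4.
apply: (le_trans (lerD (lerD m1 m2) (lerD m3 m4))).
move: n1 n2 n3 n4.
move: (vnorm Omega (Q (mre mu) (mre nu)) rho) (vnorm Omega (Q (mim mu) (mim nu)) rho).
move: (vnorm Omega (Q (mre mu) (mim nu)) rho) (vnorm Omega (Q (mim mu) (mre nu)) rho).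
move: (vnorm Omega (mre mu) rho) (vnorm Omega (mim mu) rho).
move: (grad_norm Omega (mre nu) rho) (grad_norm Omega (mim nu) rho).
move=> c e a b q1 q2 q3 q4.
rewrite (_ : CQ * (a + b) * (c + e) = CQ * a * c + CQ * a * e + CQ * b * c + CQ * b * e);
  last by ring.
lra.
Qed.

End Products.

End Modes.

(** * Inversion of lambda - L on a mode *)

Lemma re_colE {R : realType} (T : Type) m (f : T -> 'cV[R[i]]_m) x i :
  re_col f x i 0 = complex.Re (f x i 0).
Proof. by rewrite mxE. Qed.

Lemma im_colE {R : realType} (T : Type) m (f : T -> 'cV[R[i]]_m) x i :
  im_col f x i 0 = complex.Im (f x i 0).
Proof. by rewrite mxE. Qed.

Lemma complex_split {R : realType} (k w l1 l2 : R) (z z' : R[i]) :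
  (k +i* w)%C * z = (l1 +i* l2)%C + z' ->
  k * complex.Re z - w * complex.Im z = l1 + complex.Re z' /\
  w * complex.Re z + k * complex.Im z = l2 + complex.Im z'.
Proof.
case: z z' => [a b] [a' b'] /eqP; rewrite eq_complex /= => /andP[/eqP E1 /eqP E2].
by split; rewrite // -E2 addrC.
Qed.

Section Solver.
Context {R : realType} {d m : nat}.
Variable Omega : set 'cV[R]_d.
Hypothesis Omega_open : open Omega.
Hypothesis Omega_nonempty : Omega !=set0.
Variable rho0 : R.
Hypothesis rho0_gt0 : 0 < rho0.
Variables (A : 'cV[R]_m -> 'cV[R]_m) (B : 'I_d -> 'cV[R]_m -> 'M[R]_m)
  (u0 : 'cV[R]_d -> 'cV[R]_m).
Variables (X : function_space m Omega) (L : unbounded_operator X).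
Hypothesis L_linearization : is_linearization A B u0 L.

Local Notation mode := (mode Omega rho0 (m := m)).
Local Notation Lin := (linearized A B u0).

Let memO x : Omega x -> x \in Omega. Proof. by move=> Ox; rewrite inE. Qed.

Lemma fs_fun0 x : Omega x -> fs_fun (0 : X) x = 0.
Proof.
move=> Ox; have := fs_linear (1 : R[i]) (0 : X) 0 (memO Ox).
rewrite scaler0 addr0 scale1r => /eqP.
by rewrite -[X in X == _]addr0 (inj_eq (addrI _)) eq_sym => /eqP.
Qed.

Lemma fs_funZ (a : R[i]) (f : X) x : Omega x -> fs_fun (a *: f) x = a *: fs_fun f x.
Proof.
move=> Ox; have := fs_linear a f 0 (memO Ox).
by rewrite addr0 fs_fun0// addr0.
Qed.

(** The complex equation (k + iw)(p + iq) = L(p + iq) + (P + iP') split into real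
    and imaginary parts. *)
Definition mode_eq (kappa w : R) (p q P P' : 'cV[R]_d -> 'cV[R]_m) : Prop :=
  forall x i, Omega x ->
    kappa * p x i 0 - w * q x i 0 = Lin p x i 0 + P x i 0 /\
    w * p x i 0 + kappa * q x i 0 = Lin q x i 0 + P' x i 0.

Lemma resolvent_mode_eq (phi f : X) (kappa w rho : R) :
  op_dom L phi -> (kappa +i* w)%C *: phi - L phi = f ->
  finV Omega (re_col (fs_fun phi)) rho -> finV Omega (im_col (fs_fun phi)) rho ->
  mode_eq kappa w (re_col (fs_fun phi)) (im_col (fs_fun phi))
                  (re_col (fs_fun f)) (im_col (fs_fun f)).
Proof.
move=> dphi E fr fi x i Ox.
have sC1 (u : 'cV[R]_d -> 'cV[R]_m) : finV Omega u rho -> C1_on Omega u.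
  move=> fu y Oy j; have su := finV_smooth Omega_open fu.
  by split; [exact: (su [::] y Oy).2|exact: (su [:: j] y Oy).1].
have HL := L_linearization dphi (sC1 _ fr) (sC1 _ fi) (memO Ox).
have E1 : (kappa +i* w)%C *: phi = 1 *: L phi + f by rewrite scale1r -E addrC subrK.
have E2 := etrans (esym (fs_funZ (kappa +i* w)%C phi Ox))
  (etrans (congr1 (fun g : X => fs_fun g x) E1) (fs_linear 1 (L phi) f (memO Ox))).
have E3 : (kappa +i* w)%C * fs_fun phi x i 0 = fs_fun (L phi) x i 0 + fs_fun f x i 0.
  by have := congr1 (fun u : 'cV[R[i]]_m => u i 0) E2; rewrite scale1r mxE [RHS]mxE.
have HL' : fs_fun (L phi) x i 0 = (Lin (re_col (fs_fun phi)) x i 0 +i*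
    Lin (im_col (fs_fun phi)) x i 0)%C.
  by apply: etrans (congr1 (fun u : 'cV[R[i]]_m => u i 0) HL) _; exact: mxE.
rewrite (re_colE (fs_fun phi)) (im_colE (fs_fun phi)) (re_colE (fs_fun f))
  (im_colE (fs_fun f)).
exact: (complex_split (etrans E3 (congr1 (fun z => z + fs_fun f x i 0) HL'))).
Qed.

Variables (C0 r : R).
Hypothesis r_gt0 : 0 < r.
Hypothesis resolvent_bound : forall lambda : R[i],
     2 * r <= complex.Re lambda ->
     exists2 S : X -> X, is_resolvent L lambda S &
       forall (u : 'cV[R]_d -> 'cV[R[i]]_m) (rho : R),
         0 <= rho <= rho0 -> (GCvec Omega u rho < +oo)%E ->
         exists2 f : X, {in Omega, fs_fun f =1 u} &
           (GCvec Omega (fs_fun (S f)) rho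
            <= (C0 / cmod lambda)%:E * GCvec Omega u rho)%E.

Lemma GCvec_ge0 (u : 'cV[R]_d -> 'cV[R[i]]_m) rho : 0 <= rho ->
  (0 <= GCvec Omega u rho)%E.
Proof.
move=> r0; apply: sume_ge0 => i _.
by apply: le_trans (GC_re_im Omega (fun x => u x i 0%R) r0).1; exact: G_ge0.
Qed.

(** The resolvent at lambda = n r + i w, with w the frequency of the source, solves
    for the mode at order n. As |lambda| >= n r, it gains the factor 1/n that
    compensates the loss of a derivative in Q. *)
Lemma mode_solve n (sigma : mode) : (2 <= n)%N -> exists mu : mode,
  [/\ freq mu = freq sigma,
      mode_eq (n%:R * r) (freq mu) (mre mu) (mim mu) (mre sigma) (mim sigma) &
      forall rho, 0 < rho < rho0 ->
        mode_norm rho mu <= 2 * (`|C0| / (n%:R * r)) * mode_norm rho sigma].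
Proof.
move=> n2; set w := freq sigma; set kappa := n%:R * r.
have k0 : 0 < kappa by rewrite mulr_gt0// ltr0n; case: n n2 @kappa.
have kr : 2 * r <= complex.Re (kappa +i* w)%C by rewrite /= ler_pM2r// ler_nat.
have [S [dS SE _ _] Sbound] := resolvent_bound kr.
pose u x : 'cV[R[i]]_m := \col_i (mre sigma x i 0 +i* mim sigma x i 0)%C.
have ur : re_col u = mre sigma.
  by apply/funext => x; apply/matrixP => i k; rewrite ord1 !mxE.
have ui : im_col u = mim sigma.
  by apply/funext => x; apply/matrixP => i k; rewrite ord1 !mxE.
have cmodk : kappa <= cmod (kappa +i* w)%C.
  by apply: le_trans (cmod_ge_Re kappa w); exact: ler_norm.
have uB rho : 0 < rho < rho0 -> (GCvec Omega u rho <= (mode_norm rho sigma)%:E)%E.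
  move=> rr; have [r0 _] := andP rr; rewrite /mode_norm -ur -ui.
  by apply: (GCvec_le Omega_nonempty r0); rewrite ?ur ?ui;
    [exact: mre_good|exact: mim_good].
have Sf rho : 0 < rho < rho0 -> exists2 f : X, {in Omega, fs_fun f =1 u} &
    (GCvec Omega (fs_fun (S f)) rho <=
      (`|C0| / kappa * mode_norm rho sigma)%:E)%E.
  move=> rr; have [r0 rr0] := andP rr.
  have [||f fu Gf] := Sbound u rho; first by rewrite !ltW.
    by apply: le_lt_trans (uB _ rr) _; rewrite ltry.
  exists f => //; apply: le_trans Gf _; rewrite [leRHS]EFinM.
  have cp : 0 < cmod (kappa +i* w)%C by exact: lt_le_trans k0 cmodk.
  apply: (@le_trans _ _ ((`|C0| / kappa)%:E * GCvec Omega u rho)%E).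
    apply: lee_wpmul2r; first exact: GCvec_ge0 (ltW r0).
    rewrite lee_fin; apply: (@le_trans _ _ (`|C0| / cmod (kappa +i* w)%C)).
      by rewrite ler_wpM2r ?invr_ge0 ?(ltW cp)// ler_norm.
    by rewrite ler_wpM2l// lef_pV2.
  by apply: lee_wpmul2l; [rewrite lee_fin divr_ge0// ltW|exact: uB].
have rh : 0 < rho0 / 2 < rho0 by exact: good_half.
have [f fu _] := Sf _ rh.
(* The element of X that represents the source is the same at every radius, because
   an element of X is determined by its values on Omega. *)
have funiq g : {in Omega, fs_fun g =1 u} -> g = f.
  by move=> gu; apply: fs_inj => x Ox; rewrite gu// fu.
have B3 rho : 0 < rho < rho0 ->
   [/\ finV Omega (re_col (fs_fun (S f))) rho, finV Omega (im_col (fs_fun (S f))) rho &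
      cnorm Omega (re_col (fs_fun (S f))) (im_col (fs_fun (S f))) rho <=
       2 * (`|C0| / kappa * mode_norm rho sigma)].
  move=> rr; have [r0 _] := andP rr; have [g gu Gg] := Sf _ rr.
  rewrite (funiq g gu) in Gg.
  exact: (GCvec_re_im Omega_nonempty (ltW r0) Gg).
have gre : good Omega rho0 (re_col (fs_fun (S f))).
  by move=> rho rr; have [] := B3 rho rr.
have gim : good Omega rho0 (im_col (fs_fun (S f))).
  by move=> rho rr; have [] := B3 rho rr.
exists (Mode w gre gim); split => //=; last first.
  by move=> rho rr; rewrite -mulrA; have [] := B3 rho rr.
move=> x i Ox.
have := resolvent_mode_eq (dS f) (SE f) (gre _ rh) (gim _ rh) i Ox.
have E1 : re_col (fs_fun f) x i 0 = mre sigma x i 0.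
  by rewrite re_colE (fu x (memO Ox)) mxE.
have E2 : im_col (fs_fun f) x i 0 = mim sigma x i 0.
  by rewrite im_colE (fu x (memO Ox)) mxE.
by rewrite E1 E2.
Qed.

End Solver.

(** * The majorant recursion *)

Section Majorant.
Context {R : realType}.

Let s (j : nat) : R := (j.+1%:R ^+ 2)^-1.

Let s_ge0 j : 0 <= s j.
Proof. by rewrite invr_ge0 sqr_ge0. Qed.

Lemma sum_inv_sq N : \sum_(j < N.+1) s j <= 2 - N.+1%:R^-1.
Proof.
elim: N => [|N IH]; first by rewrite big_ord1 /s expr1n invr1; lra.
rewrite big_ord_recr/=; apply: le_trans (lerD IH (lexx _)) _.
rewrite /s; set x : R := N.+1%:R; have x0 : 0 < x by rewrite ltr0n.
have -> : N.+2%:R = x + 1 :> R by rewrite -natr1.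
have -> : 2 - (x + 1)^-1 = 2 - x^-1 + (x * (x + 1))^-1.
  by field; rewrite !gt_eqF//; lra.
by rewrite lerD2l lef_pV2 ?posrE ?mulr_gt0 ?exprn_gt0 ?addr_gt0//; nra.
Qed.

(** As (x + y)^2 <= 2 (x^2 + y^2), the weights 1/n^2 are stable under convolution up
    to a constant. This keeps the majorant of a quadratic recursion geometric. *)
Lemma inv_sq_convolution p :
  \sum_(j < p.+1) s j * s (p - j) <= 8 * s p.+1.
Proof.
have h j : (j < p.+1)%N -> s j * s (p - j) <= 2 * s p.+1 * (s j + s (p - j)).
  rewrite ltnS => jp; rewrite /s.
  have -> : p.+2%:R = j.+1%:R + (p - j).+1%:R :> R.
    by rewrite -natrD addSn addnS subnKC.
  set x : R := j.+1%:R; set y : R := (p - j).+1%:R.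
  have x0 : 0 < x by rewrite ltr0n.
  have y0 : 0 < y by rewrite ltr0n.
  have xy : 0 < x + y by rewrite addr_gt0.
  have -> : 2 * ((x + y) ^+ 2)^-1 * ((x ^+ 2)^-1 + (y ^+ 2)^-1) =
      (2 * (x ^+ 2 + y ^+ 2)) / (x ^+ 2 * y ^+ 2 * (x + y) ^+ 2).
    by field; rewrite !gt_eqF.
  rewrite ler_pdivlMr ?mulr_gt0 ?exprn_gt0//.
  have -> : (x ^+ 2)^-1 * (y ^+ 2)^-1 * (x ^+ 2 * y ^+ 2 * (x + y) ^+ 2) = (x + y) ^+ 2.
    by field; rewrite !gt_eqF.
  by have := sqr_ge0 (x - y); rewrite sqrrB sqrrD => ?; lra.
apply: (@le_trans _ _ (\sum_(j < p.+1) 2 * s p.+1 * (s j + s (p - j)))).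
  by apply: ler_sum => j _; exact: h.
rewrite -mulr_sumr big_split/=.
have -> : \sum_(j < p.+1) s (p - j) = \sum_(j < p.+1) s j.
  rewrite (reindex_inj rev_ord_inj)/=; apply: eq_bigr => j _.
  by rewrite subSS subKn// -ltnS.
have S2 : \sum_(j < p.+1) s j <= 2.
  by apply: le_trans (sum_inv_sq p) _; rewrite gerBl invr_ge0.
have := s_ge0 p.+1; set S := \sum_(j < _) _ in S2 *; nra.
Qed.

Lemma expr_1Dinv_le (l : nat) : (1 + l.+1%:R^-1) ^+ l <= expR 1 :> R.
Proof.
have l0 : 0 < (l.+1%:R : R) by rewrite ltr0n.
apply: (@le_trans _ _ ((1 + l.+1%:R^-1) ^+ l.+1)).
  by rewrite exprS ler_peMl ?exprn_ge0 ?addr_ge0 ?invr_ge0// lerDl invr_ge0.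
apply: (@le_trans _ _ (expR (l.+1%:R^-1) ^+ l.+1)).
  by rewrite lerXn2r ?nnegrE ?expR_ge0 ?addr_ge0 ?invr_ge0// expR_ge1Dx.
by rewrite -expRM_natl mulfV// gt_eqF.
Qed.

(** The Cauchy-Kovalevskaya majorant. In the recursion for g the derivative
    falls on one factor, and is paid for by enlarging the radius by the fraction
    1/(l+1) of the distance to rho0 for the term of order l; the division by n,
    which comes from the resolvent, absorbs the resulting factor l. *)
Lemma majorant (g gd : nat -> R -> R) (a K D rho0 : R) :
  0 <= a -> 0 <= K -> 0 <= D ->
  (forall n rho, 0 < rho < rho0 -> 0 <= g n rho) ->
  (forall n rho, 0 < rho < rho0 -> 0 <= gd n rho) ->
  (forall rho, 0 < rho < rho0 -> g 1%N rho <= a) ->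
  (forall p rho, 0 < rho < rho0 -> g p.+2 rho <=
     K / p.+2%:R * \sum_(j < p.+1) g j.+1 rho * gd (p - j).+1 rho) ->
  (forall n rho rho', 0 < rho' < rho -> rho < rho0 ->
     gd n rho' <= D / (rho - rho') * g n rho) ->
  forall p rho, 0 < rho < rho0 ->
    g p.+1 rho <= a * (16 * K * D * expR 1 * a / (rho0 - rho)) ^+ p * s p.
Proof.
move=> a0 K0 D0 g0 gd0 g1 grec gdg; set b := 16 * K * D * expR 1 * a.
have e0 : 0 <= expR 1 :> R by exact: expR_ge0.
have b0 : 0 <= b by rewrite !mulr_ge0.
elim/ltn_ind => -[|p] IH rho rr.
  by rewrite expr0 mulr1 /s expr1n invr1 mulr1; exact: g1.
have [r0 rr0] := andP rr; set w := rho0 - rho; have w0 : 0 < w by rewrite subr_gt0.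
have beta0 : 0 <= b / w by rewrite divr_ge0// ltW.
have gdl l : (l < p.+1)%N ->
    gd l.+1 rho <= 2 * expR 1 * D * a / w * ((b / w) ^+ l * (l.+1%:R * s l)).
  move=> lp; set x : R := l.+1%:R; have x0 : 0 < x by rewrite ltr0n.
  have x1 : 1 <= x by rewrite ler1n.
  (* With this radius, rho0 - rho' is rho0 - rho divided by 1 + 1/x, and the l-th power
     of 1 + 1/x stays below e. *)
  pose rho' := rho + w / (x + 1).
  have x10 : 0 < x + 1 by rewrite addr_gt0.
  have d1 : rho' - rho = w / (x + 1) by rewrite /rho' addrAC subrr add0r.
  have d2 : rho0 - rho' = w * x / (x + 1).
    by rewrite /rho' opprD addrA -/w; field; rewrite gt_eqF.
  have r1 : rho < rho' by rewrite -subr_gt0 d1 divr_gt0.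
  have r2 : rho' < rho0 by rewrite -subr_gt0 d2 divr_gt0// mulr_gt0.
  have rr' : 0 < rho' < rho0 by rewrite r2 andbT (lt_trans r0).
  have r0r1 : 0 < rho < rho' by rewrite r0.
  apply: le_trans (gdg _ _ _ r0r1 r2) _; rewrite d1.
  have := IH l lp rho' rr'; rewrite d2 => gl.
  have c0 : 0 <= D / (w / (x + 1)) by rewrite divr_ge0// divr_ge0// ltW.
  apply: le_trans (ler_wpM2l c0 gl) _.
  have -> : b / (w * x / (x + 1)) = (b / w) * (1 + x^-1).
    by field; rewrite !gt_eqF.
  rewrite exprMn; have E1 := expr_1Dinv_le l; rewrite -/x in E1.
  have q0 : 0 <= (b / w) ^+ l by rewrite exprn_ge0.
  have sl := s_ge0 l.
  have E2 : 0 <= (1 + x^-1) ^+ l by rewrite exprn_ge0// addr_ge0// invr_ge0 ltW.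
  have -> : D / (w / (x + 1)) * (a * ((b / w) ^+ l * (1 + x^-1) ^+ l) * s l) =
    D * a / w * (b / w) ^+ l * s l * ((x + 1) * (1 + x^-1) ^+ l).
    by field; rewrite !gt_eqF.
  have -> : 2 * expR 1 * D * a / w * ((b / w) ^+ l * (x * s l)) =
    D * a / w * (b / w) ^+ l * s l * (2 * x * expR 1) by ring.
  rewrite ler_wpM2l//; first by rewrite !mulr_ge0// invr_ge0 ltW.
  by apply: ler_pM => //; lra.
apply: le_trans (grec p rho rr) _.
have gk k : (k < p.+1)%N -> g k.+1 rho <= a * (b / w) ^+ k * s k.
  by move=> kp; exact: IH.
pose c := 2 * expR 1 * D * a / w.
have c0 : 0 <= c by rewrite !mulr_ge0// invr_ge0 ltW.
have term (j : 'I_p.+1) : g j.+1 rho * gd (p - j).+1 rho <=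
    c * a * (b / w) ^+ p * p.+2%:R * (s j * s (p - j)).
  have jp : (j <= p)%N by rewrite -ltnS.
  have pj : (p - j < p.+1)%N by rewrite ltnS leq_subr.
  apply: le_trans (ler_pM (g0 _ _ rr) (gd0 _ _ rr) (gk _ (ltn_ord j)) (gdl _ pj)) _.
  have Ep : (b / w) ^+ p = (b / w) ^+ j * (b / w) ^+ (p - j) by rewrite -exprD subnKC.
  rewrite -/c Ep.
  have -> : a * (b / w) ^+ j * s j *
     (c * ((b / w) ^+ (p - j) * ((p - j).+1%:R * s (p - j)))) =
     c * a * ((b / w) ^+ j * (b / w) ^+ (p - j)) * (s j * s (p - j)) * (p - j).+1%:R by ring.
  rewrite [leRHS]mulrAC; apply: ler_wpM2l.
    apply: mulr_ge0; last by apply: mulr_ge0; exact: s_ge0.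
    apply: mulr_ge0; first exact: mulr_ge0.
    by apply: mulr_ge0; exact: exprn_ge0.
  by rewrite ler_nat ltnS (leq_trans (leq_subr _ _))// leqnSn.
have q0 : 0 <= (b / w) ^+ p by rewrite exprn_ge0.
have x0 : 0 < p.+2%:R :> R by rewrite ltr0n.
apply: (@le_trans _ _ (K / p.+2%:R * (c * a * (b / w) ^+ p * p.+2%:R * (8 * s p.+1)))).
  rewrite ler_wpM2l ?divr_ge0 ?ler0n//.
  apply: (@le_trans _ _ (\sum_(j < p.+1)
     c * a * (b / w) ^+ p * p.+2%:R * (s j * s (p - j)))).
    by apply: ler_sum => j _; exact: term.
  rewrite -mulr_sumr ler_wpM2l//; last exact: inv_sq_convolution.
  apply: mulr_ge0; last exact: ltW.
  by apply: mulr_ge0 => //; exact: mulr_ge0.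
rewrite exprS le_eqVlt; apply/orP; left; apply/eqP.
rewrite /c; move: ((b / w) ^+ p) (s p.+1) => q sp; rewrite /b.
by field; rewrite !gt_eqF.
Qed.

End Majorant.

Section Levels.
Variables (T : Type) (prods : seq T -> seq T -> seq T) (sol : nat -> T -> T) (z : T).

Let next n (ls : seq (seq T)) : seq T :=
  map (sol n) (if n == 1%N then [:: z]
    else flatten [seq prods (nth [::] ls k) (nth [::] ls (n - k)) | k <- index_iota 1 n]).

Let levels := fix levels n : seq (seq T) :=
  if n is n'.+1 then rcons (levels n') (next n (levels n')) else [:: [::]].

Let size_levels n : size (levels n) = n.+1.
Proof. by elim: n => [//|n IH] /=; rewrite size_rcons IH. Qed.

Let nth_levels n k : (k <= n)%N -> nth [::] (levels n) k = nth [::] (levels k) k.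
Proof.
elim: n => [|n IH]; first by rewrite leqn0 => /eqP ->.
rewrite leq_eqVlt => /orP[/eqP ->//|]; rewrite ltnS => kn.
by rewrite /= nth_rcons size_levels ltnS kn IH.
Qed.

(** Course-of-values recursion: each level is built from products of all the earlier
    ones, so the levels are constructed as a growing list. *)
Lemma exists_levels : exists level : nat -> seq T,
  [/\ level 0%N = [::], level 1%N = [:: sol 1 z] &
      forall p, level p.+2 = map (sol p.+2)
        (flatten [seq prods (level k) (level (p.+2 - k)%N) | k <- index_iota 1 p.+2])].
Proof.
exists (fun n => nth [::] (levels n) n); split => // p.
have -> : nth [::] (levels p.+2) p.+2 = next p.+2 (levels p.+1).
  rewrite -[levels p.+2]/(rcons (levels p.+1) (next p.+2 (levels p.+1))).
  by rewrite nth_rcons size_levels ltnn eqxx.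
rewrite /next; congr (map _ (flatten _)); apply/eq_in_map => k.
rewrite mem_index_iota => /andP[k1 k2].
by congr prods; apply: nth_levels; lia.
Qed.

End Levels.

(** * Modes as functions of time *)

Section TimeDerivative.
Context {R : realType}.

(** The function Re (e^((kappa + i w) t) (a + i b)); its time derivative is the
    multiplication of a + i b by kappa + i w. *)
Definition osc (kappa w a b t : R) : R :=
  expR (kappa * t) * cos (w * t) * a + - (expR (kappa * t) * sin (w * t)) * b.

Lemma is_derive_osc (kappa w a b t : R) :
  is_derive t 1 (osc kappa w a b)
    (osc kappa w (kappa * a - w * b) (w * a + kappa * b) t).
Proof.
have DE := is_derive_scale (is_derive_expR (kappa * t)).
have DC := is_derive_scale (is_derive_cos (w * t)).
have DS := is_derive_scale (is_derive_sin (w * t)).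
have D := is_deriveD (is_deriveZ a (is_deriveM DE DC))
  (is_deriveZ (- b) (is_deriveM DE DS)).
move: D; set F := (X in is_derive _ _ X _) => D.
have -> : osc kappa w a b = F.
  by apply/funext => s; rewrite /osc /F !fctE /= -![_ *: _]/(_ * _); ring.
apply: is_derive_eq D _; rewrite /osc.
set e := expR _; set c := cos _; set s := sin _.
rewrite -![_ *: _]/(_ * _); ring.
Qed.

Lemma osc_driven (kappa w t a b l l' p p' : R) : a = l + p -> b = l' + p' ->
  osc kappa w a b t = expR (kappa * t) * cos (w * t) * l +
    - (expR (kappa * t) * sin (w * t)) * l' + osc kappa w p p' t.
Proof. by move=> -> ->; rewrite /osc; ring. Qed.

Lemma osc_le (kappa w a b t : R) :
  `|osc kappa w a b t| <= expR (kappa * t) * (`|a| + `|b|).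
Proof.
have cs : `|cos (w * t)| <= 1 by rewrite ler_norml cos_geN1 cos_le1.
have sn : `|sin (w * t)| <= 1 by rewrite ler_norml sin_geN1 sin_le1.
have e0 := expR_gt0 (kappa * t); apply: le_trans (ler_normD _ _) _.
rewrite mulrDr mulNr normrN !normrM (gtr0_norm e0).
by apply: lerD; rewrite ler_wpM2r// ler_piMr// ltW.
Qed.

Lemma continuous_osc_coef (T : topologicalType) (kappa w : R) (tau f g : T -> R) (p : T) :
  {for p, continuous tau} -> {for p, continuous f} -> {for p, continuous g} ->
  {for p, continuous (fun z => osc kappa w (f z) (g z) (tau z))}.
Proof.
move=> ct cf cg.
have ce : expR (kappa * tau z) @[z --> p] --> expR (kappa * tau p).
  have ckt : kappa * tau z @[z --> p] --> kappa * tau p.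
    by apply: cvgM => //; exact: cvg_cst.
  by apply: continuous_cvg; [exact: continuous_expR|exact: ckt].
have cwt : w * tau z @[z --> p] --> w * tau p by apply: cvgM => //; exact: cvg_cst.
have cc : cos (w * tau z) @[z --> p] --> cos (w * tau p).
  by apply: continuous_cvg; [exact: continuous_cos|exact: cwt].
have csn : sin (w * tau z) @[z --> p] --> sin (w * tau p).
  by apply: continuous_cvg; [exact: continuous_sin|exact: cwt].
exact: (cvgD (cvgM (cvgM ce cc) cf) (cvgM (cvgN (cvgM ce csn)) cg)).
Qed.

Lemma is_derive_bigsum (I : Type) (s : seq I) (F : I -> R -> R) (D : I -> R) (t : R) :
  (forall i, is_derive t 1 (F i) (D i)) ->
  is_derive t 1 (fun z => \sum_(i <- s) F i z) (\sum_(i <- s) D i).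
Proof.
move=> FD; elim: s => [|i s IH].
  rewrite big_nil (_ : (fun z => \sum_(i <- [::]) F i z) = cst 0).
    exact: is_derive_cst.
  by apply/funext => z; rewrite big_nil.
rewrite big_cons (_ : (fun z => \sum_(j <- i :: s) F j z) =
   (F i) + (fun z => \sum_(j <- s) F j z)); first exact: is_deriveD.
by apply/funext => z; rewrite big_cons.
Qed.

Lemma cvg_bigsum (T : Type) (F : set_system T) {FF : Filter F} (I : Type) (s : seq I)
    (f : I -> T -> R) (l : I -> R) :
  (forall i, f i z @[z --> F] --> l i) ->
  \sum_(i <- s) f i z @[z --> F] --> \sum_(i <- s) l i.
Proof.
move=> fl; elim: s => [|i s IH].
  rewrite big_nil (_ : (fun z => \sum_(i <- [::]) f i z) = cst 0); first exact: cvg_cst.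
  by apply/funext => z; rewrite big_nil.
rewrite big_cons (_ : (fun z => \sum_(j <- i :: s) f j z) =
   (fun z => f i z + \sum_(j <- s) f j z)); first exact: cvgD.
by apply/funext => z; rewrite big_cons.
Qed.

Lemma series_bigsum (I : Type) (s : seq I) (c : I -> R) (a : I -> nat -> R) (l : I -> R) :
  (forall i, series (a i) @ \oo --> l i) ->
  series (fun n => \sum_(i <- s) c i * a i n) @ \oo --> \sum_(i <- s) c i * l i.
Proof.
move=> al; rewrite (_ : series _ = fun n => \sum_(i <- s) c i * series (a i) n); last first.
  apply/funext => n; rewrite /series/= exchange_big/=.
  by apply: eq_bigr => i _; rewrite mulr_sumr.
by apply: cvg_bigsum => i; apply: cvgM => //; exact: cvg_cst.
Qed.

End TimeDerivative.

Section AllSeq.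
Variable T : Type.
Implicit Types (P : T -> Prop) (s : seq T).

(** A predicate with values in Prop, as modes have no decidable equality. *)
Fixpoint allProp P s : Prop := if s is x :: s' then P x /\ allProp P s' else True.

Lemma allProp_cat P s s' : allProp P s -> allProp P s' -> allProp P (s ++ s').
Proof. by elim: s => [//|x s IH] /= [px ps] ps'; split => //; exact: IH. Qed.

Lemma allProp_flatten (I : eqType) P (l : seq I) (F : I -> seq T) :
  (forall k, k \in l -> allProp P (F k)) -> allProp P (flatten [seq F k | k <- l]).
Proof.
elim: l => [//|k l IH] FP /=; apply: allProp_cat; first by apply: FP; rewrite mem_head.
by apply: IH => j jl; apply: FP; rewrite inE jl orbT.
Qed.

End AllSeq.

Lemma allProp_map (T T' : Type) (P : T -> Prop) (P' : T' -> Prop) (f : T -> T') s :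
  (forall x, P x -> P' (f x)) -> allProp P s -> allProp P' (map f s).
Proof. by move=> fP; elim: s => [//|x s IH] /= [px ps]; split; auto. Qed.

Section Dynamics.
Context {R : realType} {d m : nat}.
Variable Omega : set 'cV[R]_d.
Hypothesis Omega_open : open Omega.
Hypothesis Omega_nonempty : Omega !=set0.
Variable rho0 : R.
Hypothesis rho0_gt0 : 0 < rho0.
Variables (A : 'cV[R]_m -> 'cV[R]_m) (B : 'I_d -> 'cV[R]_m -> 'M[R]_m)
  (u0 : 'cV[R]_d -> 'cV[R]_m).
Hypothesis A_analytic : forall i, real_analytic (fun y => A y i 0).
Hypothesis B_analytic : forall j i k, real_analytic (fun y => B j y i k).

Local Notation mode := (mode Omega rho0 (m := m)).
Local Notation Lin := (linearized A B u0).

Lemma partial_lin2 j a u b w x : smooth_on Omega u -> smooth_on Omega w -> Omega x ->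
  partial j (lin2 a u b w) x = a *: partial j u x + b *: partial j w x :> 'cV[R]_m.
Proof.
move=> su sw Ox; have du := (su [::] x Ox).2 j; have dw := (sw [::] x Ox).2 j.
exact: (@derive_val _ _ _ _ _ _ _
  (is_deriveD (is_deriveZ a (derivableP du)) (is_deriveZ b (derivableP dw)))).
Qed.

Lemma linearized_lin2 a u b w x i : smooth_on Omega u -> smooth_on Omega w -> Omega x ->
  Lin (lin2 a u b w) x i 0 = a * Lin u x i 0 + b * Lin w x i 0.
Proof.
move=> su sw Ox; have [M0 E] := linearizedE u0 x A_analytic B_analytic.
have h1 : \sum_k M0 i k * lin2 a u b w x k 0 =
    a * (\sum_k M0 i k * u x k 0) + b * (\sum_k M0 i k * w x k 0).
  rewrite !mulr_sumr -big_split/=; apply: eq_bigr => k _.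
  by rewrite /lin2 !mxE; ring.
have h2 j : \sum_k B j (u0 x) i k * partial j (lin2 a u b w) x k 0 =
    a * (\sum_k B j (u0 x) i k * partial j u x k 0) +
    b * (\sum_k B j (u0 x) i k * partial j w x k 0).
  have Ep := partial_lin2 j a b su sw Ox.
  move: (partial j (lin2 a u b w) x) (partial j u x) (partial j w x) Ep => _ p q ->.
  rewrite !mulr_sumr -big_split/=; apply: eq_bigr => k _.
  by rewrite !mxE; ring.
apply: etrans (E _ i) _; rewrite h1 (eq_bigr _ (fun j _ => h2 j)) big_split/= -!mulr_sumr.
rewrite (E u i) (E w i); move: (\sum_k _ * u x k 0) (\sum_k _ * w x k 0) => p q.
by move: (\sum_j _) (\sum_j _) => p' q'; ring.
Qed.

Lemma partial_modes_at j kappa (s : seq mode) t x : Omega x ->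
  partial j (modes_at kappa s t) x = \sum_(mu <- s) partial j (mode_at kappa t mu) x.
Proof.
move=> Ox; elim: s => [|mu s IH].
  rewrite big_nil (_ : modes_at _ _ _ = cst 0); first exact: derive_cst.
  by apply/funext => y; rewrite /modes_at big_nil.
rewrite big_cons -IH (_ : modes_at kappa (mu :: s) t =
  lin2 1 (mode_at kappa t mu) 1 (modes_at kappa s t)); last first.
  by apply/funext => y; rewrite /modes_at big_cons /lin2 !scale1r.
rewrite partial_lin2 ?scale1r//.
  exact: (good_smooth Omega_open rho0_gt0 (good_mode_at Omega_open Omega_nonempty _ _ _)).
exact: (good_smooth Omega_open rho0_gt0 (good_modes_at Omega_open Omega_nonempty _ _ _)).
Qed.

Lemma linearized_modes_at kappa (s : seq mode) t x i : Omega x ->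
  Lin (modes_at kappa s t) x i 0 = \sum_(mu <- s) Lin (mode_at kappa t mu) x i 0.
Proof.
move=> Ox; elim: s => [|mu s IH].
  have s0 : smooth_on Omega (fun=> 0 : 'cV[R]_m).
    exact: (good_smooth Omega_open rho0_gt0 (good0 Omega_nonempty (rho0 := rho0))).
  rewrite big_nil (_ : modes_at _ _ _ = lin2 0 (fun=> 0) 0 (fun=> 0)).
    apply: etrans (linearized_lin2 0 0 i s0 s0 Ox) _.
    exact: etrans (congr2 +%R (mul0r _) (mul0r _)) (addr0 _).
  by apply/funext => y; rewrite /modes_at big_nil /lin2 !scale0r addr0.
rewrite big_cons -IH (_ : modes_at kappa (mu :: s) t =
  lin2 1 (mode_at kappa t mu) 1 (modes_at kappa s t)); last first.
  by apply/funext => y; rewrite /modes_at big_cons /lin2 !scale1r.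
have g1 := good_smooth Omega_open rho0_gt0
  (good_mode_at Omega_open Omega_nonempty kappa t mu).
have g2 := good_smooth Omega_open rho0_gt0
  (good_modes_at Omega_open Omega_nonempty kappa s t).
exact: etrans (linearized_lin2 1 1 i g1 g2 Ox) (congr2 +%R (mul1r _) (mul1r _)).
Qed.

Lemma mode_at_osc kappa t (mu : mode) x i : mode_at kappa t mu x i 0 =
  osc kappa (freq mu) (mre mu x i 0) (mim mu x i 0) t.
Proof. by rewrite /mode_at /lin2 !mxE. Qed.

Lemma modes_at_osc kappa (s : seq mode) t x i : modes_at kappa s t x i 0 =
  \sum_(mu <- s) osc kappa (freq mu) (mre mu x i 0) (mim mu x i 0) t.
Proof. by rewrite /modes_at summxE; apply: eq_bigr => mu _; exact: mode_at_osc. Qed.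

Lemma partial_modes_at_osc j kappa (s : seq mode) t x i : Omega x ->
  partial j (coord (modes_at kappa s t) i) x =
  \sum_(mu <- s) osc kappa (freq mu) (partial j (coord (mre mu) i) x)
                                    (partial j (coord (mim mu) i) x) t.
Proof.
move=> Ox; have rh := good_half rho0_gt0.
rewrite -(partial_coord Omega_open j i
  (good_modes_at Omega_open Omega_nonempty kappa s t rh) Ox).
rewrite partial_modes_at// summxE; apply: eq_bigr => mu _.
have gp := mre_good mu; have gq := mim_good mu.
have Ep := partial_lin2 j (expR (kappa * t) * cos (freq mu * t))
  (- (expR (kappa * t) * sin (freq mu * t)))
  (good_smooth Omega_open rho0_gt0 gp) (good_smooth Omega_open rho0_gt0 gq) Ox.
rewrite -(partial_coord Omega_open j i (gp _ rh) Ox).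
rewrite -(partial_coord Omega_open j i (gq _ rh) Ox).
have Ei := congr1 (fun v : 'cV[R]_m => v i 0) Ep.
by apply: etrans Ei _; move: (partial j _ x) (partial j _ x) => p q; rewrite !mxE.
Qed.

(** The algebraic form of the equation dv/dt = L v + s, where v and s are the modes mu
    and sigma at growth rate kappa. *)
Definition mode_driven (kappa : R) (mu sigma : mode) : Prop :=
  freq mu = freq sigma /\
  mode_eq Omega A B u0 kappa (freq mu) (mre mu) (mim mu) (mre sigma) (mim sigma).

(** The time derivative of a sum of modes: each amplitude is multiplied by kappa + i w. *)
Definition dmodes kappa (s : seq mode) t x i : R :=
  \sum_(mu <- s) osc kappa (freq mu)
    (kappa * mre mu x i 0 - freq mu * mim mu x i 0)
    (freq mu * mre mu x i 0 + kappa * mim mu x i 0) t.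

Lemma is_derive_modes_at kappa (s : seq mode) (t : R) x i :
  is_derive t 1 (fun z => modes_at kappa s z x i 0) (dmodes kappa s t x i).
Proof.
have D (mu : mode) := is_derive_osc kappa (freq mu) (mre mu x i 0) (mim mu x i 0).
have := is_derive_bigsum s (fun mu => D mu t).
rewrite (_ : (fun z => modes_at kappa s z x i 0) =
  fun z => \sum_(mu <- s) osc kappa (freq mu) (mre mu x i 0) (mim mu x i 0) z)//.
by apply/funext => z; exact: modes_at_osc.
Qed.

Lemma dmodes_driven1 kappa (mu sigma : mode) t x i :
  mode_driven kappa mu sigma -> Omega x ->
  dmodes kappa [:: mu] t x i =
    Lin (mode_at kappa t mu) x i 0 + mode_at kappa t sigma x i 0.
Proof.
move=> [fr E] Ox; have [E1 E2] := E x i Ox.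
have El := linearized_lin2 (expR (kappa * t) * cos (freq mu * t))
  (- (expR (kappa * t) * sin (freq mu * t))) i
  (good_smooth Omega_open rho0_gt0 (mre_good mu))
  (good_smooth Omega_open rho0_gt0 (mim_good mu)) Ox.
rewrite /dmodes big_seq1 mode_at_osc -fr.
exact: etrans (osc_driven _ _ _ E1 E2) (congr1 (fun z => z + _) (esym El)).
Qed.

Lemma dmodes_driven kappa (f : mode -> mode) (s : seq mode) t x i :
  (forall sigma, mode_driven kappa (f sigma) sigma) -> Omega x ->
  dmodes kappa (map f s) t x i =
    Lin (modes_at kappa (map f s) t) x i 0 + modes_at kappa s t x i 0.
Proof.
move=> fd Ox; rewrite linearized_modes_at// /dmodes /modes_at summxE !big_map -big_split/=.
apply: eq_bigr => sigma _; have := dmodes_driven1 t i (fd sigma) Ox.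
by rewrite /dmodes big_seq1.
Qed.

Lemma dmodes_le kappa (s : seq mode) t x i W rho : 0 < rho < rho0 -> 0 <= kappa ->
  allProp (fun mu => `|freq mu| <= W) s -> Omega x ->
  `|dmodes kappa s t x i| <= expR (kappa * t) * (kappa + W) * modes_norm rho s.
Proof.
move=> rr k0 + Ox; have [r0 _] := andP rr.
elim: s => [|mu s IH] /=.
  by rewrite /dmodes /modes_norm !big_nil normr0 mulr0.
move=> [wW sW]; rewrite /dmodes /modes_norm !big_cons -/(dmodes _ _ _ _ _).
rewrite [leRHS]mulrDr; apply: le_trans (ler_normD _ _) _; apply: lerD; last exact: (IH sW).
apply: le_trans (osc_le _ _ _ _ _) _; rewrite -mulrA ler_wpM2l ?expR_ge0//.
have hp := abs_le_vnorm Omega_open Omega_nonempty i r0 (mre_good mu rr) Ox.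
have hq := abs_le_vnorm Omega_open Omega_nonempty i r0 (mim_good mu rr) Ox.
rewrite /mode_norm /cnorm; move: wW hp hq.
move: (freq mu) (mre mu x i 0) (mim mu x i 0) => w p q.
move: (vnorm Omega (mre mu) rho) (vnorm Omega (mim mu) rho) => np nq wW hp hq.
have W0 : 0 <= W by exact: le_trans wW.
have t1 := ler_normB (kappa * p) (w * q); have t2 := ler_normD (w * p) (kappa * q).
rewrite !normrM (ger0_norm k0) in t1 t2.
have a1 : kappa * `|p| <= kappa * np by exact: ler_wpM2l.
have a2 : kappa * `|q| <= kappa * nq by exact: ler_wpM2l.
have a3 : `|w| * `|p| <= W * np by exact: ler_pM.
have a4 : `|w| * `|q| <= W * nq by exact: ler_pM.
rewrite mulrDl !mulrDr; lra.
Qed.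

Section InfiniteSum.
Variables (v : nat -> 'cV[R]_d -> 'cV[R]_m) (M : nat -> R) (rho : R).
Hypothesis rho_gt0 : 0 < rho.
Hypothesis v_fin : forall n, finV Omega (v n) rho.
Hypothesis v_le : forall n, vnorm Omega (v n) rho <= M n.
Hypothesis M_cvg : cvgn (series M).

Lemma series_linearized x i : Omega x ->
  series (fun n => Lin (v n) x i 0) @ \oo --> Lin (vsum v) x i 0.
Proof.
move=> Ox; have [M0 E] := linearizedE u0 x A_analytic B_analytic.
have fV := (vsum_le Omega_open Omega_nonempty rho_gt0 v_fin v_le M_cvg).1.
have c1 : series (fun n => \sum_k M0 i k * v n x k 0) @ \oo -->
    \sum_k M0 i k * vsum v x k 0.
  apply: series_bigsum => k; rewrite mxE.
  exact: (@cvg_series_coord R d m Omega Omega_open Omega_nonempty v M rho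
    rho_gt0 v_fin v_le M_cvg k x Ox).
have c2 : series (fun n => \sum_(p : 'I_d * 'I_m)
      B p.1 (u0 x) i p.2 * partial p.1 (v n) x p.2 0) @ \oo -->
    \sum_(p : 'I_d * 'I_m) B p.1 (u0 x) i p.2 * partial p.1 (vsum v) x p.2 0.
  apply: series_bigsum => -[j k] /=.
  have [Es Cs] := partial_vsum Omega_open Omega_nonempty rho_gt0 v_fin v_le M_cvg j k Ox.
  rewrite (partial_coord Omega_open j k fV Ox) Es.
  rewrite (_ : (fun n => partial j (v n) x k 0) =
               (fun n => partial j (coord (v n) k) x)); first exact: Cs.
  by apply/funext => n; exact: (partial_coord Omega_open j k (v_fin n) Ox).
rewrite E pair_big/=.
rewrite (_ : series _ = fun N => series (fun n => \sum_k M0 i k * v n x k 0) N +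
  series (fun n => \sum_(p : 'I_d * 'I_m)
      B p.1 (u0 x) i p.2 * partial p.1 (v n) x p.2 0) N); first exact: cvgD.
apply/funext => N; rewrite /series/= -big_split/=; apply: eq_bigr => n _.
by rewrite E pair_big.
Qed.

End InfiniteSum.

End Dynamics.

(** * The solution as a series of modes *)

Section Solution.
Context {R : realType} {d m : nat}.
Variable Omega : set 'cV[R]_d.
Hypothesis Omega_open : open Omega.
Hypothesis Omega_nonempty : Omega !=set0.
Variable rho0 : R.
Hypothesis rho0_gt0 : 0 < rho0.
Variables (A : 'cV[R]_m -> 'cV[R]_m) (B : 'I_d -> 'cV[R]_m -> 'M[R]_m)
  (u0 : 'cV[R]_d -> 'cV[R]_m).
Hypothesis A_analytic : forall i, real_analytic (fun y => A y i 0).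
Hypothesis B_analytic : forall j i k, real_analytic (fun y => B j y i k).

Local Notation mode := (mode Omega rho0 (m := m)).
Local Notation Lin := (linearized A B u0).

Variables (Q : ('cV[R]_d -> 'cV[R]_m) -> ('cV[R]_d -> 'cV[R]_m) ->
       'cV[R]_d -> 'cV[R]_m) (K rho : R).
Hypothesis Q_bilinear : bilinear_on Omega Q.
Hypothesis Q_quadratic : forall v, smooth_on Omega v ->
     {in Omega, nonlinearity A B u0 v =1 Q v v}.
Hypothesis rho_in : 0 < rho < rho0.
Hypothesis K_ge0 : 0 <= K.
Hypothesis Q_le : forall u w x i, finV Omega u rho -> finV Omega w rho -> Omega x ->
  `|Q u w x i 0| <= K * vnorm Omega u rho * vnorm Omega w rho.

Variables (kappa : nat -> R) (level : nat -> seq mode) (M : nat -> R).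
Local Notation v n t := (modes_at (kappa n) (level n) t).

Hypothesis M_cvg : cvgn (series M).
Hypothesis v_le : forall n t, t < 1 -> vnorm Omega (v n t) rho <= M n.
Hypothesis dv_le : forall n t x i, t < 1 -> Omega x ->
  `|dmodes (kappa n) (level n) t x i| <= M n.
Hypothesis dvE : forall n t x i, Omega x -> dmodes (kappa n) (level n) t x i =
  Lin (v n t) x i 0 + \sum_(k < n.+1) Q (v k t) (v (n - k)%N t) x i 0.

Hypothesis u0_smooth : smooth_on Omega u0.
Hypothesis u0_coord : forall i, smooth_on Omega (coord u0 i).

Definition perturbation (t : R) : 'cV[R]_d -> 'cV[R]_m := vsum (fun n => v n t).

Let rho_gt0 : 0 < rho. Proof. by case/andP: rho_in. Qed.

Let v_fin n t : finV Omega (v n t) rho.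
Proof. exact: (good_modes_at Omega_open Omega_nonempty (kappa n) (level n) t rho_in). Qed.

Lemma perturbation_fin (t : R) : t < 1 -> finV Omega (perturbation t) rho.
Proof.
move=> t1; exact: (vsum_le Omega_open Omega_nonempty rho_gt0 (fun n => v_fin n t)
  (fun n => v_le n t1) M_cvg).1.
Qed.

(** Sum the equations dv_n/dt = L v_n + sum_(k + l = n) Q(v_k, v_l). The time
    derivative, L and Q all commute with the sum, because the terms and their time
    derivatives are dominated by M uniformly for t < 1. *)
Lemma is_derive_perturbation (t : R) x i : t < 1 -> Omega x ->
  is_derive t 1 (fun s => perturbation s x i 0)
    (Lin (perturbation t) x i 0 + Q (perturbation t) (perturbation t) x i 0).
Proof.
move=> t1 Ox.
have r0 : 0 < 1 - t by rewrite subr_gt0.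
have lt1 (s : R) : `|s| < 1 - t -> t + s *: 1 < 1.
  by rewrite [_ *: 1]mulr1 => sr; have := ler_norm s; lra.
pose f n (s : R) : R := modes_at (kappa n) (level n) s x i 0.
have Df n (s : R) : is_derive s 1 (f n) (dmodes (kappa n) (level n) s x i).
  exact: is_derive_modes_at.
have D : is_derive t 1 (fun s => ssum (f ^~ s)) (ssum (fun n => 'D_1 (f n) t)).
  apply: (@is_derive_ssum R R f M t 1 (1 - t) r0 M_cvg).
  - move=> n s /lt1 st; apply: le_trans (v_le n st).
    exact: (abs_le_vnorm Omega_open Omega_nonempty i rho_gt0 (v_fin n _) Ox).
  - move=> n s _; exact: (@ex_derive _ _ _ _ _ _ _ (Df n _)).
  - move=> n s /lt1 st; rewrite (@derive_val _ _ _ _ _ _ _ (Df n _)).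
    exact: dv_le.
have E : (fun s => perturbation s x i 0) = (fun s => ssum (f ^~ s)).
  by apply/funext => s; rewrite mxE.
rewrite E; apply: is_derive_eq D _.
have v_fint n := v_fin n t; have v_let n := v_le n t1.
(* Both sides of the equation of order n are summed over n. *)
have cL := series_linearized Omega_open Omega_nonempty A_analytic B_analytic
  (u0 := u0) (i := i) rho_gt0 v_fint v_let M_cvg Ox.
have cQ := Q_vsum_vsum (i := i) Omega_open Omega_nonempty rho_gt0 v_fint v_let M_cvg
  Q_bilinear K_ge0 Q_le Ox.
apply: (@cvg_lim R _ _ _ _ _ _ _) => //.
apply: cvg_trans (cvgD cL cQ).
rewrite (_ : series _ = series (fun n => Lin (v n t) x i 0) +
  series (fun n => \sum_(k < n.+1) Q (v k t) (v (n - k)%N t) x i 0)) //.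
apply/funext => N; rewrite /series/= fctE -big_split/=; apply: eq_bigr => n _.
by rewrite (@derive_val _ _ _ _ _ _ _ (Df n t)) dvE.
Qed.

Lemma partial_perturbation_le j i : exists C, forall n t x, t < 1 -> Omega x ->
  `|partial j (coord (v n t) i) x| <= C * M n.
Proof.
exists ((mi_fact (mi_of [:: j]))%:R / rho ^+ 1) => n t x t1 Ox.
apply: le_trans (partials_le Omega_open Omega_nonempty [:: j] rho_gt0
  (v_fin n t i) Ox) _.
rewrite ler_wpM2l ?divr_ge0 ?exprn_ge0 ?(ltW rho_gt0)//.
apply: le_trans (v_le n t1); rewrite /vnorm (bigD1 i)//= lerDl sumr_ge0// => k _.
exact: (gnorm_ge0 Omega_nonempty _ (ltW rho_gt0)).
Qed.

Variable T : R.

(** The perturbation lives on times below 1 and decays at minus infinity; the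
    shift by T places the small end at time 0. *)
Definition solution (s : R) : 'cV[R]_d -> 'cV[R]_m :=
  fun x => u0 x + perturbation (s - T) x.

Let near_domain (p : R * 'cV[R]_d) : p.1 - T < 1 -> Omega p.2 ->
  \forall q \near p, q.1 - T < 1 /\ Omega q.2.
Proof.
move=> p1 p2.
have n1 : \forall s \near p.1, s < 1 + T.
  by apply: (open_nbhs_nbhs (A := [set s | s < 1 + T])); split => /=;
    [exact: open_lt|rewrite -ltrBlDr].
have n2 : \forall y \near p.2, Omega y by exact: open_nbhs_nbhs.
exists ([set s | s < 1 + T], Omega) => //= q [/= q1 q2]; split => //.
by rewrite ltrBlDr.
Qed.

Let fst_cont (p : R * 'cV[R]_d) : {for p, continuous (fun q => q.1 - T)}.
Proof. by apply: cvgB; [exact: cvg_fst|exact: cvg_cst]. Qed.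

Let snd_cont (f : 'cV[R]_d -> R) (p : R * 'cV[R]_d) : {for p.2, continuous f} ->
  {for p, continuous (fun q => f q.2)}.
Proof.
move=> cf; have cs : {for p, continuous (@snd R 'cV[R]_d)} by exact: cvg_snd.
exact: (continuous_comp cs cf).
Qed.

Lemma solution_continuous (p : R * 'cV[R]_d) : p.1 - T < 1 -> Omega p.2 ->
  {for p, continuous (fun q => solution q.1 q.2)}.
Proof.
move=> p1 p2; apply: (@cvg_mx R _ (nbhs p) _) => i k; rewrite ord1.
have E q : solution q.1 q.2 i 0 = coord u0 i q.2 +
   ssum (fun n => v n (q.1 - T) q.2 i 0) by rewrite !mxE.
rewrite E; under eq_fun do rewrite E.
apply: cvgD; first exact: (snd_cont (u0_coord i [::] p2).1).
apply: (@cvg_dominated_series _ _ (nbhs p) _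
  (fun n q => v n (q.1 - T) q.2 i 0) (fun n => v n (p.1 - T) p.2 i 0) M) => //.
  apply: filterS (near_domain p1 p2) => q [q1 q2] n.
  apply: le_trans (v_le n q1).
  exact: (abs_le_vnorm Omega_open Omega_nonempty i rho_gt0 (v_fin n _) q2).
move=> n; under eq_fun do rewrite modes_at_osc.
rewrite modes_at_osc; apply: (@cvg_bigsum R _ (nbhs p)) => mu.
have rh := good_half rho0_gt0.
have cp := snd_cont (finG_smooth (mre_good mu rh i) [::] p2).1.
have cq := snd_cont (finG_smooth (mim_good mu rh i) [::] p2).1.
exact: (@continuous_osc_coef R _ (kappa n) (freq mu) _ _ _ p (@fst_cont p) cp cq).
Qed.

Lemma solution_partial (s : R) j x : s - T < 1 -> Omega x ->
  derivable (solution s) x (basis_vec j) /\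
  partial j (solution s) x = partial j u0 x + partial j (perturbation (s - T)) x.
Proof.
move=> s1 Ox; have sp := finV_smooth Omega_open (perturbation_fin s1).
have D := is_deriveD (derivableP ((u0_smooth [::] Ox).2 j))
                     (derivableP ((sp [::] x Ox).2 j)).
by split; [exact: (@ex_derive _ _ _ _ _ _ _ D)|exact: (@derive_val _ _ _ _ _ _ _ D)].
Qed.

Lemma solution_partial_continuous j (p : R * 'cV[R]_d) : p.1 - T < 1 -> Omega p.2 ->
  {for p, continuous (fun q => partial j (solution q.1) q.2)}.
Proof.
move=> p1 p2; apply: (@cvg_mx R _ (nbhs p) _) => i k; rewrite ord1.
have u0E x : Omega x -> partial j u0 x i 0 = partial j (coord u0 i) x.
  by move=> Ox; rewrite -[partial j u0 x]/(partials [:: j] u0 x)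
    (partials_coord Omega_open [:: j] u0_coord Ox) mxE.
pose H (q : R * 'cV[R]_d) := partial j (coord u0 i) q.2 +
   ssum (fun n => partial j (coord (v n (q.1 - T)) i) q.2).
have E q : q.1 - T < 1 -> Omega q.2 -> H q = partial j (solution q.1) q.2 i 0.
  move=> q1 q2; rewrite (solution_partial j q1 q2).2 mxE u0E// /H; congr (_ + _).
  rewrite (partial_coord Omega_open j i (perturbation_fin q1) q2).
  exact: (esym (partial_vsum Omega_open Omega_nonempty rho_gt0
    (fun n => v_fin n (q.1 - T)) (fun n => v_le n q1) M_cvg j i q2).1).
rewrite -[X in _ --> X](E p p1 p2).
suff cH : H q @[q --> p] --> H p.
  apply: cvg_trans cH; apply: near_eq_cvg.
  by apply: filterS (near_domain p1 p2) => q [q1 q2]; exact: E.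
apply: cvgD; first exact: (snd_cont (u0_coord i [:: j] p2).1).
have [C HC] := partial_perturbation_le j i.
apply: (@cvg_dominated_series _ _ (nbhs p) _
  (fun n q => partial j (coord (v n (q.1 - T)) i) q.2)
  (fun n => partial j (coord (v n (p.1 - T)) i) p.2) (fun n => C * M n)).
- by apply: filterS (near_domain p1 p2) => q [q1 q2] n; exact: HC.
- move=> n; rewrite [X in _ --> X](partial_modes_at_osc Omega_open Omega_nonempty
    rho0_gt0 j _ _ _ i p2).
  pose H' (q : R * 'cV[R]_d) := \sum_(mu <- level n) osc (kappa n) (freq mu)
    (partial j (coord (mre mu) i) q.2) (partial j (coord (mim mu) i) q.2) (q.1 - T).
  suff cH' : H' q @[q --> p] --> H' p.
    apply: cvg_trans cH'; apply: near_eq_cvg.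
    apply: filterS (near_domain p1 p2) => q [q1 q2].
    exact: (esym (partial_modes_at_osc Omega_open Omega_nonempty rho0_gt0 j _ _ _ i q2)).
  have rh := good_half rho0_gt0.
  apply: (@cvg_bigsum R _ (nbhs p)) => mu.
  have cp := snd_cont (finG_smooth (mre_good mu rh i) [:: j] p2).1.
  have cq := snd_cont (finG_smooth (mim_good mu rh i) [:: j] p2).1.
  exact: (@continuous_osc_coef R _ (kappa n) (freq mu) _ _ _ p (@fst_cont p) cp cq).
- exact: (is_cvg_seriesZ (k := C) M_cvg).
Qed.

Lemma solution_is_solution : is_solution A B Omega T solution.
Proof.
have lt1 s : 0 <= s <= T -> s - T < 1 by move=> /andP[_ sT]; lra.
split.
- by move=> s x /lt1 s1 Ox j; exact: (solution_partial j s1 Ox).1.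
- apply: continuous_in_subspaceT => p; rewrite inE => -[/= p1 p2].
  by apply: solution_continuous => //; apply: lt1; move: p1; rewrite in_itv.
- move=> j; apply: continuous_in_subspaceT => p; rewrite inE => -[/= p1 p2].
  by apply: solution_partial_continuous => //; apply: lt1; move: p1; rewrite in_itv.
- move=> s x /lt1 s1 Ox.
  have sp := finV_smooth Omega_open (perturbation_fin s1).
  have memx : x \in Omega by rewrite inE.
  have NE := Q_quadratic sp memx.
  have LE : Lcal A B (solution s) x =
      Lin (perturbation (s - T)) x + Q (perturbation (s - T)) (perturbation (s - T)) x.
    by rewrite -NE /nonlinearity addrC subrK.
  rewrite LE; apply: is_derive_mx => i k; rewrite ord1 [X in is_derive _ _ _ X]mxE.
  have D := is_derive_perturbation i s1 Ox.
  have D' := is_derive_translate (f := fun t => perturbation t x i 0)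
    (@ex_derive _ _ _ _ _ _ _ D).
  rewrite (@derive_val _ _ _ _ _ _ _ D) in D'.
  have D2 := is_deriveD (is_derive_cst (u0 x i 0) s 1) D'.
  rewrite add0r in D2.
  rewrite (_ : (fun y => solution y x i 0) =
    cst (u0 x i 0) + (fun y => perturbation (y - T) x i 0)); first exact: D2.
  by apply/funext => y; rewrite /solution mxE.
Qed.

End Solution.

(** * The cascade of forced modes *)

Section Cascade.
Context {R : realType} {d m : nat}.
Variable Omega : set 'cV[R]_d.
Hypothesis Omega_open : open Omega.
Hypothesis Omega_nonempty : Omega !=set0.
Variable rho0 : R.
Hypothesis rho0_gt0 : 0 < rho0.
Variables (A : 'cV[R]_m -> 'cV[R]_m) (B : 'I_d -> 'cV[R]_m -> 'M[R]_m)
  (u0 : 'cV[R]_d -> 'cV[R]_m).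
Hypothesis A_analytic : forall i, real_analytic (fun y => A y i 0).
Hypothesis B_analytic : forall j i k, real_analytic (fun y => B j y i k).

Local Notation mode := (mode Omega rho0 (m := m)).
Local Notation Lin := (linearized A B u0).

Variables (Q : ('cV[R]_d -> 'cV[R]_m) -> ('cV[R]_d -> 'cV[R]_m) ->
       'cV[R]_d -> 'cV[R]_m) (CQ : R).
Hypothesis Q_bilinear : bilinear_on Omega Q.
Hypothesis CQ_ge0 : 0 <= CQ.
Hypothesis Q_good : forall u w rho, good Omega rho0 u -> good Omega rho0 w ->
  0 < rho < rho0 ->
  finV Omega (Q u w) rho /\
  vnorm Omega (Q u w) rho <= CQ * vnorm Omega u rho * grad_norm Omega w rho.

Local Notation prods := (mode_products Omega_open Omega_nonempty Q_good).

Lemma mode_products_nil s : prods s [::] = [::].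
Proof. by rewrite /mode_products; elim: s. Qed.

Lemma freq_mode_products W1 W2 s1 s2 :
  allProp (fun mu : mode => `|freq mu| <= W1) s1 ->
  allProp (fun mu : mode => `|freq mu| <= W2) s2 ->
  allProp (fun mu : mode => `|freq mu| <= W1 + W2) (prods s1 s2).
Proof.
move=> h1 h2; rewrite /mode_products.
elim: s1 h1 => [//|mu s1 IH] /= [m1 h1]; apply: allProp_cat; last exact: IH.
elim: s2 h2 {IH} => [//|nu s2 IH] /= [n2 h2]; split.
  by apply: le_trans (ler_normD _ _) _; exact: lerD.
split; last exact: IH.
by apply: le_trans (ler_normB _ _) _; exact: lerD.
Qed.

Variables (r C0 a W : R) (mu1 : mode).
Hypothesis r_gt0 : 0 < r.
Hypothesis C0_ge0 : 0 <= C0.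
Hypothesis solve : forall n (sigma : mode), (2 <= n)%N -> exists mu : mode,
  [/\ freq mu = freq sigma,
      mode_eq Omega A B u0 (n%:R * r) (freq mu) (mre mu) (mim mu)
        (mre sigma) (mim sigma) &
      forall rho, 0 < rho < rho0 ->
        mode_norm rho mu <= 2 * (C0 / (n%:R * r)) * mode_norm rho sigma].

(** The source of a solution of the homogeneous linearized equation. *)
Definition zero_mode (w : R) : mode :=
  Mode w (good0 Omega_nonempty (rho0 := rho0)) (good0 Omega_nonempty (rho0 := rho0)).

Hypothesis mu1_driven : mode_driven A B u0 r mu1 (zero_mode (freq mu1)).
Hypothesis mu1_freq : `|freq mu1| <= W.
Hypothesis mu1_norm : forall rho, 0 < rho < rho0 -> mode_norm rho mu1 <= a.

Lemma modes_at_flatten (I : Type) (l : seq I) (F : I -> seq mode) kappa t x :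
  modes_at kappa (flatten [seq F k | k <- l]) t x = \sum_(k <- l) modes_at kappa (F k) t x.
Proof. by rewrite /modes_at big_flatten big_map. Qed.

Lemma zero_mode_at kappa w t x : mode_at kappa t (zero_mode w) x = 0.
Proof. by rewrite /mode_at /lin2 /= !scaler0 addr0. Qed.

(** The expansion sum_n v_n of a solution whose leading term is the mode mu1. The
    products of the earlier levels form the source at order n, and each mode of this
    source is solved for separately. The frequencies add up along products, and the
    norms obey the majorant recursion. *)
Lemma cascade : exists level : nat -> seq mode,
  [/\ level 0%N = [::], level 1%N = [:: mu1],
      forall n t x i, Omega x -> dmodes (n%:R * r) (level n) t x i =
        Lin (modes_at (n%:R * r) (level n) t) x i 0 +
        \sum_(k < n.+1) Q (modes_at (k%:R * r) (level k) t)
                          (modes_at ((n - k)%:R * r) (level (n - k)%N) t) x i 0,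
      forall n, allProp (fun mu => `|freq mu| <= n%:R * W) (level n) &
      forall p rho, 0 < rho < rho0 -> modes_norm rho (level p.+1) <=
        a * (16 * (2 * C0 * CQ / r) * d%:R * expR 1 * a / (rho0 - rho)) ^+ p *
        (p.+1%:R ^+ 2)^-1].
Proof.
have solve' (ns : nat * mode) : exists mu : mode, (2 <= ns.1)%N ->
    [/\ freq mu = freq ns.2,
      mode_eq Omega A B u0 (ns.1%:R * r) (freq mu) (mre mu) (mim mu)
        (mre ns.2) (mim ns.2) &
      forall rho, 0 < rho < rho0 ->
        mode_norm rho mu <= 2 * (C0 / (ns.1%:R * r)) * mode_norm rho ns.2].
  case: ns => n sigma /=; have [n2|_] := boolP (2 <= n)%N.
    by have [mu mP] := solve sigma n2; exists mu.
  by exists mu1.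
have [sol0 sol0P] := choice solve'.
pose sol n sigma := if n == 1%N then mu1 else sol0 (n, sigma).
have [level [l0 l1 lS]] := exists_levels prods sol (zero_mode (freq mu1)).
rewrite /sol eqxx in l1.
have {}lS p : level p.+2 = map (fun sigma => sol0 (p.+2, sigma))
    (flatten [seq prods (level k) (level (p.+2 - k)%N) | k <- index_iota 1 p.+2]).
  by rewrite lS.
exists level; split => //.
- move=> n t x i Ox.
  have Qkl k l : Q (modes_at (k%:R * r) (level k) t) (modes_at (l%:R * r) (level l) t) x i 0
      = modes_at ((k + l)%:R * r) (prods (level k) (level l)) t x i 0.
    by rewrite (Q_modes_at Omega_open Omega_nonempty rho0_gt0 Q_bilinear Q_good)//
       natrD mulrDl.
  have Q0l l : Q (modes_at (0%:R * r) (level 0%N) t)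
      (modes_at (l%:R * r) (level l) t) x i 0 = 0.
    by rewrite Qkl l0 /modes_at /mode_products /= big_nil mxE.
  have Qk0 k : Q (modes_at (k%:R * r) (level k) t)
      (modes_at (0%:R * r) (level 0%N) t) x i 0 = 0.
    by rewrite Qkl l0 mode_products_nil /modes_at big_nil mxE.
  case: n => [|[|p]].
  + rewrite big_ord1 Q0l addr0 l0 /dmodes big_nil.
    by rewrite (linearized_modes_at Omega_open Omega_nonempty rho0_gt0
      u0 A_analytic B_analytic)// big_nil.
  + rewrite big_ord_recl big_ord1 Q0l add0r [(1 - _)%N]/= Qk0 addr0 l1.
    have := @dmodes_driven1 R d m Omega Omega_open rho0 rho0_gt0 A B u0 A_analytic
      B_analytic r mu1 (zero_mode (freq mu1)) t x i mu1_driven Ox.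
    have z0 : mode_at r t (zero_mode (freq mu1)) x i 0 = 0 by rewrite zero_mode_at mxE.
    rewrite z0 addr0 mul1r => ->.
    by rewrite (linearized_modes_at Omega_open Omega_nonempty rho0_gt0
      u0 A_analytic B_analytic)// big_seq1.
  + have driven sigma : mode_driven A B u0 (p.+2%:R * r) (sol0 (p.+2, sigma)) sigma.
      by have [] := sol0P (p.+2, sigma) isT.
    have := @dmodes_driven R d m Omega Omega_open Omega_nonempty rho0 rho0_gt0 A B u0
      A_analytic B_analytic (p.+2%:R * r) (fun sigma => sol0 (p.+2, sigma))
      (flatten [seq prods (level k) (level (p.+2 - k)%N) | k <- index_iota 1 p.+2])
      t x i driven Ox.
    rewrite -lS => ->; congr (_ + _); rewrite modes_at_flatten summxE.
    rewrite -(big_mkord xpredT (fun k => Q (modes_at (k%:R * r) (level k) t)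
      (modes_at ((p.+2 - k)%:R * r) (level (p.+2 - k)%N) t) x i 0)).
    rewrite [RHS]big_ltn// subn0 Q0l add0r [RHS]big_nat_recr// [RHS]/= subnn Qk0 addr0.
    apply: eq_big_nat => k /andP[_ kp].
    by rewrite Qkl subnKC// ltnW.
- elim/ltn_ind => -[|[|p]] IH; first by rewrite l0.
    by rewrite l1 mul1r /=.
  rewrite lS; apply: (@allProp_map _ _ (fun mu : mode => `|freq mu| <= p.+2%:R * W)).
    by move=> sigma; have [-> _ _] := sol0P (p.+2, sigma) isT.
  apply: allProp_flatten => k; rewrite mem_index_iota => /andP[k1 kp].
  have -> : p.+2%:R * W = k%:R * W + (p.+2 - k)%:R * W.
    by rewrite -mulrDl -natrD subnKC// ltnW.
  apply: freq_mode_products; apply: IH => //.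
  by rewrite ltn_subrL k1.
(* The hypotheses of the majorant recursion: solving at order n costs 2 C0 / (n r),
   the product costs CQ and one derivative. *)
- apply: (@majorant R (fun n rho => modes_norm rho (level n))
    (fun n rho => modes_grad_norm rho (level n)) a (2 * C0 * CQ / r) d%:R rho0).
  + have rh := good_half rho0_gt0; apply: le_trans (mu1_norm rh).
    by apply: mode_norm_ge0 => //; case/andP: rh => /ltW.
  + by rewrite divr_ge0 ?mulr_ge0// ltW.
  + by rewrite ler0n.
  + by move=> n rho /andP[/ltW r0 _]; exact: modes_norm_ge0.
  + by move=> n rho /andP[/ltW r0 _]; exact: modes_grad_norm_ge0.
  + by move=> rho rr; rewrite l1 /modes_norm big_seq1; exact: mu1_norm.
  + move=> p rho rr; have [r0 _] := andP rr; rewrite lS /modes_norm big_map.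
    apply: (@le_trans _ _ (\sum_(sigma <- flatten [seq prods (level k)
        (level (p.+2 - k)%N) | k <- index_iota 1 p.+2])
        2 * (C0 / (p.+2%:R * r)) * mode_norm rho sigma)).
      by apply: ler_sum => sigma _; have [_ _] := sol0P (p.+2, sigma) isT; apply.
    rewrite -mulr_sumr.
    have -> : 2 * C0 * CQ / r / p.+2%:R = 2 * (C0 / (p.+2%:R * r)) * CQ.
      by field; rewrite !gt_eqF// ltr0n.
    rewrite -[leRHS]mulrA; apply: ler_wpM2l.
      by rewrite mulr_ge0// divr_ge0// mulr_ge0 ?ler0n// ltW.
    rewrite big_flatten big_map big_add1 /= big_mkord mulr_sumr.
    apply: ler_sum => j _; have jp : (j <= p)%N by rewrite -ltnS.
    rewrite subSS subSn// mulrA.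
    exact: (mode_products_norm Omega_open Omega_nonempty Q_good (level j.+1)
      (level (p - j).+1) rr).
  + move=> n rho rho' rr rr0.
    exact: (modes_grad_norm_le Omega_open Omega_nonempty _ rr rr0).
Qed.

End Cascade.

(** * Pointwise and norm bounds on the quadratic term *)

Section QBounds.
Context {R : realType} {d m : nat}.
Variable Omega : set 'cV[R]_d.
Hypothesis Omega_open : open Omega.
Hypothesis Omega_nonempty : Omega !=set0.
Variable rho0 : R.
Hypothesis rho0_gt0 : 0 < rho0.
Variables (Q : ('cV[R]_d -> 'cV[R]_m) -> ('cV[R]_d -> 'cV[R]_m) ->
       'cV[R]_d -> 'cV[R]_m) (CQ : R).
Hypothesis Q_bound : forall (u v : 'cV[R]_d -> 'cV[R]_m) (rho : R),
     0 <= rho <= rho0 -> smooth_on Omega u -> smooth_on Omega v ->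
     (Gvec Omega u rho < +oo)%E -> (Ggrad Omega v rho < +oo)%E ->
     (Gvec Omega (Q u v) rho
      <= CQ%:E * Gvec Omega u rho * Ggrad Omega v rho)%E.

(** The finiteness of the gradient at rho needs some room, which the larger
    radius rho' provides. *)
Lemma Q_gen u w rho rho' : 0 < rho < rho' -> rho' < rho0 ->
  finV Omega u rho' -> finV Omega w rho' ->
  finV Omega (Q u w) rho /\
  vnorm Omega (Q u w) rho <= `|CQ| * vnorm Omega u rho * grad_norm Omega w rho.
Proof.
move=> /andP[r0 rr] r1 fu fw; have r'0 := lt_trans r0 rr.
have rle : 0 <= rho <= rho' by rewrite !ltW.
have rlt : 0 <= rho < rho' by rewrite rr ltW.
have [fu' _] := vnorm_mono Omega_nonempty rle r'0 fu.
have EG := GvecE Omega_nonempty (ltW r0) fu'.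
have [Ed _] := Ggrad_le Omega_open Omega_nonempty rlt fw.
have rle0 : 0 <= rho <= rho0 by rewrite !ltW// (lt_trans rr).
have := Q_bound rle0 (finV_smooth Omega_open fu) (finV_smooth Omega_open fw).
rewrite EG Ed !ltry => /(_ isT isT); rewrite -!EFinM => QB.
have [f n] := Gvec_le Omega_nonempty (ltW r0) QB.
split => //; apply: le_trans n _; rewrite -!mulrA ler_wpM2r ?ler_norm//.
by rewrite mulr_ge0 ?vnorm_ge0 ?grad_norm_ge0// ltW.
Qed.

Lemma Q_good_bound u w rho : good Omega rho0 u -> good Omega rho0 w -> 0 < rho < rho0 ->
  finV Omega (Q u w) rho /\
  vnorm Omega (Q u w) rho <= `|CQ| * vnorm Omega u rho * grad_norm Omega w rho.
Proof.
move=> gu gw /andP[r0 rr]; pose rho' := (rho + rho0) / 2.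
have r1 : rho < rho' by rewrite /rho' ltr_pdivlMr//; lra.
have r2 : rho' < rho0 by rewrite /rho' ltr_pdivrMr//; lra.
have rr' : 0 < rho' < rho0 by rewrite r2 (lt_trans r0).
by apply: (Q_gen (rho' := rho')); rewrite ?r0//; [exact: gu|exact: gw].
Qed.

(** At half of the radius the gradient is bounded by the norm at rho; this
    is the continuity of Q under which it may be applied to a convergent series. *)
Lemma Q_pointwise rho : 0 < rho < rho0 -> exists2 K : R, 0 <= K &
  forall u w x i, finV Omega u rho -> finV Omega w rho -> Omega x ->
  `|Q u w x i 0| <= K * vnorm Omega u rho * vnorm Omega w rho.
Proof.
move=> /andP[r0 rr]; pose rho' := rho / 2.
have r1 : 0 < rho' by rewrite divr_gt0.
have r2 : rho' < rho by rewrite /rho' ltr_pdivrMr//; lra.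
have c0 : 0 <= d%:R / (rho - rho') by rewrite divr_ge0// subr_ge0 ltW.
exists (`|CQ| * (d%:R / (rho - rho'))); first by rewrite mulr_ge0.
move=> u w x i fu fw Ox.
have r12 : 0 < rho' < rho by rewrite r1.
have [fQ nQ] := Q_gen r12 rr fu fw.
apply: le_trans (abs_le_vnorm Omega_open Omega_nonempty i r1 fQ Ox) _.
apply: le_trans nQ _.
have rle : 0 <= rho' <= rho by rewrite !ltW.
have rlt : 0 <= rho' < rho by rewrite r2 ltW.
have [_ nu] := vnorm_mono Omega_nonempty rle r0 fu.
have [_ nw] := Ggrad_le Omega_open Omega_nonempty rlt fw.
have -> : `|CQ| * (d%:R / (rho - rho')) * vnorm Omega u rho * vnorm Omega w rho =
  `|CQ| * vnorm Omega u rho * (d%:R / (rho - rho') * vnorm Omega w rho) by ring.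
apply: ler_pM => //; rewrite ?mulr_ge0 ?vnorm_ge0 ?grad_norm_ge0 ?(ltW r1)//.
by rewrite ler_wpM2l.
Qed.

End QBounds.

(** * The leading mode and the constants of the construction *)

Lemma ssum_half {R : realType} (c : R) :
  cvgn (series (fun n => c * 2^-1 ^+ n)) /\ ssum (fun n => c * 2^-1 ^+ n) = 2 * c.
Proof.
have h : `|2^-1 : R| < 1 by rewrite ger0_norm// invf_lt1// ltr1n.
have := cvg_geometric_series (a := c) h; rewrite /geometric => cv.
have -> : 2 * c = c / (1 - 2^-1) by field.
by split; [apply/cvg_ex; eexists; exact: cv|exact: cvg_lim cv].
Qed.

(** Constants of the construction: the amplitude eps is small enough for the
    series to converge up to time 1, and for its terms of order at least two to
    be dominated by half the leading one at time 0. *)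
Lemma amplitude {R : realType} (a0 c k0 E : R) : 0 < a0 -> 0 < c -> 0 <= k0 -> 1 <= E ->
  exists2 eps : R, 0 < eps &
    E * (k0 * (eps * a0)) <= 2^-1 /\ 2 * (eps * a0 * (k0 * (eps * a0))) <= eps * c / 2.
Proof.
move=> a00 c0 k00 E1; have E0 : 0 < E by lra.
pose h := k0 * a0 + 1; have ka : 0 <= k0 * a0 by rewrite mulr_ge0// ltW.
have h0 : 0 < h by rewrite /h; lra.
pose eps := Num.min (2 * E * h)^-1 (c / (4 * a0 * h)).
have p1 : 0 < 2 * E * h by rewrite !mulr_gt0.
have p2 : 0 < 4 * a0 * h by rewrite !mulr_gt0.
have e0 : 0 < eps by rewrite lt_min invr_gt0 p1 divr_gt0.
have e1 : eps * (2 * E * h) <= 1.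
  by rewrite -ler_pdivlMr// div1r /eps ge_min lexx.
have e2 : eps * (4 * a0 * h) <= c by rewrite -ler_pdivlMr// /eps ge_min lexx orbT.
exists eps => //; split.
  have -> : E * (k0 * (eps * a0)) = eps * E * (k0 * a0) by ring.
  have : eps * E * (k0 * a0) <= eps * E * h.
    by rewrite ler_wpM2l ?mulr_ge0 ?ltW// /h; lra.
  have E2 : eps * (2 * E * h) = 2 * (eps * E * h) by ring.
  by rewrite E2 in e1; lra.
have -> : 2 * (eps * a0 * (k0 * (eps * a0))) = eps * (eps * (2 * a0 * (k0 * a0))) by ring.
rewrite -[leRHS]mulrA ler_wpM2l ?(ltW e0)//.
have : eps * (2 * a0 * (k0 * a0)) <= eps * (2 * a0 * h).
  by rewrite !ler_wpM2l ?mulr_ge0 ?ltW// /h; lra.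
have E2 : eps * (4 * a0 * h) = 2 * (eps * (2 * a0 * h)) by ring.
by rewrite E2 in e2; lra.
Qed.

(** Domination of the term of order n = p + 1, and of its time derivative, on
    t < 1 by a geometric sequence. The time derivative costs a factor n, which is paid
    for by the factor 1/n^2 of the majorant. *)
Lemma level_bounds {R : realType} (a q r W t g : R) p :
  0 <= a -> 0 <= q -> expR r * q <= 2^-1 -> 0 < r -> 0 <= W -> t < 1 -> 0 <= g ->
  g <= a * q ^+ p * (p.+1%:R ^+ 2)^-1 ->
  let C := 2 * (1 + r + W) * (a * expR r) * 2^-1 ^+ p.+1 in
  expR (p.+1%:R * r * t) * g <= C /\
  expR (p.+1%:R * r * t) * (p.+1%:R * r + p.+1%:R * W) * g <= C.
Proof.
move=> a0 q0 Eq r0 W0 t1 g0 gle /=; set n : R := p.+1%:R.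
have n1 : 1 <= n by rewrite ler1n.
have n0 : 0 < n by lra.
have E0 : 0 < expR r by exact: expR_gt0.
have e0 : 0 < expR (n * r * t) by exact: expR_gt0.
have eE : expR (n * r * t) <= expR r ^+ p.+1.
  rewrite -expRM_natl ler_expR -/n; have : 0 < n * r by rewrite mulr_gt0.
  by move: (n * r) => x x0; nra.
have h0 : 0 <= 2^-1 ^+ p :> R by rewrite exprn_ge0.
have key : expR (n * r * t) * (n * g) <= a * expR r * 2^-1 ^+ p.
  have ng : n * g <= a * q ^+ p.
    apply: le_trans (ler_wpM2l (ltW n0) gle) _.
    have -> : n * (a * q ^+ p * (n ^+ 2)^-1) = a * q ^+ p * n^-1.
      by field; rewrite gt_eqF.
    by rewrite ler_piMr ?mulr_ge0 ?exprn_ge0// invf_le1.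
  apply: (@le_trans _ _ (expR r ^+ p.+1 * (a * q ^+ p))).
    by apply: ler_pM => //; rewrite ?(ltW e0) ?mulr_ge0 ?(ltW n0).
  have -> : expR r ^+ p.+1 * (a * q ^+ p) = a * expR r * (expR r * q) ^+ p.
    by rewrite exprS exprMn; ring.
  rewrite ler_wpM2l ?mulr_ge0 ?(ltW E0)//.
  by rewrite lerXn2r ?nnegrE ?mulr_ge0 ?(ltW E0).
have -> : 2 * (1 + r + W) * (a * expR r) * 2^-1 ^+ p.+1 =
    (1 + r + W) * (a * expR r * 2^-1 ^+ p) by rewrite exprS; field.
set S := a * expR r * _ in key *.
have S0 : 0 <= S by rewrite !mulr_ge0// ltW.
split.
  have : expR (n * r * t) * g <= expR (n * r * t) * (n * g).
    by rewrite ler_wpM2l ?(ltW e0)// ler_peMl.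
  have : 0 <= (r + W) * S by rewrite mulr_ge0// addr_ge0// ltW.
  lra.
have -> : expR (n * r * t) * (n * r + n * W) * g = (r + W) * (expR (n * r * t) * (n * g)).
  by ring.
have : (r + W) * (expR (n * r * t) * (n * g)) <= (r + W) * S.
  by rewrite ler_wpM2l// addr_ge0// ltW.
lra.
Qed.

Lemma lin2E {R : realType} {d m : nat} (a b : R) (u w : 'cV[R]_d -> 'cV[R]_m) x i :
  lin2 a u b w x i 0 = a * u x i 0 + b * w x i 0.
Proof. by rewrite /lin2 !mxE. Qed.

(** The equation (r + i w) z = l is invariant under multiplication of z by
    e (a + i b). *)
Lemma rotate_mode_eq {R : realType} (e a b r w p q l l' : R) :
  r * p - w * q = l -> w * p + r * q = l' ->
  r * (e * a * p + - (e * b) * q) - w * (e * b * p + e * a * q) =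
    e * a * l + - (e * b) * l' + 0 /\
  w * (e * a * p + - (e * b) * q) + r * (e * b * p + e * a * q) =
    e * b * l + e * a * l' + 0.
Proof. by move=> <- <-; split; ring. Qed.

Lemma rotate_norm_le {R : realType} (e a b p q P Q' : R) :
  0 < e -> 0 <= a -> 0 <= b -> a + b <= 1 -> 0 <= p <= P -> 0 <= q <= Q' ->
  e * a * p + e * b * q + (e * b * p + e * a * q) <= e * (P + Q' + 1).
Proof.
move=> e0 a0 b0 ab /andP[p0 pP] /andP[q0 qQ].
have -> : e * a * p + e * b * q + (e * b * p + e * a * q) = e * ((a + b) * (p + q)) by ring.
rewrite ler_wpM2l ?(ltW e0)//.
have : (a + b) * (p + q) <= p + q by rewrite ler_piMl// addr_ge0.
lra.
Qed.

Section Eigenmode.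
Context {R : realType} {d m : nat}.
Variable Omega : set 'cV[R]_d.
Hypothesis Omega_open : open Omega.
Hypothesis Omega_nonempty : Omega !=set0.
Variable rho0 : R.
Hypothesis rho0_gt0 : 0 < rho0.
Variables (A : 'cV[R]_m -> 'cV[R]_m) (B : 'I_d -> 'cV[R]_m -> 'M[R]_m)
  (u0 : 'cV[R]_d -> 'cV[R]_m).
Hypothesis A_analytic : forall i, real_analytic (fun y => A y i 0).
Hypothesis B_analytic : forall j i k, real_analytic (fun y => B j y i k).
Variables (X : function_space m Omega) (L : unbounded_operator X).
Hypothesis L_linearization : is_linearization A B u0 L.
Variables (lambda0 : R[i]) (U : X).
Hypothesis U_eigen : is_eigenvector L lambda0 U.
Hypothesis U_analytic : (GCvec Omega (fs_fun U) rho0 < +oo)%E.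

Local Notation w := (complex.Im lambda0).
Local Notation r := (complex.Re lambda0).
Local Notation p := (re_col (fs_fun U)).
Local Notation q := (im_col (fs_fun U)).

Lemma eigenvector_neq0 : exists x i, Omega x /\ (p x i 0 != 0 \/ q x i 0 != 0).
Proof.
have [_ U0 _] := U_eigen; apply: contrapT => nex; case/negP: U0; apply/eqP.
apply: fs_inj => x; rewrite inE => Ox; rewrite fs_fun0//.
apply/matrixP => i k; rewrite ord1 mxE.
have [p0|p0] := eqVneq (p x i 0) 0; last by case: nex; exists x, i; split; [|left].
have [q0|q0] := eqVneq (q x i 0) 0; last by case: nex; exists x, i; split; [|right].
by move: p0 q0; rewrite re_colE im_colE; case: (fs_fun U x i 0) => ? ? /= -> ->.
Qed.

(** The real part of the eigenvector may vanish; it does not once the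
    eigenvector is multiplied by 1 or by i. *)
Lemma eigenmode : exists a0 c : R, [/\ 0 < a0, 0 < c & forall eps : R, 0 < eps ->
  exists mu : mode Omega rho0 (m := m), [/\ freq mu = w,
    mode_driven A B u0 r mu (zero_mode Omega_nonempty rho0 w),
    forall rho, 0 < rho < rho0 -> mode_norm rho mu <= eps * a0 &
    exists x i, Omega x /\ eps * c <= `|mre mu x i 0|]].
Proof.
have [dU _ LU] := U_eigen; have rho0_ge0 := ltW rho0_gt0.
have GU : (GCvec Omega (fs_fun U) rho0 <= (fine (GCvec Omega (fs_fun U) rho0))%:E)%E.
  by rewrite fineK// ge0_fin_numE// GCvec_ge0.
have [fp fq _] := GCvec_re_im Omega_nonempty rho0_ge0 GU.
have mono (u : 'cV[R]_d -> 'cV[R]_m) (rho : R) : finV Omega u rho0 -> 0 < rho < rho0 ->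
    finV Omega u rho /\ vnorm Omega u rho <= vnorm Omega u rho0.
  move=> fu /andP[rp rr]; apply: (vnorm_mono Omega_nonempty _ rho0_gt0 fu).
  by rewrite !ltW.
have gp : good Omega rho0 p by move=> rho rr; exact: (mono _ _ fp rr).1.
have gq : good Omega rho0 q by move=> rho rr; exact: (mono _ _ fq rr).1.
have eqU x i : Omega x ->
    r * p x i 0 - w * q x i 0 = linearized A B u0 p x i 0 /\
    w * p x i 0 + r * q x i 0 = linearized A B u0 q x i 0.
  have E0 : (r +i* w)%C *: U - L U = 0 by rewrite LU; case: (lambda0) => ? ?; rewrite subrr.
  move=> Ox.
  have [H1 H2] := resolvent_mode_eq Omega_open L_linearization dU E0 fp fq i Ox.
  have z0 : fs_fun (0 : X) x i 0 = 0 by rewrite (fs_fun0 X Ox) mxE.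
  have zr : re_col (fs_fun (0 : X)) x i 0 = 0 by rewrite re_colE z0.
  have zi : im_col (fs_fun (0 : X)) x i 0 = 0 by rewrite im_colE z0.
  split; first exact: etrans H1 (etrans (congr1 (+%R _) zr) (addr0 _)).
  exact: etrans H2 (etrans (congr1 (+%R _) zi) (addr0 _)).
have [x [i [Ox pq]]] := eigenvector_neq0.
have [ca [cb [cab c0]]] : exists ca cb : R, `|ca| + `|cb| <= 1 /\
    0 < `|ca * p x i 0 - cb * q x i 0|.
  case: pq => h; [exists 1, 0|exists 0, 1]; rewrite normr0 normr1 ?addr0 ?add0r.
    by rewrite mul1r mul0r subr0 normr_gt0.
  by rewrite mul1r mul0r sub0r normrN normr_gt0.
exists (cnorm Omega p q rho0 + 1), `|ca * p x i 0 - cb * q x i 0|.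
have n0 : 0 <= cnorm Omega p q rho0 by rewrite addr_ge0// vnorm_ge0.
split => //; first by lra.
move=> eps e0.
exists (Mode w (good_lin2 Omega_open Omega_nonempty (eps * ca) (- (eps * cb)) gp gq)
               (good_lin2 Omega_open Omega_nonempty (eps * cb) (eps * ca) gp gq)).
have sp := good_smooth Omega_open rho0_gt0 gp.
have sq := good_smooth Omega_open rho0_gt0 gq.
split; first reflexivity.
- split; first reflexivity.
  move=> y k Oy; rewrite /=.
  have z1 : (0 : 'cV[R]_m) k 0 = 0 by rewrite mxE.
  have [E1 E2] := eqU y k Oy.
  have L1 := linearized_lin2 u0 A_analytic B_analytic
    (eps * ca) (- (eps * cb)) k sp sq Oy.
  have L2 := linearized_lin2 u0 A_analytic B_analytic
    (eps * cb) (eps * ca) k sp sq Oy.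
  have e1 := lin2E (eps * ca) (- (eps * cb)) p q y k.
  have e2 := lin2E (eps * cb) (eps * ca) p q y k.
  have [R1 R2] := rotate_mode_eq eps ca cb E1 E2.
  split.
    exact: (etrans (congr2 (fun s t => r * s - w * t) e1 e2)
      (etrans R1 (congr2 +%R (esym L1) (esym z1)))).
  exact: (etrans (congr2 (fun s t => w * s + r * t) e1 e2)
    (etrans R2 (congr2 +%R (esym L2) (esym z1)))).
- move=> rho rr; have [rp _] := andP rr.
  have [fp' np] := mono _ _ fp rr; have [fq' nq] := mono _ _ fq rr.
  have [_ n1] := lin2_le Omega_open Omega_nonempty (eps * ca) (- (eps * cb)) rp fp' fq'.
  have [_ n2] := lin2_le Omega_open Omega_nonempty (eps * cb) (eps * ca) rp fp' fq'.
  rewrite /mode_norm /= /cnorm; apply: le_trans (lerD n1 n2) _.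
  rewrite normrN !normrM (gtr0_norm e0).
  have np0 : 0 <= vnorm Omega p rho by rewrite vnorm_ge0// ltW.
  have nq0 : 0 <= vnorm Omega q rho by rewrite vnorm_ge0// ltW.
  by apply: rotate_norm_le => //; rewrite ?np0 ?nq0.
- exists x, i; split => //; rewrite lin2E.
  have -> : eps * ca * p x i 0 + - (eps * cb) * q x i 0 =
     eps * (ca * p x i 0 - cb * q x i 0) by ring.
  by rewrite normrM (gtr0_norm e0).
Qed.

End Eigenmode.

Unset Implicit Arguments.
Set Strict Implicit.

Theorem theorem2p1 (R : realType) (d m : nat)
  (Omega : set 'cV[R]_d)
  (Omega_open : open Omega) (Omega_connected : connected Omega)
  (Omega_nonempty : Omega !=set0)
  (A : 'cV[R]_m -> 'cV[R]_m) (B : 'I_d -> 'cV[R]_m -> 'M[R]_m)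
  (A_analytic : forall i, real_analytic (fun y => A y i 0))
  (B_analytic : forall j i k, real_analytic (fun y => B j y i k))
  (u0 : 'cV[R]_d -> 'cV[R]_m)
  (u0_analytic : analytic_on Omega u0)
  (u0_stationary : forall x, Omega x -> Lcal A B u0 x = 0)
  (X : function_space m Omega) (L : unbounded_operator X)
  (L_linearization : is_linearization A B u0 L)
  (sigma_finite : spectral_bound L \is a fin_num)
  (lambda0 : R[i]) (U : X) (rho0 : R)
  (U_eigen : is_eigenvector L lambda0 U)
  (lambda0_pos : 0 < complex.Re lambda0)
  (lambda0_gt : fine (spectral_bound L) / 2 < complex.Re lambda0)
  (rho0_pos : 0 < rho0)
  (U_analytic : (GCvec Omega (fs_fun U) rho0 < +oo)%E)
  (C0 : R)
  (resolvent_bound : forall lambda : R[i],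
     2 * complex.Re lambda0 <= complex.Re lambda ->
     exists2 S : X -> X, is_resolvent L lambda S &
       forall (u : 'cV[R]_d -> 'cV[R[i]]_m) (rho : R),
         0 <= rho <= rho0 -> (GCvec Omega u rho < +oo)%E ->
         exists2 f : X, {in Omega, fs_fun f =1 u} &
           (GCvec Omega (fs_fun (S f)) rho
            <= (C0 / cmod lambda)%:E * GCvec Omega u rho)%E)
  (Q : ('cV[R]_d -> 'cV[R]_m) -> ('cV[R]_d -> 'cV[R]_m) ->
       'cV[R]_d -> 'cV[R]_m)
  (Q_bilinear : bilinear_on Omega Q)
  (Q_quadratic : forall v, smooth_on Omega v ->
     {in Omega, nonlinearity A B u0 v =1 Q v v})
  (CQ : R)
  (Q_bound : forall (u v : 'cV[R]_d -> 'cV[R]_m) (rho : R),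
     0 <= rho <= rho0 -> smooth_on Omega u -> smooth_on Omega v ->
     (Gvec Omega u rho < +oo)%E -> (Ggrad Omega v rho < +oo)%E ->
     (Gvec Omega (Q u v) rho
      <= CQ%:E * Gvec Omega u rho * Ggrad Omega v rho)%E) :
  exists eps1 rho1 : R,
    [/\ 0 < eps1, 0 < rho1 &
      forall delta1 : R, 0 < delta1 ->
      exists (T : R) (u : R -> 'cV[R]_d -> 'cV[R]_m),
        [/\ 0 < T, is_solution A B Omega T u,
            (Gvec Omega (fun x => (u 0 x - u0 x)%R) rho1 <= delta1%:E)%E &
            (eps1%:E <= Linfty Omega (fun x => (u T x - u0 x)%R))%E]].
Proof.
set r := complex.Re lambda0 in lambda0_pos lambda0_gt resolvent_bound *.
set W := `|complex.Im lambda0|.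
have [a0 [c [a00 c0 eig]]] := eigenmode Omega_open Omega_nonempty rho0_pos
  A_analytic B_analytic L_linearization U_eigen U_analytic.
pose rho1 := rho0 / 2.
have rho1_in : 0 < rho1 < rho0 by exact: good_half.
have [rho1_gt0 _] := andP rho1_in.
pose E := expR r.
have E1 : 1 <= E.
  by apply: le_trans (expR_ge1Dx r); rewrite lerDl ltW.
(* The ratio q of the majorant is k0 a, the radius being rho1 = rho0 / 2. *)
pose k0 := 16 * (2 * `|C0| * `|CQ| / r) * d%:R * expR 1 / (rho0 / 2).
have k00 : 0 <= k0.
  by rewrite /k0 !(divr_ge0, mulr_ge0)// ?expR_ge0// ltW.
have [eps eps0 [Eq_le second_le]] := amplitude a00 c0 k00 E1.
pose a := eps * a0; pose q := k0 * a.
have a_ge0 : 0 <= a by rewrite mulr_ge0// ltW.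
have q_ge0 : 0 <= q by rewrite mulr_ge0.
have [mu1 [mu1_freq mu1_driven mu1_norm [x0 [i0 [Ox0 mu1_large]]]]] := eig eps eps0.
rewrite -mu1_freq in mu1_driven.
have Qgood := Q_good_bound Omega_open Omega_nonempty Q_bound.
have [K K0 Q_le] := Q_pointwise Omega_open Omega_nonempty Q_bound rho1_in.
have mu1_freq_le : `|freq mu1| <= W by rewrite mu1_freq.
have [level [l0 l1 dvE freq_le gam_le]] := cascade Omega_open rho0_pos
  A_analytic B_analytic Q_bilinear (normr_ge0 CQ) Qgood lambda0_pos (normr_ge0 C0)
  (mode_solve Omega_open Omega_nonempty rho0_pos L_linearization lambda0_pos
     resolvent_bound) mu1_driven mu1_freq_le mu1_norm.
pose gam n := modes_norm rho1 (level n).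
have gam0 n : 0 <= gam n by exact: modes_norm_ge0 (ltW rho1_gt0).
have gamS p : gam p.+1 <= a * q ^+ p * (p.+1%:R ^+ 2)^-1.
  apply: le_trans (gam_le p rho1 rho1_in) _.
  rewrite (_ : rho0 - rho1 = rho0 / 2); last by rewrite /rho1; field.
  by rewrite (_ : _ / (rho0 / 2) = q)// /q /k0 mulrAC.
(* Uniformly for t < 1, the term of order n and its time derivative are below M n. *)
pose C := 2 * (1 + r + W) * (a * E).
pose M (n : nat) := C * 2^-1 ^+ n.
have C_ge0 : 0 <= C.
  have E0 : 0 <= E by exact: expR_ge0.
  by rewrite /C /W !mulr_ge0 ?addr_ge0// ltW.
have [M_cvg M_sum] := ssum_half C.
have level_le n t : t < 1 -> expR (n%:R * r * t) * gam n <= M n /\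
    expR (n%:R * r * t) * (n%:R * r + n%:R * W) * gam n <= M n.
  case: n => [|p] t1.
    rewrite /gam l0 /modes_norm big_nil !mulr0 /M.
    by rewrite mulr_ge0// exprn_ge0.
  exact: (level_bounds a_ge0 q_ge0 Eq_le lambda0_pos (normr_ge0 _) t1 (gam0 p.+1)
    (gamS p)).
have v_le n t : t < 1 ->
    vnorm Omega (modes_at (n%:R * r) (level n) t) rho1 <= M n.
  move=> t1; have [h _] := level_le n t t1; apply: le_trans h.
  exact: (modes_at_le Omega_open Omega_nonempty (n%:R * r) (level n) t rho1_in).2.
have dv_le n t x i : t < 1 -> Omega x ->
    `|dmodes (n%:R * r) (level n) t x i| <= M n.
  move=> t1 Ox; have [_ h] := level_le n t t1; apply: le_trans h.
  apply: dmodes_le => //; first by rewrite mulr_ge0// ltW.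
have [rhou rhou0 u0_fin] := u0_analytic.
have fu0 := Gvec_finV Omega_nonempty (ltW rhou0) u0_fin.
have u0_smooth := finV_smooth Omega_open fu0.
have u0_coord i : smooth_on Omega (coord u0 i) by exact: finG_smooth (fu0 i).
have sol T := solution_is_solution Omega_open Omega_nonempty rho0_pos A_analytic
  B_analytic Q_bilinear Q_quadratic rho1_in K0 Q_le M_cvg v_le dv_le dvE
  u0_smooth u0_coord T.
exists (eps * c / 2), rho1; split => //; first by rewrite divr_gt0// mulr_gt0.
move=> delta delta0.
pose S := ssum M; have S0 : 0 <= S by rewrite /S M_sum mulr_ge0.
pose T := (S / delta + 1) / r.
have T0 : 0 < T by rewrite divr_gt0// ltr_wpDl// divr_ge0// ltW.
(* By the inequality 1 + r T <= e^(r T), this time T suffices. *)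
have decay : expR (- (r * T)) * S <= delta.
  rewrite expRN mulrC ler_pdivrMr ?expR_gt0//.
  apply: (@le_trans _ _ (delta * (1 + r * T))).
    rewrite /T mulrC (mulrCA r) mulfV ?gt_eqF// mulr1.
    have -> : (1 + (S / delta + 1)) * delta = 2 * delta + S.
      by field; rewrite gt_eqF.
    by rewrite ler_wpDl// mulr_ge0// ltW.
  by rewrite ler_wpM2l ?(ltW delta0)// expR_ge1Dx.
set pert := perturbation (fun n => n%:R * r) level.
exists T, (solution u0 (fun n => n%:R * r) level T); split => //.
- have -> : (fun x => solution u0 (fun n => n%:R * r) level T 0 x - u0 x) = pert (- T).
    by apply/funext => x; rewrite /solution sub0r addrC addKr.
  have mT1 : - T < 1 by rewrite ltrNl (lt_trans _ T0)// ltrN10.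
  (* The terms of order n >= 1 have decayed by e^(- n r T) <= e^(- r T) at time -T. *)
  have start_le n : vnorm Omega (modes_at (n%:R * r) (level n) (- T)) rho1 <=
      expR (- (r * T)) * M n.
    apply: le_trans (modes_at_le Omega_open Omega_nonempty (n%:R * r) (level n)
      (- T) rho1_in).2 _.
    rewrite -/(gam n); case: n => [|p].
      rewrite /gam l0 /modes_norm big_nil mulr0 /M expr0 mulr1.
      by rewrite mulr_ge0// expR_ge0.
    have [h _] := level_le p.+1 0 ltr01; rewrite mulr0 expR0 mul1r in h.
    apply: ler_pM => //.
    rewrite ler_expR mulrN lerN2 -mulrA; have rT : 0 < r * T by rewrite mulr_gt0.
    by rewrite ler_peMl ?(ltW rT)// ler1n.
  have cM : cvgn (series (fun n => expR (- (r * T)) * M n)).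
    exact: (is_cvg_seriesZ (k := expR (- (r * T))) M_cvg).
  have vfin n := good_modes_at Omega_open Omega_nonempty (n%:R * r) (level n) (- T) rho1_in.
  have [fP nP] := vsum_le Omega_open Omega_nonempty rho1_gt0 vfin start_le cM.
  rewrite (GvecE Omega_nonempty (ltW rho1_gt0) fP) lee_fin.
  by apply: le_trans nP _; rewrite ssumZ.
- apply: (@le_trans _ _ `|solution u0 (fun n => n%:R * r) level T T x0 - u0 x0|%:E);
    last by apply: ereal_sup_ubound; exists x0.
  rewrite lee_fin.
  have -> : solution u0 (fun n => n%:R * r) level T T x0 - u0 x0 = pert 0 x0.
    by rewrite /solution subrr addrC addKr.
  apply: le_trans _ (norm_coord (pert 0 x0) i0 0).
  rewrite mxE; pose f n := modes_at (n%:R * r) (level n) 0 x0 i0 0.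
  have f_le n : `|f n| <= gam n.
    have ff := good_modes_at Omega_open Omega_nonempty (n%:R * r) (level n) 0 rho1_in.
    apply: le_trans (abs_le_vnorm Omega_open Omega_nonempty i0 rho1_gt0 ff Ox0) _.
    have [_ h] := modes_at_le Omega_open Omega_nonempty (n%:R * r) (level n) 0 rho1_in.
    by apply: le_trans h _; rewrite mulr0 expR0 mul1r.
  have gamM n : gam n <= M n.
    by have [h _] := level_le n 0 ltr01; rewrite mulr0 expR0 mul1r in h.
  have cf : cvgn (series f).
    apply: (dominated_cvg_series (M := M)) => // n; exact: le_trans (f_le n) (gamM n).
  have [_ tailE] := cvg_series_shift 2 cf.
  have [cg Eg] := ssum_half (a * q).
  (* The terms of order n >= 2 are at most a q^(n-1) <= a q (1/2)^(n-2). *)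
  have tail_le : `|ssum (fun n => f (n + 2)%N)| <= 2 * (a * q).
    rewrite -Eg; apply: ssum_norm_le => // n; rewrite addn2.
    apply: le_trans (f_le _) _; apply: le_trans (gamS n.+1) _.
    apply: (@le_trans _ _ (a * q ^+ n.+1)).
      apply: ler_piMr; first by rewrite mulr_ge0// exprn_ge0.
      by rewrite invf_le1 ?exprn_gt0// exprn_ege1// ler1n.
    rewrite exprS mulrA; apply: ler_wpM2l; first exact: mulr_ge0.
    apply: lerXn2r; rewrite ?nnegrE ?invr_ge0//.
    apply: le_trans Eq_le; rewrite -/a -/q.
    by rewrite ler_peMl.
  have f0 : f 0%N = 0 by rewrite /f l0 /modes_at big_nil mxE.
  have f1 : f 1%N = mre mu1 x0 i0 0.
    rewrite /f l1 modes_at_osc big_seq1 /osc !mulr0 expR0 cos0 sin0.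
    by rewrite !mulr1 mulr0 oppr0 mul0r addr0 mul1r.
  have s2 : series f 2 = mre mu1 x0 i0 0.
    by rewrite /series/= big_mkord !big_ord_recr big_ord0/= f0 f1 !add0r.
  have large : eps * c <= `|mre mu1 x0 i0 0| by exact: mu1_large.
  have : ssum f = mre mu1 x0 i0 0 + ssum (fun n => f (n + 2)%N).
    by rewrite tailE s2 addrC subrK.
  move=> ->; have := lerB_normD (mre mu1 x0 i0 0) (ssum (fun n => f (n + 2)%N)).
  have : 2 * (a * q) <= eps * c / 2 by exact: second_le.
  move: tail_le large; move: (mre mu1 x0 i0 0) (ssum _) (a * q) => z s y.
  by clear; lra.
Qed.
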